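(* Suppose that the finite range defining potential $\Phi(\sigma,\eta)$ is translation invariant and that $\mathbb P$ is asymptotically decoupled. Suppose that $K^{\bar\sigma}$ is a translation invariant joint measure constructed with the boundary condition $\bar\sigma$. Suppose that $K$ is a translation invariant probability measure on the product (joint) space, and denote by $K_d$ its marginal on the disorder variables $\eta$. Then $$h(K|K^{\bar\sigma})=h(K_d|\mathbb P)-h(K)+h(K_d)+\sum_{A\ni0}\frac1{|A|}K\big(\Phi_A(\sigma,\eta)\big)+K\Big(\lim_{\Lambda\uparrow\mathbb Z^d}\frac1{|\Lambda|}\log Z_\Lambda^{\bar\sigma}[\eta]\Big),$$ where $K(f)$ denotes the expectation of the function $f$ of $(\sigma,\eta)$ under $K$.
   Context: $E,E'$ are finite sets. Spin configurations are $\sigma\in E^{\mathbb Z^d}$, disorder configurations are $\eta\in(E')^{\mathbb Z^d}$, joint configurations are $\xi=(\sigma,\eta)=(\sigma_x,\eta_x)_{x\in\mathbb Z^d}$. The defining potential is a family $\Phi=(\Phi_A)$ of real functions indexed by finite $A\subset\mathbb Z^d$, with $\Phi_A(\xi)$ depending on $\xi$ only through $\xi_A$; it is finite range, i.e. there is $r<\infty$ with $\Phi_A=0$ whenever $\mathrm{diam}(A)>r$; it is translation invariant if $\Phi_{A+x}(\xi)=\Phi_A(\tau_x\xi)$, $(\tau_x\xi)(y)=\xi(x+y)$. For fixed $\eta$, finite $\Lambda$ and boundary condition $\bar\sigma\in E^{\mathbb Z^d}$ the quenched finite-volume Gibbs measure is $$\mu_\Lambda^{\bar\sigma}[\eta](B)=\frac1{Z_\Lambda^{\bar\sigma}[\eta]}\sum_{\sigma_\Lambda\in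 E^\Lambda}1_B(\sigma_\Lambda\bar\sigma_{\mathbb Z^d\setminus\Lambda})\exp\Big(-\sum_{A:A\cap\Lambda\ne\emptyset}\Phi_A(\sigma_\Lambda\bar\sigma_{\mathbb Z^d\setminus\Lambda},\eta)\Big),$$ with $Z_\Lambda^{\bar\sigma}[\eta]$ the normalizing partition function. $\mathbb P$ is a probability measure on $(E')^{\mathbb Z^d}$. A joint measure $K^{\bar\sigma}$ is any weak limit (product topology), along a sequence of finite volumes $\Lambda_N\uparrow\mathbb Z^d$, of the measures $\mathbb P(d\eta)\mu_{\Lambda_N}^{\bar\sigma}[\eta](d\sigma)$. $\Lambda_n=[-n,n]^d\cap\mathbb Z^d$, and limits $\Lambda\uparrow\mathbb Z^d$ are taken along this sequence (or a Van Hove sequence); $\mathcal F_\Lambda$ is the $\sigma$-field generated by the coordinates in $\Lambda$. A translation invariant probability measure $\mathbb P$ is asymptotically decoupled if there are sequences $g_n,c_n$ with $\lim_n c_n/|\Lambda_n|=0$, $\lim_n g_n/n=0$, such that for all $A\in\mathcal F_{\Lambda_n}$, $B\in\mathcal F_{\Lambda_{n+g_n}^c}$ with $\mathbb P(A)\mathbb P(B)\neq0$, $e^{-c_n}\le\frac{\mathbb P(A\cap B)}{\mathbb P(A)\mathbb P(B)}\le e^{c_n}$. For translation invariant $\mu$, $h(\mu)=-\lim_n|\Lambda_n|^{-1}\sum_{\omega_{\Lambda_n}}\mu(\omega_{\Lambda_n})\log\mu(\omega_{\Lambda_n})$ is the Kolmogorov–Sinai entropy, and $h(\mu|\nu)=\lim_n|\Lambda_n|^{-1}h_{\Lambda_n}(\mu|\nu)$,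 where $h_\Lambda(\mu|\nu)=\sum_{\omega_\Lambda}\mu(\omega_\Lambda)\log\frac{\mu(\omega_\Lambda)}{\nu(\omega_\Lambda)}$ if $\mu_\Lambda\ll\nu_\Lambda$ and $+\infty$ otherwise. *)

(* Defs.v *)
From HB Require Import structures.
From mathcomp Require Import all_boot all_order all_algebra finmap.
From mathcomp Require Import all_classical all_reals all_analysis.
From mathcomp Require Import zify.

Set Implicit Arguments.
Unset Strict Implicit.
Unset Printing Implicit Defensive.

Import Order.TTheory GRing.Theory Num.Theory.
Import numFieldNormedType.Exports.

Local Open Scope classical_set_scope.
Local Open Scope ring_scope.

(* Measurable types are pointed in the library, so a single-site space is a
   finite set with a distinguished element; that element plays no role. *)
#[short(type="finPointedType")]
HB.structure Definition FinPointed := {T of Finite T & Pointed T}.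

HB.instance Definition _ (S S' : finPointedType) := Finite.on (S * S')%type.

Notation site d := 'rV[int]_d.

Definition config (d : nat) (S : Type) := site d -> S.

HB.instance Definition _ (d : nat) (S : finPointedType) :=
  Pointed.copy (config d S) (site d -> S).

HB.instance Definition _ (d : nat) (S : finPointedType) :=
  Topological.copy (config d S) {ptws site d -> discrete_topology S}.

Definition coord_events (d : nat) (S : finPointedType) (D : set (site d)) :
    set (set (config d S)) :=
  [set C | exists x s, D x /\ C = [set xi | xi x = s]].

HB.instance Definition _ (d : nat) (S : finPointedType) :=
  Measurable.copy (config d S)
    (g_sigma_algebraType (@coord_events d S [set: site d])).

Definition cylF (d : nat) (S : finPointedType) (D : set (site d)) :
    set (set (config d S)) :=
  <<s coord_events D >>.

Definition shift_config (d : nat) (S : Type) (x : site d) (xi : config d S) :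
    config d S :=
  fun y => xi (x + y).

Definition join_config (d : nat) (E E' : Type) (sigma : config d E)
    (eta : config d E') : config d (E * E') :=
  fun x => (sigma x, eta x).

Definition disorder (d : nat) (E E' : Type) (xi : config d (E * E')) :
    config d E' :=
  fun x => (xi x).2.

Definition box (d n : nat) : {fset site d} :=
  [fset (\row_i ((v 0 i : nat)%:Z - n%:Z))%R |
    v : 'rV['I_n.*2.+1]_d in predT]%fset.

Lemma in_box (d n : nat) (x : site d) :
  (x \in box d n) = [forall i, `|x ord0 i| <= n]%N.
Proof.
apply/imfsetP/forallP => /= [[v _ ->] i|xn].
  by rewrite mxE; have := ltn_ord (v 0 i); lia.
have xn' i : (absz (x 0 i + n%:Z)%R < n.*2.+1)%N.
  by have := xn i; move: (x 0 i) => z; lia.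
exists (\row_i Ordinal (xn' i)) => //.
by apply/rowP => i; rewrite !mxE /=; have := xn i; move: (x 0 i) => z; lia.
Qed.

Definition diam (d : nat) (A : {fset site d}) : nat :=
  \max_(x <- A) \max_(y <- A) \max_(i < d) absz (x ord0 i - y ord0 i)%R.

Section potential.
Context (R : realType) (d : nat).

Definition potential (S : Type) := {fset site d} -> config d S -> R.

Definition local_potential (S : Type) (Phi : potential S) :=
  forall (A : {fset site d}) (xi xi' : config d S),
    (forall x, x \in A -> xi x = xi' x) -> Phi A xi = Phi A xi'.

Definition finite_range (S : Type) (Phi : potential S) :=
  exists r : nat, forall A : {fset site d}, (r < diam A)%N ->
    forall xi, Phi A xi = 0.

Definition potential_invariant (S : Type) (Phi : potential S) :=
  forall (A : {fset site d}) (x : site d) (xi : config d S),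
    Phi [fset (y + x)%R | y in A]%fset xi = Phi A (shift_config x xi).

Definition glue_config (E : Type) (L : {fset site d}) (s : {ffun L -> E})
    (sbar : config d E) : config d E :=
  fun x => if insub x is Some u then s u else sbar x.

Section gibbs.
Context (E : finType) (E' : Type) (Phi : potential (E * E'))
  (L : {fset site d}) (sbar : config d E).

(* \sum_(_ \in _) is the sum over the support of the summand, which is finite
   for a finite range potential. *)
Definition energy (sigma : config d E) (eta : config d E') : R :=
  \sum_(A \in [set A : {fset site d} | (A `&` L != fset0)%fset])
    Phi A (join_config sigma eta).

Definition partition_function (eta : config d E') : R :=
  \sum_(s : {ffun L -> E}) expR (- energy (glue_config s sbar) eta).

Definition gibbs (eta : config d E') (B : set (config d E)) : R :=
  (partition_function eta)^-1 *
  \sum_(s : {ffun L -> E})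
    \1_B (glue_config s sbar) * expR (- energy (glue_config s sbar) eta).

End gibbs.
End potential.

(* The measure PP(d eta) mu_L[eta](d sigma), evaluated on events. *)
Definition joint_volume (R : realType) (d : nat) (E E' : finPointedType)
    (Phi : potential R d (E * E')) (PP : probability (config d E') R)
    (L : {fset site d}) (sbar : config d E) (B : set (config d (E * E'))) :
    \bar R :=
  (\int[PP]_eta
     (gibbs Phi L sbar eta [set sigma | B (join_config sigma eta)])%:E)%E.

Definition weakly_cvg (R : realType) (d : nat) (S : finPointedType)
    (mu : nat -> probability (config d S) R)
    (nu : probability (config d S) R) :=
  forall f : config d S -> R, continuous f ->
    (exists M, forall xi, `|f xi| <= M) ->
    (\int[mu n]_xi (f xi)%:E)%E @[n --> \oo] --> (\int[nu]_xi (f xi)%:E)%E.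

(* KL N is the measure PP(d eta) mu_(L N)[eta](d sigma) itself: the displayed
   identity determines it, and such a probability exists as soon as Phi is local
   and of finite range, since mu_L[eta] is then a local function of eta. *)
Definition joint_measure (R : realType) (d : nat) (E E' : finPointedType)
    (Phi : potential R d (E * E')) (PP : probability (config d E') R)
    (sbar : config d E) (K : probability (config d (E * E')) R) :=
  exists (L : nat -> {fset site d})
         (KL : nat -> probability (config d (E * E')) R),
    [/\ forall N, (L N `<=` L N.+1)%fset,
        forall x, exists N, x \in L N,
        forall N B, measurable B ->
          KL N B = joint_volume Phi PP (L N) sbar B
      & weakly_cvg KL K].

Section invariant_measures.
Context (R : realType) (d : nat) (S : finPointedType).
Implicit Types mu nu : set (config d S) -> \bar R.

Definition invariant_measure mu :=
  forall (x : site d) (A : set (config d S)), measurable A ->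
    mu (shift_config x @^-1` A) = mu A.

Definition asymptotically_decoupled mu :=
  invariant_measure mu /\
  exists (g : nat -> nat) (c : nat -> R),
    [/\ (c n / #|` box d n|%:R) @[n --> \oo] --> (0 : R),
        ((g n)%:R / n%:R) @[n --> \oo] --> (0 : R)
      & forall n (A B : set (config d S)),
          cylF [set` box d n] A -> cylF (~` [set` box d (n + g n)]) B ->
          (mu A * mu B != 0)%E ->
          expR (- c n) <= fine (mu (A `&` B)) / (fine (mu A) * fine (mu B))
            <= expR (c n)].

Definition cylinder (L : {fset site d}) (w : {ffun L -> S}) :
    set (config d S) :=
  [set xi | forall x : L, xi (val x) = w x].

(* Since ln 0 = 0, terms with mu (cylinder w) = 0 vanish below. *)
Definition entropy_density mu (n : nat) : R :=
  (#|` box d n|%:R)^-1 *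
  \sum_(w : {ffun box d n -> S})
    fine (mu (cylinder w)) * ln (fine (mu (cylinder w))).

(* limn has a default value on divergent sequences: entropy and rel_entropy are
   meaningful only together with convergence of the densities. *)
Definition entropy mu : R := - limn (entropy_density mu).

Definition rel_entropy_volume (L : {fset site d}) mu nu : \bar R :=
  if `[< forall A, cylF [set` L] A -> nu A = 0%E -> mu A = 0%E >] then
    (\sum_(w : {ffun L -> S}) fine (mu (cylinder w)) *
       ln (fine (mu (cylinder w)) / fine (nu (cylinder w))))%:E
  else +oo%E.

Definition rel_entropy_density mu nu (n : nat) : \bar R :=
  (((#|` box d n|%:R)^-1)%:E * rel_entropy_volume (box d n) mu nu)%E.

Definition rel_entropy mu nu : \bar R := limn (rel_entropy_density mu nu).

End invariant_measures.

Definition pressure_density (R : realType) (d : nat) (E : finType) (E' : Type)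
    (Phi : potential R d (E * E')) (sbar : config d E) (eta : config d E')
    (n : nat) : R :=
  (#|` box d n|%:R)^-1 * ln (partition_function Phi (box d n) sbar eta).

(* Main.v *)
Require Import Defs.
From HB Require Import structures.
From mathcomp Require Import all_boot all_order all_algebra finmap.
From mathcomp Require Import all_classical all_reals all_analysis measurable_realfun.
From mathcomp Require Import zify ring lra.

Set Implicit Arguments.
Unset Strict Implicit.
Unset Printing Implicit Defensive.

Import Order.TTheory GRing.Theory Num.Theory.
Import numFieldNormedType.Exports.

Local Open Scope classical_set_scope.
Local Open Scope ring_scope.

(** Write [Ln] for the box of radius [n] and [eta] for the disorder. The whole
    argument rests on one estimate: on the cylinder of a joint configuration
    [xi] over [Ln],

      Ks(xi on Ln) = PP(eta on Ln) exp(- H(xi)) / Z(eta), up to exp(O(boundary)),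

    where [H] and [Z] are the energy and the partition function of [Ln] with
    free boundary ([joint_measure_bounds]). It holds because a Gibbs measure of
    any larger volume, conditioned on the spins outside [Ln], is a Gibbs measure
    in [Ln], and boundary spins change energies by at most a constant times the
    size of the boundary; the bounds do not depend on the larger volume, so they
    survive the weak limit. Taking logarithms and integrating with respect to
    [K] splits the relative entropy on [Ln] into the five terms of the formula,
    up to a boundary error ([relent_joint]). In particular absolute continuity
    on [Ln] holds for the joint measures exactly when it holds for the disorder
    marginals, so both sides are infinite together. What remains is to divide by
    the volume and to show that every term converges.

    Entropy is subadditive, and relative entropy with respect to an
    asymptotically decoupled measure is almost superadditive for sets separated
    by a gap. Both follow from one form of Gibbs' inequality ([gibbs_ineq]) and
    give convergence along boxes by tiling a large box with small ones
    ([tiling_le], [cvg_of_frequently]); the limit of the relative entropy may be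
    infinite. The mean energy per site converges because each interaction can be
    shared equally among its sites ([inner_energy_site_energy]).

    The logarithm of [Z] is additive over disjoint sets up to a boundary error,
    so that its density is close to an average over translates of a local
    function ([lnZfree_avg]). Almost sure convergence of the pressure therefore
    reduces to the pointwise ergodic theorem for averages of bounded functions
    over boxes ([ergodic_ae]). It is proved from the Vitali covering argument
    ([covering_count], [maximal_ineq]) and from a mean ergodic theorem that needs
    only the parallelogram identity ([mean_cauchy2]). Dominated convergence then
    handles the last term. *)

(** * Boxes and their translates *)

Section lattice.
Variable d : nat.
Implicit Types (x y z : site d) (L A : {fset site d}).

Definition translate x L : {fset site d} := [fset (y + x)%R | y in L]%fset.

Lemma in_translate x L y : (y \in translate x L) = (y - x \in L).
Proof.
apply/imfsetP/idP => /= [[z zL ->]|yL]; first by rewrite addrK.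
by exists (y - x) => //; rewrite subrK.
Qed.

Lemma card_translate x L : #|` translate x L| = #|` L|.
Proof. by rewrite card_imfset //; exact: addIr. Qed.

Lemma in_box_le n y : (y \in box d n) <-> (forall i, absz (y ord0 i) <= n)%N.
Proof. by rewrite in_box; split => [/forallP//|h]; apply/forallP. Qed.

Lemma in_cube x n y :
  (y \in translate x (box d n)) <->
  (forall i, absz (y ord0 i - x ord0 i) <= n)%N.
Proof.
rewrite in_translate in_box_le; split=> h i; have := h i; by rewrite !mxE.
Qed.

Definition vol n : nat := #|` box d n|.

Lemma volE n : vol n = (n.*2.+1 ^ d)%N.
Proof.
rewrite /vol /box card_imfset /=; last first.
  move=> v w /rowP h; apply/rowP => i; have := h i; rewrite !mxE => hi.
  by apply/val_inj => /=; lia.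
transitivity #|{: 'rV['I_n.*2.+1]_d}|; last by rewrite card_mx card_ord mul1n.
by rewrite cardE.
Qed.

Lemma vol_gt0 n : (0 < vol n)%N.
Proof. by rewrite volE expn_gt0. Qed.

Lemma leq_vol m n : (m <= n)%N -> (vol m <= vol n)%N.
Proof.
move=> mn; rewrite !volE; elim: (d) => [|e IH]; first by rewrite !expn0.
by rewrite !expnS leq_mul // ltnS leq_double.
Qed.

Lemma box_sub m n : (m <= n)%N -> (box d m `<=` box d n)%fset.
Proof.
move=> mn; apply/fsubsetP => y /in_box_le h; apply/in_box_le => i.
exact: leq_trans mn.
Qed.

Lemma cube_sub x k m n : x \in box d k -> (k + m <= n)%N ->
  (translate x (box d m) `<=` box d n)%fset.
Proof.
move=> /in_box_le xk kmn; apply/fsubsetP => y /in_cube h; apply/in_box_le => i.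
by move: (xk i) (h i); lia.
Qed.

Lemma sum_translate (V : nmodType) x L (f : site d -> V) :
  \sum_(y <- translate x L) f y = \sum_(y <- L) f (y + x).
Proof. by rewrite big_imfset //= => y z _ _; exact: addIr. Qed.

Lemma sum_fsetD_le (R : numDomainType) A L (f : site d -> R) (M : R) :
  (A `<=` L)%fset -> (forall y, `|f y| <= M) ->
  `|\sum_(y <- L) f y - \sum_(y <- A) f y| <= M * (#|` L|%:R - #|` A|%:R).
Proof.
move=> AL fM; rewrite (big_fsetID _ (mem A)) /=.
have -> : [fset x in L | x \in A]%fset = A.
  by apply/fsetP => y; rewrite !inE /= andbC; case: (boolP (y \in A)) => //= yA;
    rewrite (fsubsetP AL).
have -> : [fset x in L | x \notin A]%fset = (L `\` A)%fset.
  by apply/fsetP => y; rewrite !inE /= andbC.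
rewrite [X in `|X|]addrC addKr.
apply: le_trans (ler_norm_sum _ _ _) _.
apply: (le_trans (ler_sum _ (fun y _ => fM y))).
rewrite big_const_seq count_predT iter_addr addr0.
by rewrite cardfsDS // -natrB ?fsubset_leq_card // mulr_natr.
Qed.

(** The box and its translate share the box of radius [n - k], so the two sums
    differ only on their outer layers. *)
Lemma sum_box_translate (R : realDomainType) n k x (f : site d -> R) (M : R) :
  (k <= n)%N -> x \in box d k -> (forall y, `|f y| <= M) ->
  `|\sum_(y <- box d n) f (y + x) - \sum_(y <- box d n) f y| <=
    2 * M * ((vol n)%:R - (vol (n - k))%:R).
Proof.
move=> kn xk fM; rewrite -sum_translate.
have s1 : (box d (n - k) `<=` box d n)%fset by apply: box_sub; exact: leq_subr.
have s2 : (box d (n - k) `<=` translate x (box d n))%fset.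
  apply/fsubsetP => y /in_box_le h; apply/in_cube => i.
  by move: xk => /in_box_le /(_ i); move: (h i); lia.
have := sum_fsetD_le s1 fM; have := sum_fsetD_le s2 fM.
rewrite card_translate -/(vol n) -/(vol (n - k)) => h2 h1.
apply: le_trans (ler_distD (\sum_(y <- box d (n - k)) f y) _ _) _.
by rewrite [X in _ + X]distrC -mulrA mulr2n mulrDl !mul1r lerD.
Qed.

End lattice.
Arguments vol : clear implicits.

(** * Tilings of a box *)
Section tiling.
Variable d : nat.
Implicit Types (x y z : site d) (L A : {fset site d}).

Definition tiles (m : nat) (s : seq (site d)) : {fset site d} :=
  (\bigcup_(x <- s) translate x (box d m))%fset.

Lemma in_tiles m s y :
  (y \in tiles m s) = has (fun x => y \in translate x (box d m)) s.
Proof.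
rewrite /tiles; elim: s => [|x s IH]; first by rewrite big_nil inE.
by rewrite big_cons inE IH.
Qed.

Lemma tiles_cons m x s : tiles m (x :: s) = (translate x (box d m) `|` tiles m s)%fset.
Proof. by rewrite /tiles big_cons. Qed.

Definition residue (l : nat) (x : site d) : 'rV['I_l.+1]_d :=
  \row_i inord (absz ((x ord0 i) %% (l.+1)%:Z)%Z).

(** Congruent integers that differ do so by at least the modulus. *)
Lemma residue_sep l x y : residue l x = residue l y -> x != y ->
  exists i, (l < absz (x ord0 i - y ord0 i))%N.
Proof.
move=> /rowP res xy.
have [i xyi] : exists i, x ord0 i != y ord0 i.
  by apply/existsP; apply: contraNT xy; rewrite negb_exists => /forallP h;
     apply/eqP/rowP => i; apply/eqP; move: (h i); rewrite negbK.
exists i; have := res i; rewrite !mxE => /(congr1 val) /=.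
move: (x ord0 i) (y ord0 i) xyi => {res} a b ab.
have lt (c : int) : (absz (c %% (l.+1)%:Z)%Z < l.+1)%N.
  by have := modz_ge0 c (d := (l.+1)%:Z) isT; have := ltz_pmod c (d := (l.+1)%:Z) isT; lia.
rewrite !inordK // => e.
have {}e : (a %% (l.+1)%:Z)%Z = (b %% (l.+1)%:Z)%Z.
  have := modz_ge0 a (d := (l.+1)%:Z) isT; have := modz_ge0 b (d := (l.+1)%:Z) isT; lia.
have dv : (l.+1%:Z %| a - b)%Z by rewrite -eqz_mod_dvd; apply/eqP.
apply: dvdn_leq; last by rewrite dvdzE /= in dv.
by lia.
Qed.

(* The gap [g] around a tile is what decoupling requires; quantities that are
   additive over adjacent sets take [g = 0]. *)
Variables (R : realFieldType) (F : {fset site d} -> R) (b : site d -> R) (C : R).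
Variables m g : nat.
Hypothesis F_tile : forall x L, [disjoint translate x (box d (m + g)) & L]%fset ->
  F (translate x (box d m) `|` L)%fset <= b x + F L.
Hypothesis F_mono : forall L A, (L `<=` A)%fset ->
  F A <= F L + C * (#|` A|%:R - #|` L|%:R).
Hypothesis F_fset0 : F fset0 <= 0.

Lemma tiles_le s : uniq s -> {in s &, forall x y, x != y ->
    exists i, ((m + g).*2 < absz (x ord0 i - y ord0 i))%N} ->
  F (tiles m s) <= \sum_(x <- s) b x /\ #|` tiles m s| = (size s * vol d m)%N.
Proof.
elim: s => [_ _|x s IH /= /andP[xs us] sep].
  by rewrite /tiles !big_nil cardfs0.
have [|IHF IHc] := IH us; first by move=> y z ys zs; apply: sep; rewrite inE ?ys ?zs orbT.
have dis k : (k <= m + g)%N -> [disjoint translate x (box d k) & tiles m s]%fset.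
  move=> kmg; apply/fdisjointP => z /in_cube zx; rewrite in_tiles.
  apply/hasPn => y ys; apply/negP => /in_cube zy.
  have [|||i] := sep x y; rewrite ?inE ?eqxx ?ys ?orbT //.
    by apply: contraNneq xs => ->.
  by move: (zx i) (zy i); lia.
rewrite tiles_cons big_cons; split.
  by apply: le_trans (F_tile _) _; rewrite ?lerD2l //; exact: dis.
rewrite cardfsU; have := dis m (leq_addr _ _).
by move=> /disjoint_fsetI0 ->; rewrite cardfs0 subn0 card_translate IHc mulSn.
Qed.

(** Averaging over all offsets of the grid of tiles makes every centre count
    exactly once, so that no exact count of the tiles of one grid is needed. *)
Lemma tiling_le n : (m <= n)%N ->
  (vol d (m + g))%:R * F (box d n) <=
  \sum_(x <- box d (n - m)) b x +
    C * ((vol d (m + g))%:R * (vol d n)%:R - (vol d m)%:R * (vol d (n - m))%:R).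
Proof.
move=> mn; pose res := residue (m + g).*2.
pose T a := [seq x <- box d (n - m) | res x == a].
have one a : F (box d n) <= \sum_(x <- T a) b x +
    C * ((vol d n)%:R - (size (T a) * vol d m)%:R).
  have [||leT cardT] := @tiles_le (T a); first exact/filter_uniq/fset_uniq.
    move=> x y; rewrite !mem_filter => /andP[/eqP xa _] /andP[/eqP ya _].
    by apply: residue_sep; rewrite -/res xa.
  have sT : (tiles m (T a) `<=` box d n)%fset.
    apply/fsubsetP => y; rewrite in_tiles => /hasP[x].
    rewrite mem_filter => /andP[_ xb]; apply: (fsubsetP (cube_sub xb _)).
    by rewrite subnK.
  apply: le_trans (F_mono sT) _; rewrite -cardT -/(vol d n).
  by rewrite lerD2r.
have card_res : (#|{: 'rV['I_(m + g).*2.+1]_d}| = vol d (m + g))%N.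
  rewrite volE card_mx card_ord mul1n; exact: erefl.
rewrite [leLHS]mulr_natl -[X in _ *+ X]card_res -sumr_const.
apply: le_trans (ler_sum _ (fun a _ => one a)) _.
rewrite big_split /= -big_distrr /= sumrB sumr_const card_res.
have part (V : nmodType) (f : site d -> V) :
    \sum_(x <- box d (n - m)) f x =
    \sum_(a : 'rV['I_(m + g).*2.+1]_d) \sum_(x <- T a) f x.
  rewrite (partition_big res predT) //; apply: eq_bigr => a _.
  by rewrite /T big_filter.
rewrite part lerD2l.
have <- : \sum_(a : 'rV['I_(m + g).*2.+1]_d) ((size (T a) * vol d m)%:R : R) =
    (vol d m)%:R * (vol d (n - m))%:R.
  rewrite -natr_sum -big_distrl /= mulnC -natrM; congr (_ * _)%:R.
  by rewrite /vol -sum1_size part; apply: eq_bigr => a _; rewrite sum1_size.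
by rewrite mulr_natl mulrC.
Qed.

End tiling.

(** * A covering lemma for boxes *)
Section covering.
Variables (d : nat) (R : realFieldType).
Implicit Types (x y z : site d) (P W : {fset site d}).

Lemma vol_double n : (vol d n.*2 <= 3 ^ d * vol d n)%N.
Proof.
rewrite !volE -expnMn; move: (d) => e.
by elim: e => // e IH; rewrite !expnS leq_mul //; lia.
Qed.

(** The finite Vitali selection: remove the largest box, discard the centres
    within twice its radius, and iterate. The discarded centres fill at most the
    doubled box, and the boxes around the surviving centres avoid the removed
    one because no radius exceeds that of the removed box. *)
Lemma covering_count (a : site d -> R) (lam : R) (n : site d -> nat) P W :
  0 <= lam -> (forall x, 0 <= a x) ->
  (forall x, x \in P -> (translate x (box d (n x)) `<=` W)%fset) ->
  (forall x, x \in P ->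
     lam * (vol d (n x))%:R <= \sum_(y <- translate x (box d (n x))) a y) ->
  lam * #|` P|%:R <= 3 ^+ d * \sum_(y <- W) a y.
Proof.
move=> lam0 a0; have [k] := ubnP #|` P|; elim: k P W => // k IH P W /ltnSE cardP PW avg.
have [->|[x0 x0P]] := fset_0Vmem P.
  by rewrite cardfs0 mulr0 mulr_ge0 ?exprn_ge0 ?sumr_ge0.
have [x xP xmax] : exists2 x, x \in P & forall y, y \in P -> (n y <= n x)%N.
  have [i _ imax] := @arg_maxnP P [` x0P]%fset predT (fun i => n (val i)) isT.
  by exists (val i); [exact: valP | move=> y yP; exact: (imax [` yP]%fset isT)].
pose B := translate x (box d (n x)).
pose P' := [fset y in P | y \notin translate x (box d (n x).*2)]%fset.
have P'P : (P' `<=` P)%fset by apply/fsubsetP => y; rewrite !inE => /andP[].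
have disc : (#|` P| <= #|` P'| + vol d (n x).*2)%N.
  rewrite /vol -(card_translate x (box d _)) -(cardfsUI P').
  apply: leq_trans (leq_addr _ _); apply/fsubset_leq_card/fsubsetP => y yP.
  by rewrite !inE yP /=; case: (_ \in _).
have P'lt : (#|` P'| < k)%N.
  apply: leq_trans cardP; rewrite (cardfsD1 x P) xP ltnS.
  apply/fsubset_leq_card/fsubsetP => y; rewrite !inE => /andP[yP yx].
  rewrite yP andbT; apply: contraNneq yx => ->; apply/in_cube => i.
  by rewrite subrr.
have inW : (B `<=` W)%fset := PW x xP.
have step : lam * #|` P'|%:R <= 3 ^+ d * \sum_(y <- (W `\` B)%fset) a y.
  apply: IH => // y; rewrite !inE => /andP[yP yx]; last exact: avg.
  apply/fsubsetP => z zy; rewrite inE (fsubsetP (PW y yP)) // andbT.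
  apply: contra yx => zx; apply/in_cube => i.
  move: zx zy => /in_cube /(_ i) + /in_cube /(_ i); have := xmax y yP; lia.
have {}disc : lam * #|` P|%:R <= lam * #|` P'|%:R + 3 ^+ d * (lam * (vol d (n x))%:R).
  rewrite mulrCA -natrX -natrM -mulrDr -natrD ler_wpM2l // ler_nat.
  by apply: leq_trans disc _; rewrite leq_add2l vol_double.
apply: le_trans disc _; rewrite (big_fsetID _ (mem B)) /= mulrDr addrC.
have -> : [fset y in W | y \in B]%fset = B.
  by apply/fsetP => y; rewrite !inE /= andbC; case: (boolP (y \in B)) => //= yB;
    rewrite (fsubsetP inW).
have -> : [fset y in W | y \notin B]%fset = (W `\` B)%fset.
  by apply/fsetP => y; rewrite !inE /= andbC.
by rewrite lerD // ler_wpM2l ?exprn_ge0 // avg.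
Qed.

End covering.

(** * Asymptotics of volumes *)
Lemma cvg_to_eq (R : realType) (u : nat -> R) (l l' : R) :
  u n @[n --> \oo] --> l -> l = l' -> u n @[n --> \oo] --> l'.
Proof. by move=> ? <-. Qed.

Section asymptotics.
Variables (d : nat) (R : realType).

(** Volumes are powers of side lengths, so it is enough that the quotient of the
    side lengths tends to one. *)
Lemma vol_ratio (a b : nat -> nat) : (forall n, a n <= b n)%N ->
  ((b n - a n)%:R / n.+1%:R : R) @[n --> \oo] --> (0 : R) ->
  (forall n, n <= b n)%N ->
  ((vol d (a n))%:R / (vol d (b n))%:R : R) @[n --> \oo] --> (1 : R).
Proof.
move=> ab r0 bn.
have -> : (fun n => (vol d (a n))%:R / (vol d (b n))%:R : R) =
    (fun n => (1 - (b n - a n).*2%:R / (b n).*2.+1%:R) ^+ d).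
  apply/funext => n; rewrite !volE !natrX -exprVn -exprMn; congr (_ ^+ _).
  have -> : (b n).*2.+1 = ((a n).*2.+1 + (b n - a n).*2)%N by have := ab n; lia.
  have : ((a n).*2.+1 + (b n - a n).*2)%:R != 0 :> R by rewrite pnatr_eq0.
  by rewrite natrD => h; field.
have h : (1 - (b n - a n).*2%:R / (b n).*2.+1%:R : R) @[n --> \oo] --> (1 : R).
  apply: (cvg_to_eq _ (subr0 (1 : R))); apply: cvgB; first exact: cvg_cst.
  apply: (@squeeze_cvgr _ _ _ _ (fun=> 0) (fun n => 2 * ((b n - a n)%:R / n.+1%:R))).
  - apply: nearW => n; apply/andP; split; first by rewrite divr_ge0.
    rewrite mulrA -natrM mul2n ler_wpM2l // lef_pV2 ?posrE ?ltr0n // ler_nat ltnS.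
    by apply: leq_trans (bn n) _; rewrite -addnn leq_addr.
  - exact: cvg_cst.
  - by apply: (cvg_to_eq _ (mulr0 (2 : R))); apply: cvgM => //; exact: cvg_cst.
elim: (d) => [|e IH]; first by under eq_fun do rewrite expr0; exact: cvg_cst.
under eq_fun do rewrite exprS.
by apply: (cvg_to_eq _ (mulr1 (1 : R))); apply: cvgM.
Qed.

Lemma cvg_cst_div k : (k%:R / n.+1%:R : R) @[n --> \oo] --> (0 : R).
Proof. by apply: (cvg_to_eq _ (mulr0 (k%:R : R))); apply: cvgM; [exact: cvg_cst|exact: cvg_harmonic]. Qed.

(** The Folner property of boxes, which makes boundary errors vanish per site. *)
Lemma vol_layer k :
  (((vol d n)%:R - (vol d (n - k))%:R) / (vol d n)%:R : R) @[n --> \oo] --> (0 : R).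
Proof.
have -> : (fun n => ((vol d n)%:R - (vol d (n - k))%:R) / (vol d n)%:R : R) =
    (fun n => 1 - (vol d (n - k))%:R / (vol d n)%:R).
  by apply/funext => n; rewrite mulrBl divff // pnatr_eq0 -lt0n vol_gt0.
apply: (cvg_to_eq _ (subrr (1 : R))); apply: cvgB; first exact: cvg_cst.
apply: (@vol_ratio (fun n => n - k)%N (fun n => n)) => //.
  by move=> n; exact: leq_subr.
apply: (@squeeze_cvgr _ _ _ _ (fun=> 0) (fun n => k%:R / n.+1%:R)).
- apply: nearW => n; apply/andP; split; first by rewrite divr_ge0.
  by rewrite ler_wpM2r // ler_nat; lia.
- exact: cvg_cst.
- exact: cvg_cst_div.
Qed.

Lemma vol_enlarge (g : nat -> nat) : ((g n)%:R / n%:R : R) @[n --> \oo] --> (0 : R) ->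
  ((vol d n)%:R / (vol d (n + g n))%:R : R) @[n --> \oo] --> (1 : R).
Proof.
move=> g0; apply: (@vol_ratio (fun n => n) (fun n => (n + g n)%N)).
- by move=> n; exact: leq_addr.
- apply: (@squeeze_cvgr _ _ _ _ (fun=> 0) (fun n => (g n)%:R / n%:R)) => //.
  + near=> n; apply/andP; split; first by rewrite divr_ge0.
    rewrite addKn ler_wpM2l // lef_pV2 ?posrE ?ltr0n // ?ler_nat //.
    by near: n; exact: nbhs_infty_gt.
  + exact: cvg_cst.
- by move=> n; exact: leq_addr.
Unshelve. all: by end_near.
Qed.

End asymptotics.

(** * Expectations of bounded measurable functions *)
Section bounded_expectation.
Context {disp : measure_display} {T : measurableType disp} {R : realType}.
Implicit Types (f g : T -> R) (P : probability T R).

(** A class of observables, closed under all the operations used below, on which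
    expectations are linear and monotone without further conditions. *)
Definition bounded_mfun f :=
  measurable_fun setT f /\ exists M, forall x, `|f x| <= M.

Definition Ex P f : R := \int[P]_x f x.

Lemma bounded_mfun_integrable P f :
  bounded_mfun f -> P.-integrable setT (EFin \o f).
Proof.
move=> [mf [M fM]]; apply: measurable_bounded_integrable => //.
  by apply: le_lt_trans (ltry 1); exact: (probability_le1 P measurableT).
by exists M; split; [rewrite num_real|move=> y My x _; exact: le_trans (fM x) (ltW My)].
Qed.

Lemma bounded_mfun_cst (c : R) : bounded_mfun (fun=> c).
Proof. by split; [exact: measurable_cst|exists `|c|]. Qed.

Lemma bounded_mfunD f g :
  bounded_mfun f -> bounded_mfun g -> bounded_mfun (fun x => f x + g x).
Proof.
move=> [mf [M fM]] [mg [N gN]]; split; first exact: measurable_funD.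
by exists (M + N) => x; apply: le_trans (ler_normD _ _) _; apply: lerD.
Qed.

Lemma bounded_mfunM f g :
  bounded_mfun f -> bounded_mfun g -> bounded_mfun (fun x => f x * g x).
Proof.
move=> [mf [M fM]] [mg [N gN]]; split; first exact: measurable_funM.
by exists (M * N) => x; rewrite normrM ler_pM.
Qed.

Lemma bounded_mfunZ (c : R) f : bounded_mfun f -> bounded_mfun (fun x => c * f x).
Proof. by move=> bf; apply: bounded_mfunM => //; exact: bounded_mfun_cst. Qed.

Lemma bounded_mfunN f : bounded_mfun f -> bounded_mfun (fun x => - f x).
Proof.
by move=> bf; have := bounded_mfunZ (-1) bf; under eq_fun do rewrite mulN1r.
Qed.

Lemma bounded_mfunB f g :
  bounded_mfun f -> bounded_mfun g -> bounded_mfun (fun x => f x - g x).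
Proof. by move=> bf bg; apply: bounded_mfunD => //; exact: bounded_mfunN. Qed.

Lemma bounded_mfun_norm f : bounded_mfun f -> bounded_mfun (fun x => `|f x|).
Proof.
move=> [mf [M fM]]; split; first exact: measurableT_comp.
by exists M => x; rewrite normr_id.
Qed.

Lemma bounded_mfun_sum (I : Type) (s : seq I) (F : I -> T -> R) :
  (forall i, bounded_mfun (F i)) -> bounded_mfun (fun x => \sum_(i <- s) F i x).
Proof.
move=> bF; elim: s => [|i s IH].
  by under eq_fun do rewrite big_nil; exact: bounded_mfun_cst.
by under eq_fun do rewrite big_cons; exact: bounded_mfunD.
Qed.

Section expectation.
Variable P : probability T R.

Lemma ExD f g : bounded_mfun f -> bounded_mfun g ->
  Ex P (fun x => f x + g x) = Ex P f + Ex P g.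
Proof. by move=> bf bg; apply: RintegralD => //; exact: bounded_mfun_integrable. Qed.

Lemma ExB f g : bounded_mfun f -> bounded_mfun g ->
  Ex P (fun x => f x - g x) = Ex P f - Ex P g.
Proof. by move=> bf bg; apply: RintegralB => //; exact: bounded_mfun_integrable. Qed.

Lemma ExZ (c : R) f : bounded_mfun f -> Ex P (fun x => c * f x) = c * Ex P f.
Proof. by move=> bf; apply: RintegralZl => //; exact: bounded_mfun_integrable. Qed.

Lemma ExN f : bounded_mfun f -> Ex P (fun x => - f x) = - Ex P f.
Proof.
by move=> bf; rewrite -[RHS]mulN1r -ExZ //; under [RHS]eq_Rintegral do rewrite mulN1r.
Qed.

Lemma Ex_cst (c : R) : Ex P (fun=> c) = c.
Proof. 
rewrite /Ex Rintegral_cst // -[RHS]mulr1; congr (_ * _).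
exact: (congr1 fine (probability_setT P)). Qed.

Lemma le_Ex f g : bounded_mfun f -> bounded_mfun g ->
  (forall x, f x <= g x) -> Ex P f <= Ex P g.
Proof. by move=> bf bg fg; apply: le_Rintegral => //; exact: bounded_mfun_integrable. Qed.

Lemma Ex_ge0 f : (forall x, 0 <= f x) -> 0 <= Ex P f.
Proof. by move=> f0; apply: Rintegral_ge0 => x _. Qed.

Lemma Ex_sum (I : Type) (s : seq I) (F : I -> T -> R) :
  (forall i, bounded_mfun (F i)) ->
  Ex P (fun x => \sum_(i <- s) F i x) = \sum_(i <- s) Ex P (F i).
Proof.
move=> bF; elim: s => [|i s IH].
  rewrite big_nil -[RHS](Ex_cst 0); congr (Ex P _).
  by apply/funext => x; rewrite big_nil.
rewrite big_cons -IH -ExD //; last exact: bounded_mfun_sum.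
by congr (Ex P _); apply/funext => x; rewrite big_cons.
Qed.

Lemma Ex_close f g (e : R) : bounded_mfun f -> bounded_mfun g ->
  (forall x, `|f x - g x| <= e) -> `|Ex P f - Ex P g| <= e.
Proof.
move=> bf bg fg; rewrite -ExB // ler_norml.
have bB := bounded_mfunB bf bg.
rewrite -[X in X <= _ <= _](Ex_cst (- e)) -[X in _ <= _ <= X](Ex_cst e).
apply/andP; split; apply: le_Ex => //; try exact: bounded_mfun_cst.
all: by move=> x; move: (fg x); rewrite ler_norml => /andP[].
Qed.

Lemma EFin_Ex f : bounded_mfun f -> (Ex P f)%:E = (\int[P]_x (f x)%:E)%E.
Proof.
move=> bf; rewrite /Ex /Rintegral fineK //.
exact: integrable_fin_num (bounded_mfun_integrable P bf).
Qed.

End expectation.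
End bounded_expectation.

Lemma Ex_pushforward (disp disp' : measure_display) (T : measurableType disp)
    (T' : measurableType disp') (R : realType) (P : probability T R)
    (P' : probability T' R) (phi : T -> T') (f : T' -> R) :
  measurable_fun setT phi -> (forall A, measurable A -> P (phi @^-1` A) = P' A) ->
  bounded_mfun f -> Ex P (f \o phi) = Ex P' f.
Proof.
move=> mphi PP' bf; rewrite /Ex /Rintegral; congr fine.
rewrite (eq_measure_integral (pushforward P phi)); last first.
  by move=> A mA _; symmetry; exact: PP'.
rewrite integral_pushforward //.
- by apply/measurable_EFinP; case: bf.
- apply: (bounded_mfun_integrable P (f := f \o phi)); case: bf => mf [M fM].
  by split; [exact: measurableT_comp|exists M => x; exact: fM].
Qed.

Lemma bounded_mfun_comp (disp disp' : measure_display) (T : measurableType disp)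
    (T' : measurableType disp') (R : realType) (phi : T -> T') (f : T' -> R) :
  measurable_fun setT phi -> bounded_mfun f -> bounded_mfun (f \o phi).
Proof.
move=> mphi [mf [M fM]].
by split; [exact: measurableT_comp|exists M => x; exact: fM].
Qed.

(** * Local observables and sums over local configurations *)
Section local_functions.
Variable d : nat.
Implicit Types L A : {fset site d}.

Definition agree (S : Type) L (xi xi' : config d S) :=
  forall x, x \in L -> xi x = xi' x.

Definition local_on (S T : Type) L (f : config d S -> T) :=
  forall xi xi', agree L xi xi' -> f xi = f xi'.

Lemma agree_sym (S : Type) L (xi xi' : config d S) :
  agree L xi xi' -> agree L xi' xi.
Proof. by move=> h x xL; rewrite h. Qed.

Lemma agree_trans (S : Type) L (xi1 xi2 xi3 : config d S) :
  agree L xi1 xi2 -> agree L xi2 xi3 -> agree L xi1 xi3.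
Proof. by move=> h1 h2 x xL; rewrite h1 ?h2. Qed.

Lemma agreeU (S : Type) L A (xi xi' : config d S) :
  agree (L `|` A)%fset xi xi' <-> agree L xi xi' /\ agree A xi xi'.
Proof.
split=> [h|[hL hA] x]; first by split=> x xL; apply: h; rewrite inE xL ?orbT.
by rewrite inE => /orP[]; [exact: hL|exact: hA].
Qed.

Lemma agree_sub (S : Type) L A (xi xi' : config d S) :
  (L `<=` A)%fset -> agree A xi xi' -> agree L xi xi'.
Proof. by move=> /fsubsetP LA h x /LA; exact: h. Qed.

Lemma shift_configD (S : Type) (x y : site d) (xi : config d S) :
  shift_config x (shift_config y xi) = shift_config (x + y) xi.
Proof. by apply/funext => z; rewrite /shift_config addrA [y + x]addrC. Qed.

Lemma shift_config0 (S : Type) (xi : config d S) : shift_config 0 xi = xi.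
Proof. by apply/funext => z; rewrite /shift_config add0r. Qed.

Lemma agree_shift (S : Type) L x (xi xi' : config d S) :
  agree L (shift_config x xi) (shift_config x xi') <->
  agree (translate x L) xi xi'.
Proof.
split=> h y; last by move=> yL; apply: h; rewrite in_translate addrC addKr.
rewrite in_translate => /h; by rewrite /shift_config addrC subrK.
Qed.

Lemma local_on_disorder (S S' T : Type) L (f : config d S' -> T) :
  local_on L f -> local_on L (f \o @disorder d S S').
Proof. by move=> h xi xi' a; apply: h => x xL; rewrite /disorder a. Qed.

Section glue.
Variable S : Type.
Implicit Types xi : config d S.

Definition restr L xi : {ffun L -> S} := [ffun u => xi (val u)].

Lemma glue_in L (s : {ffun L -> S}) xi x (xL : x \in L) :
  glue_config s xi x = s [` xL]%fset.
Proof. by rewrite /glue_config insubT. Qed.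

Lemma glue_out L (s : {ffun L -> S}) xi x :
  x \notin L -> glue_config s xi x = xi x.
Proof. by move=> xL; rewrite /glue_config insubN. Qed.

Lemma restr_glue L (s : {ffun L -> S}) xi : restr L (glue_config s xi) = s.
Proof.
apply/ffunP => u; rewrite ffunE glue_in; first exact: valP.
by move=> uL; congr (s _); apply/val_inj.
Qed.

Lemma agree_restr L xi xi' : agree L xi xi' <-> restr L xi = restr L xi'.
Proof.
split=> [h|/ffunP h x xL]; first by apply/ffunP => u; rewrite !ffunE; exact/h/valP.
by have := h [` xL]%fset; rewrite !ffunE.
Qed.

Lemma agree_glue_restr L xi xi' : agree L (glue_config (restr L xi) xi') xi.
Proof. by apply/agree_restr; rewrite restr_glue. Qed.

Lemma glue_restr L xi : glue_config (restr L xi) xi = xi.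
Proof.
apply/funext => x; have [xL|xL] := boolP (x \in L); last by rewrite glue_out.
by rewrite glue_in ffunE.
Qed.

Lemma glue_disj L A (s : {ffun L -> S}) xi :
  [disjoint L & A]%fset -> agree A (glue_config s xi) xi.
Proof.
move=> /fdisjointP dis x xA; apply: glue_out.
by apply: contraTN xA => /dis.
Qed.

Lemma glue_compat L A (s : {ffun L -> S}) xi xi' :
  agree (A `\` L)%fset xi xi' ->
  agree A (glue_config s xi) (glue_config s xi').
Proof.
move=> h x xA; have [xL|xL] := boolP (x \in L); first by rewrite !glue_in.
by rewrite !glue_out // h // inE xL.
Qed.

End glue.

Section spin_sum.
Variables (S : finType) (R : realType).
Implicit Types (xi : config d S) (f g : config d S -> R).

(** Summation over the values in [L] as an operator on observables: the result
    is again an observable, so that sums over disjoint volumes compose. *)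
Definition spin_sum L f xi : R := \sum_(s : {ffun L -> S}) f (glue_config s xi).

Lemma spin_sum_local L A f :
  local_on A f -> local_on (A `\` L)%fset (spin_sum L f).
Proof.
by move=> h xi xi' a; apply: eq_bigr => s _; apply/h/glue_compat.
Qed.

Lemma spin_sum_cst L f xi xi' : local_on L f -> spin_sum L f xi = spin_sum L f xi'.
Proof.
by move=> h; apply: (spin_sum_local (L := L) h) => x; rewrite fsetDv inE.
Qed.

Lemma spin_sum_fset0 f xi : spin_sum fset0 f xi = f xi.
Proof.
rewrite /spin_sum (big_pred1 (restr fset0 xi)) ?glue_restr // => s.
by apply/esym/eqP/ffunP => u; have := valP u; rewrite inE.
Qed.

Lemma spin_sumU L A f xi : [disjoint L & A]%fset ->
  spin_sum (L `|` A)%fset f xi = spin_sum L (spin_sum A f) xi.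
Proof.
move=> dis; rewrite /spin_sum pair_big /=.
pose h (p : {ffun L -> S} * {ffun A -> S}) : {ffun (L `|` A)%fset -> S} :=
  restr (L `|` A)%fset (glue_config p.2 (glue_config p.1 xi)).
have glueh p : glue_config (h p) xi = glue_config p.2 (glue_config p.1 xi).
  apply/funext => x; have [xLA|xLA] := boolP (x \in (L `|` A)%fset).
    by rewrite glue_in ffunE.
  move: (xLA); rewrite inE negb_or => /andP[xL xA].
  by rewrite !glue_out.
rewrite (reindex h) /=; first by apply: eq_bigr => p _; rewrite glueh.
exists (fun t => (restr L (glue_config t xi), restr A (glue_config t xi))).
  move=> [s t] _; rewrite glueh /=; congr pair; last exact: restr_glue.
  rewrite -[RHS](restr_glue s xi); apply/agree_restr/glue_disj.
  by rewrite fdisjoint_sym.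
move=> t _; rewrite -[RHS](restr_glue t xi) /h /=; apply/agree_restr/agreeU.
split; last exact: agree_glue_restr.
apply: agree_trans (agree_glue_restr _ _).
by apply: glue_disj; rewrite fdisjoint_sym.
Qed.

Lemma spin_sumMl L A f g xi : [disjoint L & A]%fset -> local_on A f ->
  spin_sum L (fun xi => f xi * g xi) xi = f xi * spin_sum L g xi.
Proof.
move=> dis loc; rewrite /spin_sum big_distrr /=; apply: eq_bigr => s _.
by congr (_ * _); apply/loc/glue_disj.
Qed.

Lemma spin_sumZ L c f xi :
  spin_sum L (fun xi => c * f xi) xi = c * spin_sum L f xi.
Proof. by rewrite /spin_sum big_distrr. Qed.

Lemma le_spin_sum L f g xi : (forall xi, f xi <= g xi) ->
  spin_sum L f xi <= spin_sum L g xi.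
Proof. by move=> fg; apply: ler_sum. Qed.

Lemma spin_sum_ge0 L f xi : (forall xi, 0 <= f xi) -> 0 <= spin_sum L f xi.
Proof. by move=> f0; apply: sumr_ge0. Qed.

Lemma le_spin_sum_term L f xi : (forall xi, 0 <= f xi) -> f xi <= spin_sum L f xi.
Proof.
move=> f0; rewrite /spin_sum (bigD1 (restr L xi)) //= glue_restr lerDl.
by apply: sumr_ge0.
Qed.

Lemma spin_sum1 L (c : R) xi : spin_sum L (fun=> c) xi = c * #|S|%:R ^+ #|` L|.
Proof.
by rewrite /spin_sum sumr_const card_ffun -cardfE -natrX mulr_natr.
Qed.

Lemma eq_spin_sum L f g xi : f =1 g -> spin_sum L f xi = spin_sum L g xi.
Proof. by move=> fg; apply: eq_bigr => s _; rewrite fg. Qed.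

Lemma spin_sum_shift L x f xi :
  spin_sum (translate x L) (f \o shift_config x) xi =
  spin_sum L f (shift_config x xi).
Proof.
pose h (s : {ffun L -> S}) : {ffun translate x L -> S} :=
  restr (translate x L) (shift_config (- x) (glue_config s (shift_config x xi))).
have glueh s : shift_config x (glue_config (h s) xi) =
    glue_config s (shift_config x xi).
  apply/funext => y; rewrite {1}/shift_config.
  have [yL|yL] := boolP (y \in L).
    have xy : x + y \in translate x L by rewrite in_translate addrC addKr.
    by rewrite (glue_in _ _ xy) ffunE /= /shift_config addKr.
  by rewrite !glue_out // in_translate addrC addKr.
rewrite /spin_sum (reindex h) /=; first by apply: eq_bigr => s _; rewrite glueh.
exists (fun t => restr L (shift_config x (glue_config t xi))) => [s|t] _.
  by rewrite glueh restr_glue.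
rewrite -[RHS](restr_glue t xi); apply/agree_restr.
have e : glue_config t xi =
    shift_config (- x) (shift_config x (glue_config t xi)).
  by rewrite shift_configD addNr shift_config0.
rewrite [X in agree _ _ X]e; apply/agree_shift; apply: agree_sub (agree_glue_restr _ _).
by apply/fsubsetP => y; rewrite !in_translate opprK addrK.
Qed.

(** A local observable takes finitely many values, and the sum of their moduli
    bounds each of them. *)
Lemma local_on_bounded L f : local_on L f ->
  exists M, 0 <= M /\ forall xi, `|f xi| <= M.
Proof.
have [[xi _]|noxi] := pselect (exists xi : config d S, True); last first.
  by move=> _; exists 0; split => // xi; case: noxi; exists xi.
move=> loc; exists (spin_sum L (fun xi => `|f xi|) xi); split; first exact: spin_sum_ge0.
move=> xi'; rewrite (spin_sum_cst _ xi'); last by move=> ? ? /loc ->.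
exact: (@le_spin_sum_term L (fun xi => `|f xi|)).
Qed.

End spin_sum.
End local_functions.

(** * Cylinders *)
Section cylinders.
Variables (d : nat) (S : finPointedType).
Implicit Types (L A : {fset site d}) (xi : config d S) (B : set (config d S)).

Definition cyl L xi : set (config d S) := [set xi' | agree L xi' xi].

Lemma cylinder_glue L (w : {ffun L -> S}) xi : cylinder w = cyl L (glue_config w xi).
Proof.
apply/seteqP; split=> xi' /= h x; first by move=> xL; rewrite glue_in -h.
have xL : val x \in L := valP x.
by rewrite h // glue_in; congr (w _); apply/val_inj.
Qed.

Lemma cyl_agree L xi xi' : agree L xi xi' -> cyl L xi = cyl L xi'.
Proof.
move=> a; apply/seteqP; split=> z /= h; first exact: agree_trans a.
exact: agree_trans (agree_sym a).
Qed.

Lemma cyl_translate x L xi :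
  cyl (translate x L) xi = shift_config x @^-1` cyl L (shift_config x xi).
Proof. by apply/seteqP; split=> z /= h; exact/agree_shift. Qed.

Lemma cylU L A xi : cyl (L `|` A)%fset xi = cyl L xi `&` cyl A xi.
Proof. by apply/seteqP; split=> z /= h; exact/agreeU. Qed.

Lemma cylF_cyl (D : set (site d)) L xi :
  (forall x, x \in L -> D x) -> cylF D (cyl L xi).
Proof.
move=> LD.
have -> : cyl L xi = \bigcap_(x in [set` L]) [set xi' | xi' x = xi x].
  by apply/seteqP; split.
change (measurable ((\bigcap_(x in [set` L]) [set xi' | xi' x = xi x]) :
  set (g_sigma_algebraType (@coord_events d S D)))).
apply: fin_bigcap_measurable; first exact: finite_fset.
by move=> x xL; apply: sub_sigma_algebra; exists x, (xi x); split => //; exact: LD.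
Qed.

Lemma cylF_measurable (D : set (site d)) B : cylF D B -> measurable B.
Proof.
apply: sub_sigma_algebra2 => C [x [s [_ ->]]].
by exists x, s.
Qed.

Lemma measurable_cyl L xi : measurable (cyl L xi).
Proof. by apply: (@cylF_measurable setT); exact: cylF_cyl. Qed.

(** The sets that ignore the coordinates outside [L] form a sigma-algebra, and it
    contains the generators. *)
Lemma cylF_local L B : cylF [set` L] B -> local_on L B.
Proof.
move: B; apply: smallest_sub.
  split=> [xi xi' _ //|C hC xi xi' a|F hF xi xi' a].
    by rewrite /setD /= (hC _ _ a).
  rewrite /bigcup /=; apply/propext; split=> -[n _ h]; exists n => //.
    by rewrite -(hF n _ _ a).
  by rewrite (hF n _ _ a).
by move=> C [x [s [xL ->]]] xi xi' a /=; rewrite (a x xL).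
Qed.

Lemma local_set_cyl L B : local_on L B ->
  B = \bigcup_(s in [set s | B (glue_config s point)])
        cyl L (glue_config (s : {ffun L -> S}) point).
Proof.
move=> loc; apply/seteqP; split=> [xi Bxi|xi [s /= Bs a]]; last by rewrite (loc _ _ a).
exists (restr L xi) => /=; last exact/agree_sym/agree_glue_restr.
by rewrite (loc _ _ (agree_glue_restr _ _)).
Qed.

Lemma local_measurable L B : local_on L B -> measurable B.
Proof.
move=> /local_set_cyl ->; apply: fin_bigcup_measurable; first exact: finite_finset.
by move=> s _; exact: measurable_cyl.
Qed.

Lemma local_measurable_fun (disp : measure_display) (T : measurableType disp)
  L (f : config d S -> T) : local_on L f -> measurable_fun setT f.
Proof.
move=> loc _ Y _; rewrite setTI; apply: (local_measurable (L := L)).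
by move=> xi xi' a; rewrite /preimage /= (loc _ _ a).
Qed.

Lemma local_bounded_mfun (R : realType) L (f : config d S -> R) :
  local_on L f -> bounded_mfun f.
Proof.
move=> loc; split; first exact: local_measurable_fun loc.
by have [M [_ fM]] := local_on_bounded loc; exists M.
Qed.

Lemma measurable_to_config (disp : measure_display) (T : measurableType disp)
    (phi : T -> config d S) :
  (forall x s, measurable (phi @^-1` [set xi | xi x = s])) ->
  measurable_fun setT phi.
Proof.
move=> mphi; apply: (measurability (@coord_events d S setT)) => //.
by move=> C [D [x [s [_ ->]]] <-]; rewrite setTI.
Qed.

Lemma measurable_coord x s : measurable [set xi : config d S | xi x = s].
Proof. by apply: sub_sigma_algebra; exists x, s. Qed.

Lemma measurable_shift x : measurable_fun setT (@shift_config d S x).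
Proof. by apply: measurable_to_config => y s; exact: measurable_coord (x + y) s. Qed.

(** Cylinders are open because single sites carry the discrete topology and a
    cylinder constrains finitely many of them. *)
Lemma nbhs_cyl L xi : nbhs xi (cyl L xi).
Proof.
have -> : cyl L xi = \bigcap_(x in [set` L]) [set xi' | xi' x = xi x].
  by apply/seteqP; split.
apply: filter_bigI => x xL.
have := @proj_continuous _ (fun _ : site d => discrete_topology S) x xi.
by move=> /(_ _ (@discrete_set1 (discrete_topology S) (xi x))).
Qed.

Lemma local_continuous (R : realType) L (f : config d S -> R) :
  local_on L f -> continuous f.
Proof.
move=> loc xi; apply: (@cvg_near_cst (config d S) R (f xi) f (nbhs xi) (nbhs_filter xi)).
apply: (@filterS _ (nbhs xi) (nbhs_filter xi) _ _ _ (nbhs_cyl L xi)) => xi' a.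
exact: loc.
Qed.

End cylinders.

Lemma measurable_disorder (d : nat) (S S' : finPointedType) :
  measurable_fun setT (@disorder d S S').
Proof.
apply: measurable_to_config => x s.
apply: (local_measurable (L := [fset x]%fset)) => xi xi' a.
by rewrite /preimage /disorder /= a ?inE.
Qed.

Section cylinder_probabilities.
Variables (R : realType) (d : nat) (S : finPointedType).
Variable P : probability (config d S) R.
Implicit Types (L A : {fset site d}) (xi : config d S) (f : config d S -> R).

Definition pr L xi : R := fine (P (cyl L xi)).

Lemma pr_local L : local_on L (pr L).
Proof. by move=> xi xi' /cyl_agree; rewrite /pr => ->. Qed.

Lemma pr_ge0 L xi : 0 <= pr L xi.
Proof. by rewrite /pr fine_ge0. Qed.

Lemma pr_fineK L xi : P (cyl L xi) = (pr L xi)%:E.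
Proof. by rewrite /pr fineK // fin_num_measure //; exact: measurable_cyl. Qed.

Lemma pr_le L A xi : (L `<=` A)%fset -> pr A xi <= pr L xi.
Proof.
move=> LA; rewrite -lee_fin -!pr_fineK.
by apply: le_measure; rewrite ?inE; [exact: measurable_cyl..|move=> z /=; exact: agree_sub].
Qed.

Lemma pr_fset0 xi : pr fset0 xi = 1.
Proof.
rewrite /pr (_ : cyl fset0 xi = setT) ?probability_setT //.
by apply/seteqP; split=> // z _ x; rewrite inE.
Qed.

Lemma Ex_indic B : measurable B -> Ex P (\1_B) = fine (P B).
Proof.
move=> mB; rewrite /Ex /Rintegral.
by rewrite (@integral_indic _ _ _ P setT measurableT B mB) setIT.
Qed.

Lemma indic_cyl_sum f L xi xi' : local_on L f ->
  f xi = spin_sum L (fun z => f z * \1_(cyl L z) xi) xi'.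
Proof.
move=> loc; rewrite /spin_sum (bigD1 (restr L xi)) //=.
rewrite indicE mem_set ?mulr1; last exact/agree_sym/agree_glue_restr.
rewrite (loc _ _ (agree_glue_restr _ _)) big1 ?addr0 // => s sxi.
rewrite indicE memNset ?mulr0 // => /agree_restr; rewrite restr_glue => e.
by rewrite -e eqxx in sxi.
Qed.

Lemma bounded_mfun_indic B : measurable B -> bounded_mfun (\1_B : config d S -> R).
Proof.
move=> mB; split; first exact: measurable_indic.
by exists 1 => xi; rewrite indicE; case: (_ \in _); rewrite ?normr1 ?normr0.
Qed.

(** The link between integrals and the sums over cylinders that define entropies. *)
Lemma Ex_local L f xi : local_on L f -> Ex P f = spin_sum L (fun z => f z * pr L z) xi.
Proof.
move=> loc.
have -> : f = fun xi' => \sum_(s : {ffun L -> S})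
    f (glue_config s xi) * \1_(cyl L (glue_config s xi)) xi'.
  by apply/funext => xi'; exact: (indic_cyl_sum xi' xi loc).
have b (s : {ffun L -> S}) : bounded_mfun (\1_(cyl L (glue_config s xi)) : _ -> R).
  by apply: bounded_mfun_indic; exact: measurable_cyl.
rewrite Ex_sum; last by move=> s; exact: bounded_mfunZ.
apply: eq_bigr => s _; rewrite ExZ // Ex_indic; last exact: measurable_cyl.
congr (_ * _); rewrite (indic_cyl_sum _ xi (f := f) (L := L)) //.
Qed.

(** Kolmogorov consistency of the cylinder probabilities. *)
Lemma spin_sum_pr L A xi : [disjoint L & A]%fset ->
  spin_sum A (pr (L `|` A)%fset) xi = pr L xi.
Proof.
move=> dis; rewrite {2}/pr -Ex_indic; last exact: measurable_cyl.
have -> : \1_(cyl L xi) = (fun z => \sum_(s : {ffun A -> S})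
    \1_(cyl (L `|` A)%fset (glue_config s xi)) z) :> (config d S -> R).
  apply/funext => z.
  have := @indic_cyl_sum (fun=> 1) A z xi (fun _ _ _ => erefl).
  rewrite /spin_sum => h; rewrite -[LHS]mulr1 h big_distrr /=.
  apply: eq_bigr => s _; rewrite mul1r cylU indicI /=.
  congr (\1_ _ z * _); apply: cyl_agree; apply/agree_sym/glue_disj.
  by rewrite fdisjoint_sym.
rewrite Ex_sum; last by move=> s; apply: bounded_mfun_indic; exact: measurable_cyl.
by apply: eq_bigr => s _; rewrite Ex_indic //; exact: measurable_cyl.
Qed.

Lemma spin_sum_pr1 L xi : spin_sum L (pr L) xi = 1.
Proof.
have := @spin_sum_pr fset0 L xi; rewrite pr_fset0 fset0U; apply.
exact: fdisjoint0X.
Qed.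

Section invariant.
Hypothesis P_inv : invariant_measure P.

Lemma pr_translate x L xi : pr (translate x L) xi = pr L (shift_config x xi).
Proof. by rewrite /pr cyl_translate P_inv //; exact: measurable_cyl. Qed.

Lemma Ex_shift x f : bounded_mfun f -> Ex P (f \o shift_config x) = Ex P f.
Proof.
move=> bf; apply: Ex_pushforward => //; first exact: measurable_shift.
by move=> B mB; exact: P_inv.
Qed.

End invariant.
End cylinder_probabilities.

(** * Ergodic averages over boxes *)
Section layer.
Variables (R : realType) (d : nat).

(** The unit in which boundary errors per site are measured below. *)
Definition layer (n k : nat) : R := ((vol d n)%:R - (vol d (n - k))%:R) / (vol d n)%:R.

Lemma vol_pos n : 0 < (vol d n)%:R :> R.
Proof. by rewrite ltr0n vol_gt0. Qed.

Lemma layer_ge0 n k : 0 <= layer n k.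
Proof. by rewrite divr_ge0 // subr_ge0 ler_nat leq_vol ?leq_subr. Qed.

Lemma layer_le n k k' : (k <= k')%N -> layer n k <= layer n k'.
Proof.
by move=> kk; rewrite ler_wpM2r ?invr_ge0 // lerB // ler_nat leq_vol // leq_sub2l.
Qed.

Lemma cvg_small (u : nat -> R) (e : R) : u n @[n --> \oo] --> (0 : R) -> 0 < e ->
  exists N, forall n, (N <= n)%N -> `|u n| <= e.
Proof.
move=> /cvgrPdist_le /(_ e) h e0; have [N _ hN] := h e0.
by exists N => n Nn; have := hN n Nn; rewrite sub0r normrN.
Qed.

Lemma layer_small k (c e : R) : 0 <= c -> 0 < e ->
  exists N, forall n, (N <= n)%N -> (k <= n)%N /\ c * layer n k <= e.
Proof.
move=> c0 e0; have [N hN] := cvg_small (@vol_layer d R k) (divr_gt0 e0 (ltr_pwDr ltr01 c0)).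
exists (maxn N k) => n; rewrite geq_max => /andP[Nn kn]; split=> //.
have := hN n Nn; rewrite -/(layer n k) ger0_norm ?layer_ge0 //.
rewrite ler_pdivlMr ?ltr_pwDr // => h; apply: le_trans h.
by rewrite mulrC ler_wpM2l ?layer_ge0 // lerDl.
Qed.

End layer.
Arguments layer {R}.

Section ergodic_averages.
Variables (R : realType) (d : nat) (S : finPointedType).
Variable P : probability (config d S) R.
Hypothesis P_inv : invariant_measure P.
Implicit Types (f g : config d S -> R) (xi : config d S).

Definition avg n f xi : R :=
  (vol d n)%:R^-1 * \sum_(x <- box d n) f (shift_config x xi).

Lemma bounded_shift f x : bounded_mfun f -> bounded_mfun (f \o shift_config x).
Proof. by apply: bounded_mfun_comp; exact: measurable_shift. Qed.

Lemma bounded_avg n f : bounded_mfun f -> bounded_mfun (avg n f).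
Proof.
move=> bf; apply: bounded_mfunZ.
apply: (@bounded_mfun_sum _ _ R _ _ (fun x => f \o shift_config x)) => x.
exact: bounded_shift.
Qed.

Lemma Ex_avg n f : bounded_mfun f -> Ex P (avg n f) = Ex P f.
Proof.
move=> bf; rewrite ExZ; last first.
  by apply: (@bounded_mfun_sum _ _ R _ _ (fun x => f \o shift_config x)) => x;
     exact: bounded_shift.
rewrite (@Ex_sum _ _ R P _ _ (fun x => f \o shift_config x)); last first.
  by move=> x; exact: bounded_shift.
under eq_bigr do rewrite Ex_shift //.
rewrite big_const_seq count_predT iter_addr addr0 -[X in _ * X]mulr_natl mulrA.
by rewrite -/(vol d n) mulVf ?mul1r // gt_eqF // vol_pos.
Qed.

Lemma avg_cst n c xi : avg n (fun=> c) xi = c.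
Proof.
rewrite /avg big_const_seq count_predT iter_addr addr0 -[X in _ * X]mulr_natl mulrA.
by rewrite -/(vol d n) mulVf ?mul1r // gt_eqF // vol_pos.
Qed.

Lemma avgD n f g xi : avg n (fun z => f z + g z) xi = avg n f xi + avg n g xi.
Proof. by rewrite /avg big_split mulrDr. Qed.

Lemma avgZ n c f xi : avg n (fun z => c * f z) xi = c * avg n f xi.
Proof. by rewrite /avg -big_distrr /= mulrCA. Qed.

Lemma avgB n f g xi : avg n (fun z => f z - g z) xi = avg n f xi - avg n g xi.
Proof. by rewrite /avg sumrB mulrBr. Qed.

Lemma le_avg n f g xi : (forall z, f z <= g z) -> avg n f xi <= avg n g xi.
Proof. by move=> fg; rewrite ler_wpM2l ?invr_ge0 // ler_sum. Qed.

Lemma avg_norm n f xi : `|avg n f xi| <= avg n (fun z => `|f z|) xi.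
Proof.
by rewrite normrM ger0_norm ?invr_ge0 // ler_wpM2l ?invr_ge0 // ler_norm_sum.
Qed.

Lemma avg_bound n f M xi : (forall z, `|f z| <= M) -> `|avg n f xi| <= M.
Proof.
by move=> fM; apply: le_trans (avg_norm _ _ _) _; rewrite -[leRHS](avg_cst n M xi) le_avg.
Qed.

Lemma avg_avgC m n f xi : avg m (avg n f) xi = avg n (avg m f) xi.
Proof.
rewrite /avg; under eq_bigr do rewrite big_distrr /=.
under [in RHS]eq_bigr do rewrite big_distrr /=.
rewrite [in RHS]exchange_big /= !big_distrr /=; apply: eq_bigr => x _.
rewrite !big_distrr /=; apply: eq_bigr => y _.
by rewrite !shift_configD mulrCA [x + y]addrC.
Qed.

(** Each shift of the inner average moves the large box by at most [m] and so
    affects its outer layer only. *)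
Lemma avg_avg m n f M xi : (m <= n)%N -> (forall z, `|f z| <= M) ->
  `|avg n (avg m f) xi - avg n f xi| <= 2 * M * layer d n m.
Proof.
move=> mn fM; rewrite -avg_avgC.
rewrite -[X in _ - X](avg_cst m _ xi) -avgB.
apply: le_trans (avg_norm _ _ _) _.
rewrite {1}/avg mulrC ler_pdivrMr ?vol_pos // mulr_natr.
have -> : 2 * M * layer d n m *+ vol d m = \sum_(x <- box d m) (2 * M * layer d n m).
  by rewrite big_const_seq count_predT iter_addr addr0.
rewrite big_seq [leRHS]big_seq; apply: ler_sum => x xm.
rewrite /avg -mulrBr normrM ger0_norm ?invr_ge0 // mulrC /layer mulrA.
rewrite ler_wpM2r ?invr_ge0 //.
under eq_bigr do rewrite shift_configD.
exact: (@sum_box_translate d R n m x (fun y => f (shift_config y xi)) M).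
Qed.

(** Jensen's inequality, from the nonnegativity of the empirical variance. *)
Lemma avg_sqr_le n f xi : avg n f xi ^+ 2 <= avg n (fun z => f z ^+ 2) xi.
Proof.
set c := avg n f xi; rewrite -subr_ge0.
have -> : avg n (fun z => f z ^+ 2) xi - c ^+ 2 = avg n (fun z => (f z - c) ^+ 2) xi.
  have -> : (fun z => (f z - c) ^+ 2) = (fun z => f z ^+ 2 + ((- 2 * c) * f z + c ^+ 2)).
    by apply/funext => z; ring.
  by rewrite !avgD avgZ avg_cst -/c; ring.
rewrite -(avg_cst n 0 xi); apply: le_avg => z; exact: sqr_ge0.
Qed.

Lemma bounded_sqr f : bounded_mfun f -> bounded_mfun (fun z => f z ^+ 2).
Proof. by move=> bf; under eq_fun do rewrite expr2; exact: bounded_mfunM. Qed.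

Lemma Ex_avg_sqr n f : bounded_mfun f ->
  Ex P (fun z => avg n f z ^+ 2) <= Ex P (fun z => f z ^+ 2).
Proof.
move=> bf; rewrite -(Ex_avg n (bounded_sqr bf)); apply: le_Ex.
- exact/bounded_sqr/bounded_avg.
- exact/bounded_avg/bounded_sqr.
- by move=> z; exact: avg_sqr_le.
Qed.

Lemma sqr_close (a b e M : R) : `|a - b| <= e -> `|a| <= M -> `|b| <= M ->
  a ^+ 2 <= b ^+ 2 + 2 * M * e.
Proof.
move=> ab aM bM.
have : `|a ^+ 2 - b ^+ 2| <= e * (M + M).
  rewrite subr_sqr normrM ler_pM //; apply: le_trans (ler_normD _ _) _.
  exact: lerD.
by rewrite ler_norml => /andP[_]; lra.
Qed.

Section mean.
Variables (f : config d S -> R) (M : R).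
Hypotheses (bf : bounded_mfun f) (fM : forall z, `|f z| <= M).

Let M_ge0 : 0 <= M.
Proof. exact: le_trans (normr_ge0 _) (fM point). Qed.

Let a n : R := Ex P (fun z => avg n f z ^+ 2).

Let a_ge0 n : 0 <= a n.
Proof. by apply: Ex_ge0 => z; exact: sqr_ge0. Qed.

Let delta := inf (range a).

Let has_inf_a : has_inf (range a).
Proof. by split; [exists (a 0%N), 0%N|exists 0 => _ [n _ <-]]. Qed.

Let delta_le n : delta <= a n.
Proof. by apply: ge_inf; [case: has_inf_a|exists n]. Qed.

(** Up to a layer, the average over the larger box is an average of [avg m f],
    and averaging does not increase the norm. *)
Let a_le m n : (m <= n)%N -> a n <= a m + 4 * M ^+ 2 * layer d n m.
Proof.
move=> mn; apply: (@le_trans _ _ (Ex P (fun z => avg n (avg m f) z ^+ 2 +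
    4 * M ^+ 2 * layer d n m))).
  apply: le_Ex; first exact/bounded_sqr/bounded_avg.
    apply: bounded_mfunD; last exact: bounded_mfun_cst.
    exact/bounded_sqr/bounded_avg/bounded_avg.
  move=> z; have := @sqr_close (avg n f z) (avg n (avg m f) z) (2 * M * layer d n m) M.
  rewrite distrC => /(_ (avg_avg z mn fM)).
  move=> /(_ (avg_bound n z fM)) /(_ (avg_bound n z (fun w => avg_bound m w fM))).
  by rewrite (_ : 4 * M ^+ 2 * _ = 2 * M * (2 * M * layer d n m)) //; ring.
rewrite ExD; last exact: bounded_mfun_cst.
  by rewrite Ex_cst lerD2r Ex_avg_sqr //; exact: bounded_avg.
exact/bounded_sqr/bounded_avg/bounded_avg.
Qed.

(** Averaged over a much larger box, the midpoint becomes an average of [f], and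
    averaging does not increase the norm. *)
Let mid_ge n m : delta <= Ex P (fun z => ((avg n f z + avg m f z) / 2) ^+ 2).
Proof.
set h := fun z => (avg n f z + avg m f z) / 2.
have bh : bounded_mfun h.
  apply: bounded_mfunM; last exact: bounded_mfun_cst.
  by apply: bounded_mfunD; exact: bounded_avg.
have hM z : `|h z| <= M.
  rewrite /h normrM [X in _ * X]ger0_norm ?invr_ge0 //.
  rewrite ler_pdivrMr // mulr_natr mulr2n; apply: le_trans (ler_normD _ _) _.
  by apply: lerD; exact: avg_bound.
apply/ler_addgt0Pl => e e0.
have c0 : 0 <= 4 * M ^+ 2 by rewrite mulr_ge0 ?exprn_ge0.
have [N hN] := layer_small d (maxn n m) c0 e0.
have [nmN lN] := hN N (leqnn N).
move: nmN; rewrite geq_max => /andP[nN mN].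
apply: le_trans (delta_le N) _.
apply: (@le_trans _ _ (Ex P (fun z => avg N h z ^+ 2 + e))); last first.
  rewrite ExD; [|exact/bounded_sqr/bounded_avg|exact: bounded_mfun_cst].
  by rewrite Ex_cst [leLHS]addrC lerD2l; exact: Ex_avg_sqr.
apply: le_Ex; first exact/bounded_sqr/bounded_avg.
  apply: bounded_mfunD; last exact: bounded_mfun_cst.
  exact/bounded_sqr/bounded_avg.
move=> z; apply: le_trans (@sqr_close _ (avg N h z) (2 * M * layer d N (maxn n m)) M _ _ _) _.
- have -> : avg N h z = (avg N (avg n f) z + avg N (avg m f) z) / 2.
    rewrite -avgD mulrC -avgZ; congr (avg N _ z).
    by apply/funext => w; rewrite /h mulrC.
  have := avg_avg z nN fM; have := avg_avg z mN fM.
  have l1 : 2 * M * layer d N n <= 2 * M * layer d N (maxn n m).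
    by rewrite ler_wpM2l ?mulr_ge0 // layer_le // leq_maxl.
  have l2 : 2 * M * layer d N m <= 2 * M * layer d N (maxn n m).
    by rewrite ler_wpM2l ?mulr_ge0 // layer_le // leq_maxr.
  move: l1 l2; move: (2 * M * layer d N n) (2 * M * layer d N m) => l1 l2.
  move: (2 * M * layer _ _ _) (avg N (avg n f) z) (avg N (avg m f) z) (avg N f z).
  move=> l u v w; rewrite !ler_norml => ? ? /andP[? ?] /andP[? ?].
  by apply/andP; split; lra.
- exact: avg_bound.
- exact: avg_bound.
- by rewrite lerD2l (_ : 2 * M * _ = 4 * M ^+ 2 * layer d N (maxn n m)) //; ring.
Qed.

(** The mean ergodic theorem, without completeness of the space of square
    integrable functions: norms of averages decrease along the boxes, up to
    boundary errors, the midpoint of two averages has norm at least the infimum,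
    and the parallelogram identity turns this into the Cauchy property. *)
Lemma mean_cauchy2 (e : R) : 0 < e -> exists N, forall n m, (N <= n)%N -> (N <= m)%N ->
  Ex P (fun z => (avg n f z - avg m f z) ^+ 2) <= e.
Proof.
move=> e0; have e8 : 0 < e / 8 by rewrite divr_gt0.
have [_ [k _ <-] ak] := inf_adherent e8 has_inf_a.
have c0 : 0 <= 4 * M ^+ 2 by rewrite mulr_ge0 ?exprn_ge0.
have [N hN] := layer_small d k c0 e8.
have small n : (N <= n)%N -> a n <= delta + e / 4.
  move=> /hN [kn ln]; apply: le_trans (a_le kn) _.
  by move: ak ln; rewrite -/delta; lra.
exists N => n m Nn Nm.
have bn k' : bounded_mfun (avg k' f) by exact: bounded_avg.
have -> : (fun z => (avg n f z - avg m f z) ^+ 2) = (fun z =>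
    2 * (avg n f z ^+ 2) + (2 * (avg m f z ^+ 2) +
    - 4 * (((avg n f z + avg m f z) / 2) ^+ 2))).
  by apply/funext => z; field.
have bmid : bounded_mfun (fun z => ((avg n f z + avg m f z) / 2) ^+ 2).
  apply: bounded_sqr; apply: bounded_mfunM; last exact: bounded_mfun_cst.
  exact: bounded_mfunD.
rewrite !ExD ?ExZ //; try exact: bounded_sqr.
- have := small n Nn; have := small m Nm; have := mid_ge n m; rewrite /a.
  by move: delta (Ex P _) (Ex P _) (Ex P _) => x1 x2 x3 x4; lra.
- exact/bounded_mfunZ/bounded_sqr.
- exact: bounded_mfunZ.
- exact/bounded_mfunZ/bounded_sqr.
- by apply: bounded_mfunD; [exact/bounded_mfunZ/bounded_sqr|exact: bounded_mfunZ].
Qed.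

(** From squares to absolute values by [t <= t^2 / (2 e) + e / 2]. *)
Lemma mean_cauchy (e : R) : 0 < e -> exists N, forall n m, (N <= n)%N -> (N <= m)%N ->
  Ex P (fun z => `|avg n f z - avg m f z|) <= e.
Proof.
move=> e0; have [N hN] := mean_cauchy2 (exprn_gt0 2 e0).
exists N => n m Nn Nm; set u := fun z => avg n f z - avg m f z.
have bu : bounded_mfun u by apply: bounded_mfunB; exact: bounded_avg.
apply: (@le_trans _ _ (Ex P (fun z => (2 * e)^-1 * u z ^+ 2 + e / 2))).
  apply: le_Ex; first exact: bounded_mfun_norm.
    apply: bounded_mfunD; last exact: bounded_mfun_cst.
    exact/bounded_mfunZ/bounded_sqr.
  move=> z; rewrite -real_normK ?num_real //; move: `|u z| => t.
  rewrite -subr_ge0.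
  have -> : (2 * e)^-1 * t ^+ 2 + e / 2 - t = (2 * e)^-1 * (t - e) ^+ 2.
    by field; rewrite gt_eqF.
  by rewrite mulr_ge0 ?sqr_ge0 // invr_ge0 mulr_ge0 // ltW.
rewrite ExD; [|exact/bounded_mfunZ/bounded_sqr|exact: bounded_mfun_cst].
rewrite Ex_cst ExZ; last exact: bounded_sqr.
have h := hN n m Nn Nm; apply: (@le_trans _ _ ((2 * e)^-1 * e ^+ 2 + e / 2)).
  by rewrite lerD2r ler_wpM2l // invr_ge0 mulr_ge0 // ltW.
by rewrite le_eqVlt; apply/orP; left; apply/eqP; field; rewrite gt_eqF.
Qed.

End mean.
End ergodic_averages.

(** * The pointwise ergodic theorem *)
Section pointwise_ergodic.
Variables (R : realType) (d : nat) (S : finPointedType).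
Variable P : probability (config d S) R.
Hypothesis P_inv : invariant_measure P.
Implicit Types (f g : config d S -> R) (xi : config d S).

Definition max_avg_event g (lam : R) (N : nat) : set (config d S) :=
  \bigcup_(n in `I_N.+1) [set xi | lam <= avg n g xi].

Lemma measurable_ge (f : config d S -> R) lam :
  bounded_mfun f -> measurable [set xi | lam <= f xi].
Proof.
move=> [mf _].
have -> : [set xi | lam <= f xi] = setT `&` f @^-1` `[lam, +oo[%classic.
  by apply/seteqP; split=> xi /=; rewrite in_itv /= andbT; [split|case].
by apply: mf => //; exact: measurable_itv.
Qed.

Lemma measurable_max_avg g lam N : bounded_mfun g -> measurable (max_avg_event g lam N).
Proof.
move=> bg; apply: fin_bigcup_measurable; first exact: finite_II.
by move=> n _; apply: measurable_ge; exact: bounded_avg.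
Qed.

(** The weak type maximal inequality, transferred from the covering lemma: along
    every orbit, the sites of a large box at which some average of [g] is large
    are few, and the invariance of [P] turns this count into a probability. *)
Lemma maximal_ineq g lam N : 0 < lam -> bounded_mfun g -> (forall z, 0 <= g z) ->
  lam * fine (P (max_avg_event g lam N)) <= 3 ^+ d * Ex P g.
Proof.
move=> lam0 bg g0; set E := max_avg_event g lam N.
have mE : measurable E by exact: measurable_max_avg.
have bE : bounded_mfun (\1_E : _ -> R) by exact: bounded_mfun_indic.
have count M xi : lam * \sum_(x <- box d M) \1_E (shift_config x xi) <=
    3 ^+ d * \sum_(x <- box d (M + N)) g (shift_config x xi).
  pose Q := [fset x in box d M | `[< E (shift_config x xi) >]]%fset.
  have -> : \sum_(x <- box d M) \1_E (shift_config x xi) = #|` Q|%:R :> R.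
    rewrite (eq_bigr (fun x => (`[< E (shift_config x xi) >] : nat)%:R)); last first.
      by move=> x _; rewrite indicE; case: asboolP => h; [rewrite mem_set|rewrite memNset].
    rewrite -natr_sum; congr _%:R; rewrite -sum1_size [LHS](eq_bigr (fun x =>
      if `[< E (shift_config x xi) >] then 1%N else 0%N)); last by move=> x _; case: asboolP.
    by rewrite -big_mkcond /= big_fset_condE.
  have [n hn] : {n : site d -> nat & forall x, x \in Q ->
      (n x <= N)%N /\ lam <= avg (n x) g (shift_config x xi)}.
    apply: (@choice _ _ (fun x n => x \in Q ->
      (n <= N)%N /\ lam <= avg n g (shift_config x xi))) => x.
    have [xQ|//] := boolP (x \in Q); last by exists 0%N.
    move: xQ; rewrite !inE /= => /andP[_ /asboolP[n /= nN h]].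
    by exists n.
  apply: (@covering_count d R _ lam n); first exact: ltW.
  - by move=> x; exact: g0.
  - move=> x xQ; have [nN _] := hn x xQ.
    apply: (@cube_sub d x M); first by move: xQ; rewrite !inE => /andP[].
    by rewrite leq_add2l.
  - move=> x xQ; have [_] := hn x xQ.
    rewrite /avg mulrC ler_pdivlMr ?vol_pos // => h; apply: le_trans h _.
    rewrite sum_translate; apply: ler_sum => y _.
    by rewrite shift_configD.
have Ecount M : lam * (vol d M)%:R * fine (P E) <= 3 ^+ d * ((vol d (M + N))%:R * Ex P g).
  have bs f L : bounded_mfun f ->
      bounded_mfun (fun xi => \sum_(x <- box d L) f (shift_config x xi)).
    move=> bf; apply: (@bounded_mfun_sum _ _ R _ _ (fun x => f \o shift_config x)) => x.
    exact: bounded_shift.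
  have Es f L : bounded_mfun f ->
      Ex P (fun xi => \sum_(x <- box d L) f (shift_config x xi)) = (vol d L)%:R * Ex P f.
    move=> bf; rewrite (@Ex_sum _ _ R P _ _ (fun x => f \o shift_config x)); last first.
      by move=> x; exact: bounded_shift.
    under eq_bigr do rewrite Ex_shift //.
    by rewrite big_const_seq count_predT iter_addr addr0 mulr_natl.
  have := @le_Ex _ _ R P _ _ (bounded_mfunZ lam (bs _ M bE))
    (bounded_mfunZ (3 ^+ d) (bs _ (M + N)%N bg)) (count M).
  rewrite !ExZ; [|exact: bs..].
  by rewrite !Es // Ex_indic // mulrA.
have ratio : (lam * fine (P E)) * ((vol d M)%:R / (vol d (M + N))%:R)
    @[M --> \oo] --> lam * fine (P E) * 1.
  apply: cvgM; first exact: cvg_cst.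
  apply: (@vol_ratio d R (fun M => M) (fun M => (M + N)%N)) => //.
  - by move=> M; exact: leq_addr.
  - by under eq_fun do rewrite addKn; exact: cvg_cst_div.
  - by move=> M; exact: leq_addr.
rewrite -[leLHS]mulr1 -(cvg_lim _ ratio) //; apply: limr_le.
  by apply/cvg_ex; exists (lam * fine (P E) * 1).
apply: nearW => M; rewrite mulrA ler_pdivrMr ?vol_pos // mulrAC.
by apply: le_trans (Ecount M) _; rewrite mulrA mulrAC.
Qed.

Section convergence.
Variables (f : config d S -> R) (M : R).
Hypotheses (bf : bounded_mfun f) (fM : forall z, `|f z| <= M).

Let M0 : 0 <= M.
Proof. exact: le_trans (normr_ge0 _) (fM point). Qed.

Let osc (e : R) N1 N2 : set (config d S) :=
  \bigcup_(n in `I_N2.+1 `&` [set n | (N1 <= n)%N])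
     [set xi | 6 * e <= `|avg n f xi - avg N1 f xi|].

Let measurable_osc e N1 N2 : measurable (osc e N1 N2).
Proof.
apply: fin_bigcup_measurable; first by apply: finite_setIl; exact: finite_II.
move=> n _; apply: measurable_ge; apply: bounded_mfun_norm.
by apply: bounded_mfunB; exact: bounded_avg.
Qed.

(** For a finite window of radii, [avg n f] is compared with [avg n (avg m f)],
    where [m] is much smaller than the window, and with [avg n (avg m' f)], where
    [m'] is much larger; the latter hardly depends on [n]. *)
Let osc_small (e t : R) : 0 < e -> 0 < t -> exists N1, forall N2,
  fine (P (osc e N1 N2)) <= t.
Proof.
move=> e0 t0; have t'0 : 0 < t * e / 3 ^+ d by rewrite divr_gt0 ?mulr_gt0 ?exprn_gt0.
have [m hm] := mean_cauchy P_inv bf fM t'0.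
have c0 : 0 <= 2 * M by rewrite mulr_ge0.
have [N1 hN1] := layer_small d m c0 e0; exists N1 => N2.
have [k hk] := layer_small d (maxn N1 N2) c0 e0.
pose m' := maxn k m.
pose g xi := `|avg m f xi - avg m' f xi|.
have bg : bounded_mfun g.
  by apply: bounded_mfun_norm; apply: bounded_mfunB; exact: bounded_avg.
have sub : osc e N1 N2 `<=` max_avg_event g e (maxn N1 N2).
  move=> xi [n [/= nN2 N1n] h].
  have close j : (N1 <= j)%N -> (j <= maxn N1 N2)%N ->
      `|avg j f xi - avg m' f xi| <= avg j g xi + 2 * e.
    move=> N1j jN.
    have a1 : `|avg j (avg m f) xi - avg j f xi| <= e.
      have [mj lj] := hN1 j N1j.
      exact: le_trans (avg_avg xi mj fM) lj.
    have a2 : `|avg j (avg m' f) xi - avg m' f xi| <= e.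
      have [jm' lm'] := hk m' (leq_maxl _ _).
      rewrite avg_avgC; apply: le_trans (avg_avg xi (leq_trans jN jm') fM) _.
      by apply: le_trans lm'; rewrite ler_wpM2l // layer_le.
    have a3 := avg_norm j (fun z => avg m f z - avg m' f z) xi.
    rewrite avgB -/g in a3; move: a1 a2 a3.
    move: (avg j (avg m f) xi) (avg j (avg m' f) xi) (avg j g xi) (avg j f xi) (avg m' f xi).
    move=> u v w x y; rewrite !ler_norml => /andP[? ?] /andP[? ?] /andP[? ?].
    by apply/andP; split; lra.
  have c1 := close n N1n; have c2 := close N1 (leqnn _) (leq_maxl _ _).
  have nN : (n <= maxn N1 N2)%N by apply: leq_trans (leq_maxr _ _).
  have {}c1 := c1 nN.
  have [en|en] := lerP e (avg n g xi); first by exists n.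
  exists N1; first by rewrite /= ltnS leq_maxl.
  move: h c1 c2 en; rewrite /= => h c1 c2 en.
  (* An oscillation of [6 e] contains a deviation of at least [3 e] from
     [avg m' f], of which the two comparisons account for [2 e]. *)
  have tri := ler_distD (avg m' f xi) (avg n f xi) (avg N1 f xi).
  rewrite [X in _ <= _ + X]distrC in tri.
  move: tri h c1 c2 en.
  move: (`|_ - _|) (`|_ - _|) (`|_ - _|) (avg n g xi) (avg N1 g xi) => x y z u v.
  by move=> *; lra.
apply: (@le_trans _ _ (fine (P (max_avg_event g e (maxn N1 N2))))).
  apply: fine_le; rewrite ?fin_num_measure //; try exact: measurable_max_avg.
  by apply: le_measure; rewrite ?inE //; exact: measurable_max_avg.
have := maximal_ineq (maxn N1 N2) e0 bg (fun z => normr_ge0 _).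
have hg : Ex P g <= t * e / 3 ^+ d by apply: hm => //; exact: leq_maxr.
move=> h; rewrite -(ler_pM2l e0); apply: le_trans h _.
apply: le_trans (ler_wpM2l _ hg) _; first by rewrite exprn_ge0.
by rewrite le_eqVlt; apply/orP; left; apply/eqP; field; rewrite expf_neq0 // pnatr_eq0.
Qed.

Let oscillating (e : R) : set (config d S) :=
  \bigcap_N1 \bigcup_N2 osc e N1 N2.

Let oscillating_null (e : R) : 0 < e -> P (oscillating e) = 0%E.
Proof.
move=> e0; apply/eqP; rewrite eq_le measure_ge0 andbT.
apply/lee_addgt0Pr => t t0; rewrite add0e.
have [N1 hN1] := osc_small e0 t0.
have mU : measurable (\bigcup_N2 osc e N1 N2) by apply: bigcup_measurable.
apply: (@le_trans _ _ (P (\bigcup_N2 osc e N1 N2))).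
  apply: le_measure; rewrite ?inE //; last by move=> xi; apply.
  by apply: bigcap_measurableType => n _; exact: bigcup_measurable.
have nd : {homo (osc e N1) : n m / (n <= m)%N >-> (n <= m)%O}.
  move=> n m nm; apply/subsetPset => xi [k [/= kn N1k] h].
  by exists k => //; split=> //=; exact: leq_trans kn _.
have := nondecreasing_cvg_mu (mu := P) (measurable_osc e N1) mU nd.
move=> h; rewrite -(cvg_lim _ h) //; apply: lime_le; first by apply/cvg_ex; eexists; exact: h.
apply: nearW => N2 /=.
by have := hN1 N2; rewrite -lee_fin fineK // fin_num_measure.
Qed.

Lemma ergodic_ae : {ae P, forall xi, cvgn (fun n => avg n f xi)}.
Proof.
pose bad := \bigcup_k oscillating (k.+1%:R^-1).
have mosc e : measurable (oscillating e).
  by apply: bigcap_measurableType => n _; exact: bigcup_measurable.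
have null : P.-negligible bad.
  apply: negligible_bigcup => k; exists (oscillating (k.+1%:R^-1)); split=> //.
  by apply: oscillating_null; rewrite invr_gt0.
apply: negligibleS null => xi /= ncv; apply: contrapT => nbad; apply: ncv.
apply: cauchy_cvg; apply: cauchy_exP => e e0.
have [k hk] : exists k : nat, 6 * k.+1%:R^-1 <= e :> R.
  have [k hk] := cvg_small (@cvg_cst_div R 6) e0.
  by exists k; have := hk k (leqnn k); rewrite ger0_norm ?divr_ge0.
have [N1 hN1] : exists N1, forall n, (N1 <= n)%N ->
    `|avg n f xi - avg N1 f xi| < 6 * k.+1%:R^-1.
  apply: contrapT => h; apply: nbad; exists k => // N1 _.
  apply: contrapT => h2; apply: h; exists N1 => n N1n.
  rewrite ltNge; apply/negP => h3; apply: h2.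
  by exists n => //; exists n => //; split=> //=; exact: ltnSn.
exists (avg N1 f xi); exists N1 => // n /= N1n.
by rewrite /ball /= distrC; apply: lt_le_trans (hN1 n N1n) hk.
Qed.

End convergence.
End pointwise_ergodic.

(** * Convergence of almost monotone sequences *)
Section frequently_eventually.
Variable R : realType.

(** In the spirit of Fekete's lemma: the tiling inequalities show that one good
    small box forces all large boxes to be almost as good, which excludes a gap
    between the limits inferior and superior. The limit may be infinite. *)
Lemma cvg_of_frequently (u : nat -> R) : (forall n, 0 <= u n) ->
  (forall a b, a < b -> (forall M, exists2 m, (M <= m)%N & b < u m) ->
     exists N, forall n, (N <= n)%N -> a <= u n) ->
  (exists l, u n @[n --> \oo] --> (l : R)) \/ (u n)%:E @[n --> \oo] --> +oo%E.
Proof.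
move=> u0 freq; pose F b := forall M, exists2 m, (M <= m)%N & b < u m.
have [unb|bnd] := pselect (forall b, F b).
  right; apply/cvgeyPge => A.
  have [|N hN] := freq A (A + 1) _ (unb _); first by rewrite ltrDl.
  by exists N => // n /= Nn; rewrite lee_fin hN.
have [B nB] : exists B, ~ F B by apply/existsNP.
have evB b : ~ F b -> exists N, forall n, (N <= n)%N -> u n <= b.
  move=> /existsNP[N hN]; exists N => n Nn; rewrite leNgt; apply/negP => h.
  by apply: hN; exists n.
have hs : has_sup F.
  split; first by exists (-1) => M; exists M => //; apply: lt_le_trans (u0 M).
  have [N hN] := evB B nB; exists B => b Fb; have [m Nm bm] := Fb N.
  exact: le_trans (ltW bm) (hN m Nm).
left; exists (sup F); apply/cvgrPdist_le => e e0.
have [b Fb hb] : exists2 b, F b & sup F - e / 2 < b.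
  by apply: sup_adherent => //; rewrite divr_gt0.
have [|N1 hN1] := freq (sup F - e) b _ Fb.
  by apply: lt_trans hb; rewrite ltrD2l ltrN2 ltr_pdivrMr // ltr_pMr // ltr1n.
have nF : ~ F (sup F + e).
  move=> h; have := ub_le_sup (proj2 hs) h.
  by rewrite leNgt ltrDl e0.
have [N2 hN2] := evB _ nF.
exists (maxn N1 N2) => // n /=; rewrite geq_max => /andP[n1 n2].
have h1 := hN1 n n1; have h2 := hN2 n n2.
by rewrite ler_norml; apply/andP; split; lra.
Qed.

Lemma ln_le_subr1 (x : R) : 0 < x -> ln x <= x - 1.
Proof.
move=> x0; have := @le_ln1Dx R (x - 1); rewrite [1 + _]addrC subrK; apply.
by rewrite ltrBrDr addNr.
Qed.

End frequently_eventually.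

(** * Gibbs' inequality and Shannon entropy *)
Section gibbs_inequality.
Variables (R : realType) (d : nat) (S : finPointedType).
Variable P : probability (config d S) R.
Implicit Types (f g q : config d S -> R) (L A : {fset site d}) (xi : config d S).

(** Events of probability zero are invisible to expectations: it is enough to
    compare local observables where the configuration has positive probability. *)
Lemma le_Ex_pos L f g : local_on L f -> local_on L g ->
  (forall xi, 0 < pr P L xi -> f xi <= g xi) -> Ex P f <= Ex P g.
Proof.
move=> lf lg fg; rewrite (Ex_local P point lf) (Ex_local P point lg).
apply: le_spin_sum => xi; have := pr_ge0 P L xi; rewrite le_eqVlt => /predU1P[<-|p0].
  by rewrite !mulr0.
by rewrite ler_wpM2r ?fg // ltW.
Qed.

Lemma eq_Ex_pos L f g : local_on L f -> local_on L g ->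
  (forall xi, 0 < pr P L xi -> f xi = g xi) -> Ex P f = Ex P g.
Proof.
by move=> lf lg fg; apply/eqP; rewrite eq_le; apply/andP; split;
  apply: (@le_Ex_pos L) => // xi /fg ->.
Qed.

(** Relative entropy with respect to a subprobability is nonnegative, because
    [ln x <= x - 1]. The entropy inequalities below are all instances of this,
    for different choices of [q]. *)
Lemma gibbs_ineq L q : local_on L q -> (forall xi, 0 <= q xi) ->
  spin_sum L q point <= 1 -> (forall xi, 0 < pr P L xi -> 0 < q xi) ->
  Ex P (fun xi => ln (q xi)) <= Ex P (fun xi => ln (pr P L xi)).
Proof.
move=> lq q0 q1 pos.
have llq : local_on L (fun xi => ln (q xi)) by move=> ? ? /lq ->.
have llp : local_on L (fun xi => ln (pr P L xi)) by move=> ? ? /(@pr_local _ _ _ P L) ->.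
rewrite (Ex_local P point llq) (Ex_local P point llp) -subr_ge0.
rewrite /spin_sum -sumrB; apply: (@le_trans _ _ (\sum_(s : {ffun L -> S})
   (pr P L (glue_config s point) - q (glue_config s point)))).
  by rewrite sumrB -/(spin_sum L q point) -/(spin_sum L (pr P L) point)
    spin_sum_pr1 subr_ge0.
apply: ler_sum => s _; set xi := glue_config s point.
have := pr_ge0 P L xi; rewrite le_eqVlt => /predU1P[<-|p0].
  by rewrite !mulr0 subr0 sub0r oppr_le0.
have qp := pos xi p0.
have := ln_le_subr1 (divr_gt0 qp p0); rewrite ln_div ?posrE //.
move=> /(ler_wpM2r (ltW p0)); rewrite !mulrBl divfK ?gt_eqF // mul1r.
by lra.
Qed.

Lemma pr_gt0_sub L A xi : (L `<=` A)%fset -> 0 < pr P A xi -> 0 < pr P L xi.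
Proof. by move=> LA; move=> h; apply: lt_le_trans h (pr_le P xi LA). Qed.

Lemma ln_pr_local L A : (L `<=` A)%fset -> local_on A (fun xi => ln (pr P L xi)).
Proof. by move=> LA xi xi' /(agree_sub LA) /(@pr_local _ _ _ P L) ->. Qed.

End gibbs_inequality.

Section shannon_entropy.
Variables (R : realType) (d : nat) (S : finPointedType).
Variable P : probability (config d S) R.
Implicit Types (L A : {fset site d}) (xi : config d S).

Definition shannon L : R := - Ex P (fun xi => ln (pr P L xi)).

Lemma bounded_ln_pr L : bounded_mfun (fun xi => ln (pr P L xi)).
Proof. exact: (local_bounded_mfun (ln_pr_local P (fsubset_refl L))). Qed.

(** Gibbs' inequality for the product of the two marginals. *)
Lemma shannonU L A : [disjoint L & A]%fset -> shannon (L `|` A)%fset <= shannon L + shannon A.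
Proof.
move=> dis; rewrite /shannon -opprD lerN2 -ExD; [|exact: bounded_ln_pr..].
have lq : local_on (L `|` A)%fset (fun xi => pr P L xi * pr P A xi).
  by move=> xi xi' /agreeU[/(@pr_local _ _ _ P L) -> /(@pr_local _ _ _ P A) ->].
have sL := fsubsetUl L A; have sA := fsubsetUr L A.
rewrite [leLHS](@eq_Ex_pos _ _ _ P (L `|` A)%fset _ (fun xi => ln (pr P L xi * pr P A xi))).
- apply: gibbs_ineq => // [xi||xi p0]; first by rewrite mulr_ge0 ?pr_ge0.
    rewrite spin_sumU // (_ : spin_sum A _ = pr P L) ?spin_sum_pr1 //.
    apply/funext => xi; rewrite (spin_sumMl _ _ _ (@pr_local _ _ _ P L)).
      by rewrite spin_sum_pr1 mulr1.
    by rewrite fdisjoint_sym.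
  by rewrite mulr_gt0 // ?(pr_gt0_sub sL) ?(pr_gt0_sub sA).
- by move=> xi xi' a; rewrite (ln_pr_local P sL a) (ln_pr_local P sA a).
- by move=> xi xi' /lq ->.
by move=> xi p0; rewrite lnM ?posrE // ?(pr_gt0_sub sL) ?(pr_gt0_sub sA).
Qed.

Lemma card_gt0R : 0 < #|S|%:R :> R.
Proof. by rewrite ltr0n; apply/card_gt0P; exists point. Qed.

(** Gibbs' inequality for the uniform distribution. *)
Lemma shannon_le L : shannon L <= ln #|S|%:R * #|` L|%:R.
Proof.
have c0 : 0 < #|S|%:R ^+ #|` L| :> R by rewrite exprn_gt0 // card_gt0R.
have := @gibbs_ineq _ _ _ P L (fun=> (#|S|%:R ^+ #|` L|)^-1).
rewrite Ex_cst lnV ?posrE // lnXn ?card_gt0R // mulr_natr /shannon lerNl; apply => //.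
- by rewrite spin_sum1 mulVf // gt_eqF.
- by move=> _ _; rewrite invr_gt0.
Qed.

Lemma shannon_mono L A : (L `<=` A)%fset ->
  shannon A <= shannon L + ln #|S|%:R * (#|` A|%:R - #|` L|%:R).
Proof.
move=> LA.
have <- : (L `|` (A `\` L))%fset = A by apply/fsetP => x; rewrite !inE;
  case: (boolP (x \in L)) => // /(fsubsetP LA) ->.
have dis : [disjoint L & A `\` L]%fset by apply/fdisjointP => x xL; rewrite inE xL.
apply: le_trans (shannonU dis) _; rewrite lerD2l; apply: le_trans (shannon_le _) _.
rewrite ler_wpM2l ?ln_ge0 //; first by rewrite ler1n; apply/card_gt0P; exists point.
by rewrite cardfsU (disjoint_fsetI0 dis) cardfs0 subn0 natrD addrC addKr.
Qed.

Lemma shannon_fset0 : shannon fset0 = 0.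
Proof.
rewrite /shannon (_ : (fun _ => _) = fun=> 0) ?Ex_cst ?oppr0 //.
by apply/funext => xi; rewrite pr_fset0 ln1.
Qed.

Lemma shannon_ge0 L : 0 <= shannon L.
Proof.
rewrite /shannon -ExN; last exact: bounded_ln_pr.
apply: Ex_ge0 => xi; rewrite oppr_ge0 ln_le0 //.
by rewrite -(pr_fset0 P xi) pr_le // fsub0set.
Qed.

Hypothesis P_inv : invariant_measure P.

Lemma shannon_translate x L : shannon (translate x L) = shannon L.
Proof.
rewrite /shannon -(Ex_shift P_inv x (bounded_ln_pr L)); congr (- Ex P _).
by apply/funext => xi; rewrite pr_translate.
Qed.

Lemma shannon_tiling m n : (m <= n)%N ->
  shannon (box d n) / (vol d n)%:R <=
  shannon (box d m) / (vol d m)%:R + ln #|S|%:R * layer d n m.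
Proof.
move=> mn; have vm := vol_pos R d m; have vn := vol_pos R d n.
have : (vol d (m + 0))%:R * shannon (box d n) <= \sum_(x <- box d (n - m)) shannon (box d m) +
    ln #|S|%:R * ((vol d (m + 0))%:R * (vol d n)%:R - (vol d m)%:R * (vol d (n - m))%:R).
  apply: tiling_le mn => [x L||].
  - by rewrite addn0 => dis; rewrite -(shannon_translate x (box d m)) shannonU.
  - exact: shannon_mono.
  - by rewrite shannon_fset0.
rewrite addn0 big_const_seq count_predT iter_addr addr0 -[X in _ <= X + _]mulr_natl -/(vol d _) => h.
have e0 := shannon_ge0 (box d m).
have vle : (vol d (n - m))%:R <= (vol d n)%:R :> R by rewrite ler_nat leq_vol ?leq_subr.
rewrite ler_pdivrMr // -(ler_pM2l vm); apply: le_trans h _.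
have -> : (vol d m)%:R * ((shannon (box d m) / (vol d m)%:R + ln #|S|%:R * layer d n m) *
    (vol d n)%:R) = (vol d n)%:R * shannon (box d m) +
    ln #|S|%:R * ((vol d m)%:R * (vol d n)%:R - (vol d m)%:R * (vol d (n - m))%:R).
  by rewrite /layer; field; rewrite !gt_eqF.
by rewrite lerD2r ler_wpM2r.
Qed.

Lemma shannon_density_cvg : exists l, shannon (box d n) / (vol d n)%:R @[n --> \oo] --> (l : R).
Proof.
pose C : R := ln #|S|%:R.
have C0 : 0 <= C by rewrite ln_ge0 // ler1n; apply/card_gt0P; exists point.
pose u n := C - shannon (box d n) / (vol d n)%:R.
have u0 n : 0 <= u n by rewrite subr_ge0 ler_pdivrMr ?vol_pos // shannon_le.
have [|[l ul]|uy] := @cvg_of_frequently R u u0.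
- move=> a b ab /(_ 0%N)[m _ bm].
  have ba : 0 < b - a by rewrite subr_gt0.
  have [N hN] := layer_small d m C0 ba.
  exists N => n /hN[mn ln]; have := shannon_tiling mn; move: bm; rewrite /u -/C.
  by move: ln; move: (C * _) (_ / _) (_ / _) => x y z; lra.
- exists (C - l); have -> : (fun n => shannon (box d n) / (vol d n)%:R) = fun n => C - u n.
    by apply/funext => n; rewrite subKr.
  by apply: cvgB => //; exact: cvg_cst.
- move/cvgeyPge : uy => /(_ (C + 1)) [N _ /(_ N (leqnn N))] /=.
  rewrite lee_fin /u; have : 0 <= shannon (box d N) / (vol d N)%:R.
    by rewrite divr_ge0 ?shannon_ge0.
  by lra.
Qed.

End shannon_entropy.

(** * Relative entropy with respect to a decoupled measure *)
Section relative_entropy.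
Variables (R : realType) (d : nat) (S : finPointedType).
Variables K P : probability (config d S) R.
Implicit Types (L A : {fset site d}) (xi : config d S).

(** Absolute continuity on [L], tested on cylinders. *)
Definition abs_cont L := forall xi, 0 < pr K L xi -> 0 < pr P L xi.

Definition relent L : R := Ex K (fun xi => ln (pr K L xi) - ln (pr P L xi)).

Lemma pr_gt0_refine L A xi : 0 < pr K L xi ->
  exists2 xi', agree L xi' xi & 0 < pr K (L `|` A)%fset xi'.
Proof.
move=> p0; have dis : [disjoint L & A `\` L]%fset.
  by apply/fdisjointP => x xL; rewrite inE xL.
have LA : (L `|` (A `\` L))%fset = (L `|` A)%fset.
  by apply/fsetP => x; rewrite !inE; case: (x \in L).
move: p0; rewrite -(spin_sum_pr K xi dis) LA /spin_sum => p0.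
have [s sp] : exists s : {ffun (A `\` L)%fset -> S},
    0 < pr K (L `|` A)%fset (glue_config s xi).
  apply: contrapT => /forallNP h; move: p0; rewrite big1 ?ltxx // => s _.
  apply/eqP; rewrite eq_le pr_ge0 andbT leNgt; exact/negP/h.
by exists (glue_config s xi) => //; apply: glue_disj; rewrite fdisjoint_sym.
Qed.

Lemma abs_cont_sub L A : (L `<=` A)%fset -> abs_cont A -> abs_cont L.
Proof.
move=> LA dA xi /(pr_gt0_refine A)[xi' a].
have -> : (L `|` A)%fset = A by exact/fsetUidPr.
by move=> /dA /(pr_gt0_sub LA); rewrite (pr_local _ a).
Qed.

(** An event that depends on finitely many sites is a finite union of cylinders. *)
Lemma abs_contP L : abs_cont L <->
  (forall B, cylF [set` L] B -> P B = 0%E -> K B = 0%E).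
Proof.
split=> [dom B /[dup] /cylF_measurable mB /cylF_local loc PB0|h xi].
  rewrite (local_set_cyl loc) measure_fin_bigcup.
  - apply: fsbig1 => s /= Bs.
    set xi := glue_config s point; apply/eqP; rewrite eq_le measure_ge0 andbT.
    rewrite pr_fineK lee_fin leNgt; apply/negP => /dom.
    have : (P (cyl L xi) <= P B)%E.
      by apply: le_measure; rewrite ?inE //; [exact: measurable_cyl|move=> z /loc ->].
    by rewrite PB0 pr_fineK lee_fin leNgt => /negP.
  - exact: finite_finset.
  - move=> s t _ _ [z [/= /agree_restr h1 /agree_restr h2]].
    by move: h1 h2; rewrite !restr_glue => -> ->.
  - by move=> s _; exact: measurable_cyl.
move=> k0; rewrite lt_neqAle pr_ge0 andbT; apply/eqP => p0.
have := h (cyl L xi) (cylF_cyl xi (D := [set` L]) (fun x xL => xL)).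
rewrite !pr_fineK -p0 => /(_ erefl) [k1].
by rewrite k1 ltxx in k0.
Qed.

Lemma bounded_relent L : bounded_mfun (fun xi => ln (pr K L xi) - ln (pr P L xi)).
Proof. by apply: bounded_mfunB; exact: bounded_ln_pr. Qed.

Lemma relent_local L A : (L `<=` A)%fset ->
  local_on A (fun xi => ln (pr K L xi) - ln (pr P L xi)).
Proof.
by move=> LA xi xi' a; rewrite (ln_pr_local K LA a) (ln_pr_local P LA a).
Qed.

Lemma rel_entropy_volumeE L : rel_entropy_volume L K P =
  if `[< abs_cont L >] then (relent L)%:E else +oo%E.
Proof.
rewrite /rel_entropy_volume; have [dom|nd] := asboolP (abs_cont L); last first.
  by case: asboolP => // h; case: nd; exact/abs_contP.
case: asboolP => [_|]; last by case; exact/abs_contP.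
congr (_%:E); rewrite /relent (Ex_local K point (relent_local (fsubset_refl L))).
apply: eq_bigr => w _; rewrite (cylinder_glue w point) mulrC.
set xi := glue_config w point; rewrite -!/(pr _ L xi).
have := pr_ge0 K L xi; rewrite le_eqVlt => /predU1P[<-|k0]; first by rewrite !mulr0.
by rewrite ln_div ?posrE ?dom.
Qed.

Lemma relent_fset0 : relent fset0 = 0.
Proof.
rewrite /relent (_ : (fun _ => _) = fun=> 0) ?Ex_cst //.
by apply/funext => xi; rewrite !pr_fset0 subrr.
Qed.

(** Here [q] is the marginal of [K] on [L], continued to [A] with the conditional
    probabilities of [P]. *)
Lemma relent_mono L A : (L `<=` A)%fset -> abs_cont A -> relent L <= relent A.
Proof.
move=> LA dA; have dL := abs_cont_sub LA dA.
pose q xi := pr K L xi / pr P L xi * pr P A xi.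
have lq : local_on A q.
  move=> xi xi' a; rewrite /q (pr_local _ a) (pr_local _ (agree_sub LA a)).
  by rewrite (pr_local _ (agree_sub LA a)).
have rA := bounded_ln_pr K A; have pA := bounded_ln_pr P A.
rewrite /relent (ExB _ rA pA) lerBrDr -ExD //; last exact: bounded_relent.
rewrite [leLHS](@eq_Ex_pos _ _ _ K A _ (fun xi => ln (q xi))).
- apply: gibbs_ineq => // [xi||xi p0]; first by rewrite !mulr_ge0 ?invr_ge0 ?pr_ge0.
    have dis : [disjoint L & A `\` L]%fset.
      by apply/fdisjointP => x xL; rewrite inE xL.
    have AE : (L `|` (A `\` L))%fset = A.
      by apply/fsetP => x; rewrite !inE; case: (boolP (x \in L)) => // /(fsubsetP LA) ->.
    rewrite -[X in spin_sum X]AE spin_sumU // -(spin_sum_pr1 K L point); apply: le_spin_sum => xi.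
    rewrite (@spin_sumMl _ _ _ (A `\` L)%fset L).
    + have := spin_sum_pr P xi dis; rewrite AE => ->; have := pr_ge0 P L xi.
      rewrite le_eqVlt => /predU1P[<-|p0]; first by rewrite mulr0 pr_ge0.
      by rewrite divfK // gt_eqF.
    + by rewrite fdisjoint_sym.
    + by move=> ? ? a; rewrite !(pr_local _ a).
  by rewrite !mulr_gt0 ?invr_gt0 ?dL ?dA // (pr_gt0_sub LA).
- by move=> ? ? a; rewrite (relent_local LA a) (ln_pr_local P (fsubset_refl A) a).
- by move=> ? ? /lq ->.
move=> xi p0; have kL := pr_gt0_sub LA p0; have pL := dL _ kL; have pA0 := dA _ p0.
by rewrite lnM ?ln_div ?posrE // divr_gt0.
Qed.

Lemma relent_ge0 L : abs_cont L -> 0 <= relent L.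
Proof. by move=> dL; rewrite -relent_fset0 relent_mono // fsub0set. Qed.

(** Here [q] reweights [P] by the densities of [K] on the two sets; decoupling
    is what keeps its total mass at most one. *)
Lemma relentU L A c : [disjoint L & A]%fset -> abs_cont (L `|` A)%fset ->
  (forall xi, pr P (L `|` A)%fset xi <= expR c * (pr P L xi * pr P A xi)) ->
  relent L + relent A <= c + relent (L `|` A)%fset.
Proof.
move=> dis dLA dec; have sL := fsubsetUl L A; have sA := fsubsetUr L A.
set U := (L `|` A)%fset in dLA dec sL sA *.
have dL := abs_cont_sub sL dLA; have dA := abs_cont_sub sA dLA.
pose q xi := expR (- c) * (pr K L xi / pr P L xi * (pr K A xi / pr P A xi) * pr P U xi).
have lq : local_on U q.
  move=> xi xi' a; rewrite /q (pr_local _ a).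
  by rewrite !(pr_local _ (agree_sub sL a)) !(pr_local _ (agree_sub sA a)).
have rU := bounded_ln_pr K U; have pU := bounded_ln_pr P U.
have rL := bounded_relent L; have rA := bounded_relent A.
rewrite -lerBlDl /relent (ExB _ rU pU) lerBrDr -ExD // [X in X - _ + _](_ : _ =
  Ex K (fun xi => ln (pr K L xi) - ln (pr P L xi) + (ln (pr K A xi) - ln (pr P A xi)))) //.
have bLA := bounded_mfunD rL rA.
rewrite -{1}(Ex_cst K c) -ExB //; last exact: bounded_mfun_cst.
rewrite -ExD //; last by apply: bounded_mfunB => //; exact: bounded_mfun_cst.
rewrite [leLHS](@eq_Ex_pos _ _ _ K U _ (fun xi => ln (q xi))).
- apply: gibbs_ineq => // [xi||xi p0].
  + by rewrite !mulr_ge0 ?expR_ge0 ?invr_ge0 ?pr_ge0.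
  + apply: (@le_trans _ _ (spin_sum U (fun xi => pr K L xi * pr K A xi) point)).
      apply: le_spin_sum => xi; rewrite /q expRN ler_pdivrMl ?expR_gt0 //.
      have kk : 0 <= pr K L xi * pr K A xi by rewrite mulr_ge0 ?pr_ge0.
      have h := dec xi.
      have [p0|/eqP p0] := boolP (pr P L xi * pr P A xi == 0).
        have -> : pr P U xi = 0.
          apply/eqP; rewrite eq_le pr_ge0 andbT; apply: le_trans h _.
          by rewrite (eqP p0) mulr0.
        by rewrite mulr0 mulr_ge0 ?expR_ge0.
      have {p0} : 0 < pr P L xi * pr P A xi.
        by rewrite lt_neqAle mulr_ge0 ?pr_ge0 // andbT eq_sym; apply/eqP.
      rewrite mulf_div => p0; rewrite mulrAC ler_pdivrMr // [leRHS]mulrAC mulrC.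
      by rewrite ler_wpM2r.
    rewrite spin_sumU // (_ : spin_sum A _ = pr K L) ?spin_sum_pr1 //.
    apply/funext => xi; rewrite (spin_sumMl _ _ _ (@pr_local _ _ _ K L)).
      by rewrite spin_sum_pr1 mulr1.
    by rewrite fdisjoint_sym.
  + have kL := pr_gt0_sub sL p0; have kA := pr_gt0_sub sA p0.
    by rewrite !mulr_gt0 ?expR_gt0 ?invr_gt0 ?dL ?dA ?dLA.
- move=> ? ? a; rewrite (relent_local sL a) (relent_local sA a).
  by rewrite (ln_pr_local P (fsubset_refl U) a).
- by move=> ? ? /lq ->.
move=> xi p0; have kL := pr_gt0_sub sL p0; have kA := pr_gt0_sub sA p0.
have pL := dL _ kL; have pA := dA _ kA; have pU0 := dLA _ p0.
rewrite /q lnM ?posrE ?expR_gt0 ?mulr_gt0 ?invr_gt0 // expRK.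
rewrite lnM ?posrE ?mulr_gt0 ?invr_gt0 //.
by rewrite lnM ?ln_div ?posrE ?divr_gt0 //; ring.
Qed.

Hypothesis K_inv : invariant_measure K.

Lemma relent_translate x L : invariant_measure P -> relent (translate x L) = relent L.
Proof.
move=> P_inv; rewrite /relent -(Ex_shift K_inv x (bounded_relent L)); congr (Ex K _).
by apply/funext => xi; rewrite /= !pr_translate.
Qed.

(** The definition of decoupling speaks of boxes around the origin, and invariance
    moves it elsewhere. If one of the two cylinders is null then so is their
    intersection. *)
Lemma decoupled_translate (m g : nat) c : invariant_measure P ->
  (forall (A B : set (config d S)), cylF [set` box d m] A ->
     cylF (~` [set` box d (m + g)]) B -> (P A * P B != 0)%E ->
     fine (P (A `&` B)) / (fine (P A) * fine (P B)) <= expR c) ->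
  forall x L xi, [disjoint translate x (box d (m + g)) & L]%fset ->
  pr P (translate x (box d m) `|` L)%fset xi <=
    expR c * (pr P (translate x (box d m)) xi * pr P L xi).
Proof.
move=> P_inv dec x L xi dis.
have tL : L = translate x (translate (- x) L).
  by apply/fsetP => y; rewrite !in_translate opprK subrK.
have tU : (translate x (box d m) `|` L)%fset =
    translate x (box d m `|` translate (- x) L)%fset.
  by rewrite {1}tL; apply/fsetP => y; rewrite !(inE, in_translate).
pose L' := translate (- x) L.
have -> : pr P L xi = pr P L' (shift_config x xi) by rewrite {1}tL pr_translate.
rewrite tU !(pr_translate P_inv x) -/L'; move: (shift_config x xi) => {}xi.
have [p0|p0] := eqVneq (pr P (box d m) xi * pr P L' xi) 0.
  rewrite p0 mulr0; have := pr_le P xi (fsubsetUl (box d m) L').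
  have := pr_le P xi (fsubsetUr (box d m) L').
  by move: p0 => /eqP; rewrite mulf_eq0 => /orP[]/eqP ->.
have pp : 0 < pr P (box d m) xi * pr P L' xi.
  by rewrite lt_neqAle eq_sym p0 mulr_ge0 ?pr_ge0.
rewrite -ler_pdivrMr // /pr cylU; apply: dec; first by apply: cylF_cyl.
  apply: cylF_cyl => y yL /= yb; move: dis => /fdisjointP /(_ (y + x)).
  rewrite in_translate addrK => /(_ yb); move: yL.
  by rewrite /L' in_translate opprK => ->.
by rewrite !pr_fineK -EFinM eqe.
Qed.

End relative_entropy.

Section relative_entropy_density.
Variables (R : realType) (d : nat) (S : finPointedType).
Variables K P : probability (config d S) R.
Hypotheses (K_inv : invariant_measure K) (P_dec : asymptotically_decoupled P).

(** The relative entropy of a large box dominates the sum over tiles, each tile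
    losing [c m]; the gaps cost only the factor [vol m / vol (m + g m)], which
    tends to one. *)
Lemma rel_density_cvg : (forall n, abs_cont K P (box d n)) ->
  (exists l, relent K P (box d n) / (vol d n)%:R @[n --> \oo] --> (l : R)) \/
  (relent K P (box d n) / (vol d n)%:R)%:E @[n --> \oo] --> +oo%E.
Proof.
move=> dom; have [P_inv [g [c [c0 g0 dec]]]] := P_dec.
have domA A : abs_cont K P A.
  have [n An] : exists n, (A `<=` box d n)%fset.
    exists (\max_(x <- A) \max_(i < d) absz (x ord0 i)).
    apply/fsubsetP => x xA; apply/in_box_le => i.
    pose F (y : site d) := (\max_(j < d) absz (y ord0 j))%N.
    apply: (@leq_trans (F x)); last by rewrite (big_fsetD1 x) //= leq_maxl.
    exact: (@leq_bigmax_cond _ predT (fun j : 'I_d => absz (x ord0 j))).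
  exact: abs_cont_sub An (dom n).
pose v n := relent K P (box d n) / (vol d n)%:R.
pose w m := (relent K P (box d m) - c m) / (vol d (m + g m))%:R.
have v0 n : 0 <= v n by rewrite divr_ge0 // relent_ge0.
have tile m n : (m <= n)%N -> w m * (1 - layer d n m) <= v n.
  move=> mn; have vm := vol_pos R d (m + g m); have vn := vol_pos R d n.
  have : (vol d (m + g m))%:R * (- relent K P (box d n)) <=
      \sum_(x <- box d (n - m)) (c m - relent K P (box d m)) +
      0 * ((vol d (m + g m))%:R * (vol d n)%:R - (vol d m)%:R * (vol d (n - m))%:R).
    apply: (@tiling_le d R (fun A => - relent K P A)) mn => [x L dis|L A LA|].
    - rewrite -(relent_translate K_inv x (box d m) P_inv).
      have disj : [disjoint translate x (box d m) & L]%fset.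
        apply/fdisjointP => y yx; move: dis => /fdisjointP; apply.
        move: yx; rewrite !in_translate; apply: (fsubsetP (box_sub _ _)).
        exact: leq_addr.
      have := relentU disj (domA _) (c := c m); rewrite -lerN2.
      suff h : forall xi, pr P (translate x (box d m) `|` L)%fset xi <=
          expR (c m) * (pr P (translate x (box d m)) xi * pr P L xi).
        by move=> /(_ h); lra.
      move=> xi; apply: (decoupled_translate (m := m) (g := g m)) => // A B cA cB AB.
      by have /andP[] := dec m A B cA cB AB.
    - by rewrite mul0r addr0 lerN2 relent_mono.
    - by rewrite relent_fset0 oppr0.
  rewrite mul0r addr0 big_const_seq count_predT iter_addr addr0 -mulr_natl -/(vol d _).
  move=> h; rewrite /w /v /layer ler_pdivlMr //.
  have -> : (relent K P (box d m) - c m) / (vol d (m + g m))%:R *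
    (1 - ((vol d n)%:R - (vol d (n - m))%:R) / (vol d n)%:R) * (vol d n)%:R =
    (vol d (n - m))%:R * (relent K P (box d m) - c m) / (vol d (m + g m))%:R.
    by field; rewrite !gt_eqF.
  by rewrite ler_pdivrMr //; move: h; lra.
apply: (cvg_of_frequently (u := v)) => // a b ab freq.
have [a0|a0] := ltP a 0.
  by exists 0%N => n _; apply: le_trans (ltW a0) (v0 n).
have b0 : 0 < 1 + b by lra.
(* This choice gives [(b - e) * (1 - e) > a]. *)
pose e := (b - a) / (2 * (1 + b)).
have e0 : 0 < e by rewrite divr_gt0 ?mulr_gt0 // subr_gt0.
have eE : e * (1 + b) = (b - a) / 2 by rewrite /e; field; rewrite gt_eqF.
have [N1 hN1] := cvg_small c0 e0.
have rho0 : 1 - (vol d n)%:R / (vol d (n + g n))%:R @[n --> \oo] --> (0 : R).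
  apply: (cvg_to_eq _ (subrr (1 : R))); apply: cvgB; first exact: cvg_cst.
  exact: vol_enlarge.
have [N2 hN2] := cvg_small rho0 e0.
have [m mN bm] := freq (maxn N1 N2); move: mN; rewrite geq_max => /andP[m1 m2].
have wa : a < w m.
  have := hN1 m m1; have := hN2 m m2.
  have wE : w m = (v m - c m / #|` box d m|%:R) * ((vol d m)%:R / (vol d (m + g m))%:R).
    by rewrite /w /v -/(vol d m); field; rewrite !gt_eqF ?vol_pos.
  have rho1 : 0 <= (vol d m)%:R / (vol d (m + g m))%:R :> R by rewrite divr_ge0.
  rewrite wE; move: rho1 bm; move: (v m) (c m / _) (_ / _) => x y z z0 bx.
  rewrite !ler_norml => /andP[_ z1] /andP[_ ye].
  have eb : e <= b by nra.
  apply: (@lt_le_trans _ _ ((b - e) * (1 - e))); first by nra.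
  apply: (@le_trans _ _ ((b - e) * z)); first by rewrite ler_wpM2l ?subr_ge0 //; lra.
  by rewrite ler_wpM2r //; lra.
have w0 : 0 <= w m by apply: le_trans a0 (ltW wa).
have wa0 : 0 < w m - a by rewrite subr_gt0.
have [N hN] := layer_small d m w0 wa0.
exists N => n /hN[mn lw]; apply: le_trans (tile m n mn).
by rewrite mulrBr mulr1; lra.
Qed.

End relative_entropy_density.

(** * Energies of finite range potentials *)
Lemma le_sum_fsubset (R : realType) (T : choiceType) (A B : {fset T}) (f : T -> R) :
  (A `<=` B)%fset -> (forall x, 0 <= f x) -> \sum_(x <- A) f x <= \sum_(x <- B) f x.
Proof.
move=> AB f0; rewrite [leRHS](big_fsetID _ (mem A)) /=.
have -> : [fset x in B | x \in A]%fset = A.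
  by apply/fsetP => y; rewrite !inE /= andbC; case: (boolP (y \in A)) => //= yA;
    rewrite (fsubsetP AB).
by rewrite lerDl sumr_ge0.
Qed.

Section geometry.
Variables (d r : nat).
Implicit Types (A L G : {fset site d}) (x y : site d).

Lemma diam_dist A x y i : x \in A -> y \in A ->
  (absz (x ord0 i - y ord0 i) <= diam A)%N.
Proof.
move=> xA yA; rewrite /diam (big_fsetD1 x) //= leq_max; apply/orP; left.
rewrite (big_fsetD1 y) //= leq_max; apply/orP; left.
exact: (@leq_bigmax_cond _ predT (fun i : 'I_d => absz (x ord0 i - y ord0 i))).
Qed.

Lemma diam_cube A x : x \in A -> (diam A <= r)%N ->
  (A `<=` translate x (box d r))%fset.
Proof.
move=> xA Ar; apply/fsubsetP => y yA; apply/in_cube => i.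
exact: leq_trans (diam_dist i yA xA) Ar.
Qed.

(** The inner boundary: a set of diameter at most [r] that meets [L] and leaves
    [L] must meet it. *)
Definition bdry L : {fset site d} :=
  [fset x in L | ~~ (translate x (box d r) `<=` L)%fset]%fset.

Lemma meets_bdry A L x : x \in A -> x \in L -> (diam A <= r)%N ->
  ~~ (A `<=` L)%fset -> x \in bdry L.
Proof.
move=> xA xL Ar AL; rewrite !inE xL /=; apply: contra AL.
exact: fsubset_trans (diam_cube xA Ar).
Qed.

Lemma translateD x y L : translate x (translate y L) = translate (x + y) L.
Proof. by apply/fsetP => z; rewrite !in_translate opprD addrA. Qed.

Lemma translate0 L : translate 0 L = L.
Proof. by apply/fsetP => z; rewrite in_translate subr0. Qed.

Lemma translateS x L A : (translate x L `<=` translate x A)%fset = (L `<=` A)%fset.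
Proof.
apply/fsubsetP/fsubsetP => h y; last by rewrite !in_translate => /h.
by have := h (y + x); rewrite !in_translate addrK.
Qed.

Lemma bdry_translate x L : bdry (translate x L) = translate x (bdry L).
Proof.
apply/fsetP => y; rewrite in_translate !inE in_translate; congr (_ && ~~ _).
by rewrite -(translateS x _ L) translateD addrC subrK.
Qed.

Lemma card_bdry_box n : (r <= n)%N -> (#|` bdry (box d n)| <= vol d n - vol d (n - r))%N.
Proof.
move=> rn; rewrite /vol -cardfsDS; last by apply: box_sub; exact: leq_subr.
apply/fsubset_leq_card/fsubsetP => x; rewrite !inE => /andP[xn h].
rewrite xn andbT; apply: contra h => xb; apply: (cube_sub xb); by rewrite subnK.
Qed.

End geometry.

Section interaction.
Variables (R : realType) (d : nat) (S : finPointedType) (Phi : potential R d S).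
Hypotheses (Phi_local : local_potential Phi) (Phi_inv : potential_invariant Phi).
Variable r : nat.
Hypothesis Phi_range : forall A : {fset site d}, (r < diam A)%N ->
  forall xi, Phi A xi = 0.
Implicit Types (A L D G : {fset site d}) (xi : config d S) (x : site d).

Lemma Phi_shift A x xi : Phi (translate x A) xi = Phi A (shift_config x xi).
Proof. exact: Phi_inv. Qed.

Lemma fpowerset_translate x D :
  fpowerset (translate x D) = [fset translate x A | A in fpowerset D]%fset.
Proof.
apply/fsetP => A; rewrite fpowersetE; apply/idP/imfsetP => /= [AD|[B]].
  exists (translate (- x) A).
    by rewrite fpowersetE -(translateS x) translateD subrr translate0.
  by rewrite translateD subrr translate0.
by rewrite fpowersetE => BD ->; rewrite translateS.
Qed.

Lemma translate_inj x : injective (@translate d x).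
Proof. by move=> A B /(congr1 (translate (- x))); rewrite !translateD addNr !translate0. Qed.

Definition psum D (p : pred {fset site d}) xi : R :=
  \sum_(A <- fpowerset D | p A) Phi A xi.

Lemma psum_shift x D p xi :
  psum (translate x D) p xi = psum D (fun A => p (translate x A)) (shift_config x xi).
Proof.
rewrite /psum fpowerset_translate big_mkcond [RHS]big_mkcond big_imfset /=; last by move=> A B _ _; exact: translate_inj.
by apply: eq_bigr => A _; rewrite Phi_shift.
Qed.

Lemma psum_local D p : local_on D (psum D p).
Proof.
move=> xi xi' a; rewrite /psum big_seq_cond [RHS]big_seq_cond; apply: eq_bigr => A /andP[].
by rewrite fpowersetE => AD _; apply: Phi_local => x xA; apply/a/(fsubsetP AD).
Qed.

Lemma psum_diff D (p q : pred {fset site d}) xi : (forall A, q A -> p A) ->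
  psum D p xi - psum D q xi = psum D (fun A => p A && ~~ q A) xi.
Proof.
move=> qp; rewrite /psum (bigID q) /= [X in X + _ - _](eq_bigl q); first by rewrite addrC addKr.
by move=> A; apply/andP/idP => [[]//|qA]; split=> //; exact: qp.
Qed.

(** Invariance moves the site to the origin; there, finite range leaves finitely
    many interactions, and each takes finitely many values. *)
Lemma abs_energy_bounded : exists2 C : R, 0 <= C &
  forall D x xi, \sum_(A <- fpowerset D | x \in A) `|Phi A xi| <= C.
Proof.
pose f xi : R := \sum_(A <- fpowerset (box d r) | (0 : site d) \in A) `|Phi A xi|.
have lf : local_on (box d r) f.
  move=> xi xi' a; rewrite /f big_seq_cond [RHS]big_seq_cond; apply: eq_bigr => A /andP[].
  rewrite fpowersetE => AD _; congr `|_|.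
  by apply: Phi_local => x xA; apply/a/(fsubsetP AD).
have [C [C0 fC]] := local_on_bounded lf; exists C => //.
have at0 D xi : \sum_(A <- fpowerset D | (0 : site d) \in A) `|Phi A xi| <= C.
  apply: le_trans (_ : f xi <= C); last by apply: le_trans (fC xi); exact: ler_norm.
  apply: (@le_trans _ _ (\sum_(A <- fpowerset (D `|` box d r)%fset | (0 : site d) \in A) `|Phi A xi|)).
    rewrite big_mkcond [leRHS]big_mkcond; apply: le_sum_fsubset.
      by rewrite fpowersetS fsubsetUl.
    by move=> A; case: ifP.
  rewrite /f big_mkcond [leRHS]big_mkcond le_eqVlt; apply/orP; left; apply/eqP; symmetry.
  apply: big_fset_incl; first by rewrite fpowersetS fsubsetUr.
  move=> A _ Abox; case: ifP => // A0; rewrite Phi_range ?normr0 // ltnNge.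
  apply: contra Abox => Ar; rewrite fpowersetE.
  by have := diam_cube A0 Ar; rewrite translate0.
move=> D x xi.
have -> : D = translate x (translate (- x) D) by rewrite translateD subrr translate0.
rewrite fpowerset_translate big_mkcond big_imfset /=; last by move=> A B _ _; exact: translate_inj.
apply: le_trans (at0 (translate (- x) D) (shift_config x xi)).
rewrite le_eqVlt; apply/orP; left; apply/eqP; rewrite -big_mkcond /=.
apply: eq_big => [A|A _]; first by rewrite in_translate subrr.
by rewrite Phi_shift.
Qed.

Variable C : R.
Hypotheses (C_ge0 : 0 <= C)
  (energy_le : forall D x xi, \sum_(A <- fpowerset D | x \in A) `|Phi A xi| <= C).

(** Each interaction is charged to one of its sites in [G]. *)
Lemma abs_psum_bound D (p : pred {fset site d}) G xi :
  (forall A, p A -> (diam A <= r)%N -> exists2 x, x \in A & x \in G) ->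
  \sum_(A <- fpowerset D | p A) `|Phi A xi| <= C * #|` G|%:R.
Proof.
move=> pG.
have -> : C * #|` G|%:R = \sum_(x <- G) C.
  by rewrite big_const_seq count_predT iter_addr addr0 mulr_natr.
apply: (@le_trans _ _ (\sum_(x <- G) \sum_(A <- fpowerset D | x \in A) `|Phi A xi|)); last first.
  by apply: ler_sum => x _; exact: energy_le.
rewrite (exchange_big_dep predT) //= [leLHS]big_mkcond; apply: ler_sum => A _.
case: ifP => [pA|_]; last by apply: sumr_ge0.
have [Ar|Ar] := leqP (diam A) r; last by rewrite Phi_range // normr0 sumr_ge0.
have [x xA xG] := pG A pA Ar.
rewrite big_mkcond (big_fsetD1 x) //= xA lerDl; apply: sumr_ge0 => y _.
by case: ifP.
Qed.

Lemma psum_bound D (p : pred {fset site d}) G xi :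
  (forall A, p A -> (diam A <= r)%N -> exists2 x, x \in A & x \in G) ->
  `|psum D p xi| <= C * #|` G|%:R.
Proof. by move=> pG; apply: le_trans (ler_norm_sum _ _ _) _; exact: abs_psum_bound. Qed.

Definition nonempty_fset A := A != fset0.

Lemma nonempty_fsetP A : reflect (exists x, x \in A) (nonempty_fset A).
Proof. exact: fset0Pn. Qed.

(** The energy with free boundary. The empty set is left out because the energy in
    a Gibbs measure contains only interactions that meet the volume. *)
Definition inner_energy L xi : R := psum L nonempty_fset xi.

Lemma inner_energy_in L D xi : (L `<=` D)%fset ->
  inner_energy L xi = psum D (fun A => nonempty_fset A && (A `<=` L)%fset) xi.
Proof.
move=> LD; rewrite /inner_energy /psum big_fset_condE [RHS]big_fset_condE /=.
apply: eq_fbigl => A; rewrite !inE !fpowersetE /=.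
have [AL|] := boolP (A `<=` L)%fset; last by rewrite !andbF.
by rewrite (fsubset_trans AL LD) andbT.
Qed.

Lemma inner_energy_local L : local_on L (inner_energy L).
Proof. exact: psum_local. Qed.

Lemma inner_energy_translate x L xi : inner_energy (translate x L) xi = inner_energy L (shift_config x xi).
Proof.
rewrite /inner_energy psum_shift; apply: eq_bigl => A; apply/nonempty_fsetP/nonempty_fsetP => -[y].
  by rewrite in_translate; exists (y - x).
by exists (y + x); rewrite in_translate addrK.
Qed.

Lemma inner_energy_mono L D xi : (L `<=` D)%fset ->
  `|inner_energy D xi - inner_energy L xi| <= C * (#|` D|%:R - #|` L|%:R).
Proof.
move=> LD; rewrite (inner_energy_in _ LD) /inner_energy psum_diff; last by move=> A /andP[].
rewrite -natrB ?fsubset_leq_card // -cardfsDS //.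
rewrite /psum big_seq_cond.
have -> : \sum_(A <- fpowerset D | (A \in fpowerset D) &&
    (nonempty_fset A && ~~ (nonempty_fset A && (A `<=` L)%fset))) Phi A xi =
    psum D (fun A => (A `<=` D)%fset && ~~ (A `<=` L)%fset) xi.
  rewrite [RHS]/psum big_seq_cond; apply: eq_bigl => A.
  rewrite !fpowersetE; case: (boolP (A `<=` D)%fset) => //= _.
  rewrite negb_and andb_orr andbN /=; case: (boolP (nonempty_fset A)) => //=.
  by rewrite negbK => /eqP ->; rewrite fsub0set.
apply: psum_bound => A /andP[AD /fsubsetPn[x xA xL]] _.
by exists x => //; rewrite inE xL (fsubsetP AD).
Qed.

(** The interactions that join [L] to [D] meet the inner boundary of [L]. *)
Lemma inner_energy_disjoint L D xi : [disjoint L & D]%fset ->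
  `|inner_energy (L `|` D)%fset xi - (inner_energy L xi + inner_energy D xi)| <= C * #|` bdry r L|%:R.
Proof.
move=> dis; rewrite (inner_energy_in xi (fsubsetUl L D)) (inner_energy_in xi (fsubsetUr L D)).
rewrite opprD addrA /inner_energy psum_diff; last by move=> A /andP[].
rewrite psum_diff; last first.
  move=> A /andP[A0 AD]; rewrite A0 /=; apply/negP => AL; move/nonempty_fsetP : A0 => [x xA].
  move: dis => /fdisjointP /(_ x (fsubsetP AL _ xA)).
  by rewrite (fsubsetP AD).
rewrite /psum big_seq_cond.
have -> : \sum_(A <- fpowerset (L `|` D)%fset | (A \in fpowerset (L `|` D)%fset) &&
    (nonempty_fset A && ~~ (nonempty_fset A && (A `<=` L)%fset) && ~~ (nonempty_fset A && (A `<=` D)%fset)))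
      Phi A xi =
    psum (L `|` D)%fset (fun A => [&& (A `<=` L `|` D)%fset, ~~ (A `<=` L)%fset &
       ~~ (A `<=` D)%fset]) xi.
  rewrite [RHS]/psum big_seq_cond; apply: eq_bigl => A.
  rewrite !fpowersetE; case: (boolP (A `<=` L `|` D)%fset) => //= _.
  case: (boolP (nonempty_fset A)) => //=.
  by rewrite negbK => /eqP ->; rewrite fsub0set.
apply: psum_bound => A /and3P[ALD AL /fsubsetPn[x xA xD]] Ar.
have xL : x \in L by move: (fsubsetP ALD _ xA); rewrite inE (negPf xD) orbF.
by exists x => //; exact: meets_bdry xA xL Ar AL.
Qed.

Lemma inner_energy_fset0 xi : inner_energy fset0 xi = 0.
Proof.
rewrite /inner_energy /psum big_seq_cond big1 // => A /andP[].
by rewrite fpowersetE fsubset0 => /eqP ->; rewrite /nonempty_fset eqxx.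
Qed.

End interaction.

(** * Partition functions with free boundary *)
Section log_partition.
Variables (R : realType) (d : nat) (S : finPointedType).
Implicit Types (L : {fset site d}) (f g : config d S -> R).

Lemma spin_sum_expR_gt0 L f s : 0 < spin_sum L (fun z => expR (f z)) s.
Proof.
apply: lt_le_trans (expR_gt0 (f s)) _.
by apply: (@le_spin_sum_term d S R L (fun z => expR (f z))) => z; exact: expR_ge0.
Qed.

(** The logarithm of a sum of exponentials is 1-Lipschitz for the uniform norm. *)
Lemma ln_spin_sum_close L f g s e : (forall z, `|f z - g z| <= e) ->
  `|ln (spin_sum L (fun z => expR (- f z)) s) -
    ln (spin_sum L (fun z => expR (- g z)) s)| <= e.
Proof.
have half u v : (forall z, `|u z - v z| <= e) ->
    ln (spin_sum L (fun z => expR (- u z)) s) <=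
    e + ln (spin_sum L (fun z => expR (- v z)) s).
  move=> uv; rewrite -{1}[e]expRK -lnM ?posrE ?expR_gt0 ?spin_sum_expR_gt0 //.
  rewrite ler_ln ?posrE ?mulr_gt0 ?expR_gt0 ?spin_sum_expR_gt0 //.
  rewrite -spin_sumZ; apply: le_spin_sum => z; rewrite -expRD ler_expR.
  by move: (uv z); rewrite ler_norml => /andP[h _]; lra.
move=> fg; have h1 := half f g fg.
have h2 : forall z, `|g z - f z| <= e by move=> z; rewrite distrC.
have {}h2 := half g f h2.
by rewrite ler_norml; apply/andP; split; lra.
Qed.

End log_partition.

Section free_partition.
Variables (R : realType) (d : nat) (E E' : finPointedType).
Variable Phi : potential R d (E * E')%type.
Hypotheses (Phi_local : local_potential Phi) (Phi_inv : potential_invariant Phi).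
Variable r : nat.
Hypothesis Phi_range : forall A : {fset site d}, (r < diam A)%N ->
  forall xi, Phi A xi = 0.
Variable C : R.
Hypotheses (C_ge0 : 0 <= C) (energy_le : forall D x xi,
  \sum_(A <- fpowerset D | x \in A) `|Phi A xi| <= C).
Variable sbar : config d E.
Implicit Types (L D A : {fset site d}) (sigma : config d E) (eta : config d E').

Lemma agree_join L sigma sigma' eta eta' : agree L sigma sigma' -> agree L eta eta' ->
  agree L (join_config sigma eta) (join_config sigma' eta').
Proof. by move=> h1 h2 x xL; rewrite /join_config h1 ?h2. Qed.

Lemma inner_energy_join_local L eta : local_on L (fun sigma => inner_energy Phi L (join_config sigma eta)).
Proof. by move=> s s' a; apply: (inner_energy_local Phi_local); exact: agree_join. Qed.

(** With interactions of range [r], the energy of [L] involves no site outside its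
    hull. *)
Definition hull L : {fset site d} := tiles r L.

Lemma meets_hull A L x : x \in A -> x \in L -> (diam A <= r)%N -> (A `<=` hull L)%fset.
Proof.
move=> xA xL Ar; apply: fsubset_trans (diam_cube xA Ar) _.
by apply/fsubsetP => y yx; rewrite in_tiles; apply/hasP; exists x.
Qed.

Lemma energyE L sigma eta D : (hull L `<=` D)%fset ->
  energy Phi L sigma eta =
  psum Phi D (fun A => (A `&` L != fset0)%fset) (join_config sigma eta).
Proof.
move=> hD; rewrite /energy /psum -[RHS]big_filter.
set s := [seq A <- fpowerset D | _].
rewrite (@fsbigE _ _ _ _ _ s).
- rewrite [LHS]big_seq_cond [RHS]big_seq; apply: eq_bigl => A.
  rewrite /s mem_filter andbC; case: (boolP (A `&` L != fset0)%fset) => /= AL; last first.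
    by rewrite andbF.
  by rewrite mem_set.
- exact/filter_uniq/fset_uniq.
- by move=> A /=; rewrite mem_filter => /andP[].
move=> A /= /[dup] AL /fset0Pn[x]; rewrite inE => /andP[xA xL].
rewrite mem_filter AL fpowersetE /= => AD; apply: Phi_range.
rewrite ltnNge; apply: contra AD => Ar; apply: fsubset_trans hD.
exact: meets_hull xA xL Ar.
Qed.

Lemma energy_local L D eta eta' : (hull L `<=` D)%fset -> agree D eta eta' ->
  (fun sigma => energy Phi L sigma eta) =1 (fun sigma => energy Phi L sigma eta').
Proof.
move=> hD a sigma; rewrite !(energyE _ _ hD).
by apply: (psum_local Phi_local); exact: agree_join.
Qed.

Lemma sub_hull L : (L `<=` hull L)%fset.
Proof.
apply/fsubsetP => x xL; rewrite in_tiles; apply/hasP; exists x => //.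
by apply/in_cube => i; rewrite subrr.
Qed.

(** Only interactions that meet both [L] and its complement are counted on one side
    only, and by finite range these meet the inner boundary. *)
Lemma energy_free L sigma eta :
  `|energy Phi L sigma eta - inner_energy Phi L (join_config sigma eta)| <= C * #|` bdry r L|%:R.
Proof.
rewrite (energyE _ _ (fsubset_refl _)) (inner_energy_in _ _ (sub_hull L)).
have [/eqP L0|Ln] := boolP (L == fset0).
  rewrite /psum !big1 ?subrr ?normr0 ?mulr_ge0 //.
    by move=> A /andP[/nonempty_fsetP[x xA]]; rewrite L0 fsubset0 => /eqP A0; rewrite A0 inE in xA.
  by move=> A; rewrite L0 fsetI0 eqxx.
rewrite psum_diff; last first.
  move=> A /andP[/nonempty_fsetP[x xA] AL]; apply/fset0Pn; exists x.
  by rewrite inE xA (fsubsetP AL).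
apply: (psum_bound Phi_range energy_le) => A /andP[/fset0Pn[x]].
rewrite inE => /andP[xA xL] AL Ar; exists x => //; apply: (meets_bdry xA xL Ar).
by apply: contra AL => ->; rewrite andbT; apply/nonempty_fsetP; exists x.
Qed.

(** Outside [L], [sbar] provides default values. *)
Definition Zfree L eta : R :=
  spin_sum L (fun sigma => expR (- inner_energy Phi L (join_config sigma eta))) sbar.

Lemma Zfree_base L eta s :
  Zfree L eta = spin_sum L (fun sigma => expR (- inner_energy Phi L (join_config sigma eta))) s.
Proof. by apply: spin_sum_cst => z z' /(@inner_energy_join_local L eta) ->. Qed.

Lemma Zfree_gt0 L eta : 0 < Zfree L eta.
Proof. exact: spin_sum_expR_gt0. Qed.

Lemma Zfree_local L : local_on L (Zfree L).
Proof.
move=> eta eta' a; apply: eq_spin_sum => sigma; congr (expR (- _)).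
by apply: (inner_energy_local Phi_local); exact: agree_join.
Qed.

Lemma Zfree_translate x L eta : Zfree (translate x L) eta = Zfree L (shift_config x eta).
Proof.
rewrite [RHS](Zfree_base _ _ (shift_config x sbar)) -spin_sum_shift.
by apply: eq_spin_sum => sigma /=; rewrite inner_energy_translate.
Qed.

Lemma partition_function_gt0 L eta : 0 < partition_function Phi L sbar eta.
Proof. exact: (spin_sum_expR_gt0 L (fun s => - energy Phi L s eta)). Qed.

Lemma partition_function_free L eta :
  `|ln (partition_function Phi L sbar eta) - ln (Zfree L eta)| <= C * #|` bdry r L|%:R.
Proof.
apply: (@ln_spin_sum_close R d E L (fun s => energy Phi L s eta)
  (fun s => inner_energy Phi L (join_config s eta))) => sigma.
exact: energy_free.
Qed.

Lemma partition_function_local L : local_on (hull L) (partition_function Phi L sbar).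
Proof.
move=> eta eta' a; apply: (@eq_spin_sum d E R L (fun s => expR (- energy Phi L s eta))
  (fun s => expR (- energy Phi L s eta')) sbar) => sigma.
by congr (expR (- _)); apply: energy_local a _.
Qed.

(** Without the interactions across the boundary of [L] the sum factorizes. *)
Lemma Zfree_disjoint L D eta : [disjoint L & D]%fset ->
  `|ln (Zfree (L `|` D)%fset eta) - (ln (Zfree L eta) + ln (Zfree D eta))| <=
    C * #|` bdry r L|%:R.
Proof.
move=> dis; rewrite -lnM ?posrE ?Zfree_gt0 //.
have <- : spin_sum (L `|` D)%fset (fun s => expR (-
    (inner_energy Phi L (join_config s eta) + inner_energy Phi D (join_config s eta)))) sbar =
    Zfree L eta * Zfree D eta.
  rewrite spin_sumU // mulrC [Zfree L eta]/Zfree -spin_sumZ.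
  apply: eq_spin_sum => s; rewrite (Zfree_base D eta s) mulrC -(@spin_sumMl _ _ _ D L
    (fun s => expR (- inner_energy Phi L (join_config s eta)))).
  - by apply: eq_spin_sum => s'; rewrite opprD expRD.
  - by rewrite fdisjoint_sym.
  - by move=> z z' /(@inner_energy_join_local L eta) ->.
apply: ln_spin_sum_close => s; exact: (inner_energy_disjoint Phi_range energy_le).
Qed.

(** A site changes the logarithm of the partition function by its energy and by the
    entropy of its spin. *)
Definition Cvol : R := C + ln #|E|%:R.

Lemma lnE_ge0 : 0 <= ln #|E|%:R :> R.
Proof. by rewrite ln_ge0 // ler1n; apply/card_gt0P; exists point. Qed.

Lemma Cvol_ge0 : 0 <= Cvol.
Proof. by rewrite addr_ge0 // lnE_ge0. Qed.

Lemma Zfree_mono L D eta : (L `<=` D)%fset ->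
  `|ln (Zfree D eta) - ln (Zfree L eta)| <= Cvol * (#|` D|%:R - #|` L|%:R).
Proof.
move=> LD; have E0 : 0 < #|E|%:R :> R by apply: card_gt0R.
have DE : (L `|` (D `\` L))%fset = D.
  by apply/fsetP => x; rewrite !inE; case: (boolP (x \in L)) => // /(fsubsetP LD) ->.
have dis : [disjoint L & D `\` L]%fset by apply/fdisjointP => x xL; rewrite inE xL.
have cDL : #|` D|%:R - #|` L|%:R = #|` (D `\` L)%fset|%:R :> R.
  by rewrite cardfsDS // natrB ?fsubset_leq_card.
have h : `|ln (Zfree D eta) - ln (spin_sum D (fun s => expR (- inner_energy Phi L (join_config s eta))) sbar)|
    <= C * (#|` D|%:R - #|` L|%:R).
  by apply: ln_spin_sum_close => s; exact: (inner_energy_mono Phi_range energy_le).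
have e : ln (spin_sum D (fun s => expR (- inner_energy Phi L (join_config s eta))) sbar) =
    ln (Zfree L eta) + ln #|E|%:R * (#|` D|%:R - #|` L|%:R).
  rewrite cDL mulr_natr -lnXn // -lnM ?posrE ?Zfree_gt0 ?exprn_gt0 //; congr ln.
  rewrite -[X in spin_sum X]DE spin_sumU // mulrC -spin_sumZ; apply: eq_spin_sum => s.
  rewrite -[X in X * _]mul1r -(spin_sum1 (D `\` L)%fset 1 s) mulrC.
  rewrite -(@spin_sumMl _ _ _ (D `\` L)%fset L
    (fun s => expR (- inner_energy Phi L (join_config s eta)))).
  - by apply: eq_spin_sum => s'; rewrite mulr1.
  - by rewrite fdisjoint_sym.
  - by move=> z z' /(@inner_energy_join_local L eta) ->.
rewrite /Cvol mulrDl; have : 0 <= ln #|E|%:R * (#|` D|%:R - #|` L|%:R) :> R.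
  by apply: mulr_ge0; [exact: lnE_ge0|rewrite subr_ge0 ler_nat fsubset_leq_card].
move: h; rewrite e; move: (C * _) (ln #|E|%:R * _) => u v.
by rewrite !ler_norml => /andP[? ?] ?; apply/andP; split; lra.
Qed.

Lemma lnZfree_fset0 eta : ln (Zfree fset0 eta) = 0.
Proof. by rewrite /Zfree spin_sum_fset0 inner_energy_fset0 oppr0 expR0 ln1. Qed.

Lemma lnZfree_le L eta : `|ln (Zfree L eta)| <= Cvol * #|` L|%:R.
Proof.
by have := Zfree_mono eta (fsub0set L); rewrite lnZfree_fset0 cardfs0 !subr0.
Qed.

(** The sign allows the tiling bound to be used for upper and for lower estimates. *)
Lemma Zfree_tile (e : bool) m eta x L :
  [disjoint translate x (box d (m + 0)) & L]%fset ->
  (-1) ^+ e * ln (Zfree (translate x (box d m) `|` L)%fset eta) <=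
  ((-1) ^+ e * ln (Zfree (box d m) (shift_config x eta)) + C * #|` bdry r (box d m)|%:R) +
  (-1) ^+ e * ln (Zfree L eta).
Proof.
rewrite addn0 => dis; have := Zfree_disjoint eta dis.
rewrite Zfree_translate bdry_translate card_translate ler_norml.
by case: e; rewrite ?expr0 ?expr1 ?mul1r ?mulN1r => /andP[? ?]; lra.
Qed.

(** Tilings by translates of the small box, averaged over their offsets, turn the
    additivity of [ln Zfree] into an average over all sites. *)
Lemma lnZfree_avg m n eta : (m <= n)%N ->
  `|ln (Zfree (box d n) eta) / (vol d n)%:R -
    avg n (fun eta => ln (Zfree (box d m) eta) / (vol d m)%:R) eta| <=
  C * #|` bdry r (box d m)|%:R / (vol d m)%:R + 2 * Cvol * layer d n m.
Proof.
move=> mn; have vm := vol_pos R d m; have vn := vol_pos R d n.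
set psi := fun x => ln (Zfree (box d m) (shift_config x eta)).
set B := C * #|` bdry r (box d m)|%:R.
have B0 : 0 <= B by rewrite mulr_ge0.
have vnm : (vol d (n - m))%:R <= (vol d n)%:R :> R by rewrite ler_nat leq_vol ?leq_subr.
have tile (e : bool) : (vol d m)%:R * ((-1) ^+ e * ln (Zfree (box d n) eta)) <=
    (-1) ^+ e * (\sum_(x <- box d (n - m)) psi x) + (vol d n)%:R * B +
    Cvol * (vol d m)%:R * ((vol d n)%:R - (vol d (n - m))%:R).
  have := @tiling_le d R (fun L => (-1) ^+ e * ln (Zfree L eta))
    (fun x => (-1) ^+ e * psi x + B) Cvol m 0 (@Zfree_tile e m eta) _ _ n mn.
  rewrite addn0 -mulrBr (mulrA Cvol) big_split /= -big_distrr /= => h; apply: le_trans (h _ _) _.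
  - move=> L D /(Zfree_mono eta); rewrite ler_norml.
    by case: e {h}; rewrite ?expr0 ?expr1 ?mul1r ?mulN1r => /andP[? ?]; lra.
  - by rewrite lnZfree_fset0 mulr0.
  rewrite lerD2r lerD2l big_const_seq count_predT iter_addr addr0 -[leLHS]mulr_natl.
  by rewrite ler_wpM2r.
have shrink : `|\sum_(x <- box d n) psi x - \sum_(x <- box d (n - m)) psi x| <=
    Cvol * (vol d m)%:R * ((vol d n)%:R - (vol d (n - m))%:R).
  apply: (sum_fsetD_le (A := box d (n - m)) (L := box d n)).
    by apply: box_sub; exact: leq_subr.
  by move=> x; exact: lnZfree_le.
have avgE : avg n (fun eta => ln (Zfree (box d m) eta) / (vol d m)%:R) eta =
    (vol d n)%:R^-1 * (vol d m)%:R^-1 * \sum_(x <- box d n) psi x.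
  by rewrite /avg -big_distrl /= mulrCA mulrC.
have t0 := tile false; have t1 := tile true.
rewrite avgE /layer; move: t0 t1 shrink.
rewrite expr0 expr1 !mul1r !mulN1r.
move: (\sum_(x <- box d n) psi x) (\sum_(x <- box d (n - m)) psi x) => s s'.
move: (ln (Zfree (box d n) eta)) => z.
set vM := (vol d m)%:R in vm *; set vN := (vol d n)%:R in vn vnm *; set w := (vol d (n - m))%:R.
move=> t0 t1; rewrite ler_norml => /andP[s0 s1].
have -> : z / vN - vN^-1 * vM^-1 * s = (vM * z - s) / (vN * vM) by field; rewrite !gt_eqF.
have -> : B / vM + 2 * Cvol * ((vN - w) / vN) =
    (vN * B + 2 * (Cvol * vM * (vN - w))) / (vN * vM) by field; rewrite !gt_eqF.
have vv : 0 < vN * vM by rewrite mulr_gt0.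
rewrite normf_div (gtr0_norm vv) ler_pdivrMr // divfK ?gt_eqF //.
move: t0 t1 s0 s1; rewrite mulrN; move: (vM * z) (vN * B) (Cvol * vM * _) => a b c' *.
by rewrite ler_norml; apply/andP; split; lra.
Qed.

End free_partition.

(** * Limits of bounded measurable functions *)
Section limits.
Variable R : realType.

Lemma cvgn_of_close (u : nat -> R) (a : nat -> nat -> R) : (forall m, cvgn (a m)) ->
  (forall e, 0 < e -> exists m N, forall n, (N <= n)%N -> `|u n - a m n| <= e) ->
  cvgn u.
Proof.
move=> acv close; apply: cauchy_cvg; apply: cauchy_exP => e e0.
have e3 : 0 < e / 3 by rewrite divr_gt0.
have [m [N hN]] := close _ e3.
have /cvg_ex[l al] := acv m.
move/cvgrPdist_le : al => /(_ _ e3)[N' _ hN'].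
exists l; exists (maxn N N') => // n /=; rewrite geq_max => /andP[n1 n2].
rewrite /ball /=; have := hN' n n2; have := hN n n1; rewrite (distrC (u n)) => h1 h2.
apply: le_lt_trans (ler_distD (a m n) _ _) _.
apply: le_lt_trans (lerD h2 h1) _; lra.
Qed.

Lemma cvgn_cauchy (u : nat -> R) : cvgn u <->
  (forall k, exists N, forall n, (N <= n)%N -> `|u n - u N| <= k.+1%:R^-1).
Proof.
split=> [/cvg_ex[l ul] k|h].
  have k0 : 0 < k.+1%:R^-1 / 2 :> R by rewrite divr_gt0 // invr_gt0.
  move/cvgrPdist_le : ul => /(_ _ k0)[N _ hN]; exists N => n Nn.
  have := hN n Nn; have := hN N (leqnn N) => h1 h2.
  apply: le_trans (ler_distD l _ _) _; rewrite [X in X + _]distrC.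
  by apply: le_trans (lerD h2 h1) _; rewrite -splitr.
apply: cauchy_cvg; apply: cauchy_exP => e e0.
have [k hk] := cvg_small (@cvg_cst_div R 2) e0.
have {}hk := hk k (leqnn k); rewrite ger0_norm ?divr_ge0 // in hk.
have [N hN] := h k; exists (u N); exists N => // n /= Nn.
rewrite /ball /= distrC; apply: le_lt_trans (hN n Nn) _; apply: lt_le_trans hk.
by rewrite ltr_pMl ?invr_gt0 // ltr1n.
Qed.

Variables (disp : measure_display) (T : measurableType disp) (f : nat -> T -> R).
Hypothesis mf : forall n, measurable_fun setT (f n).

Lemma measurable_cvgn : measurable [set x | cvgn (fun n => f n x)].
Proof.
have -> : [set x | cvgn (fun n => f n x)] = \bigcap_k \bigcup_N \bigcap_n
    [set x | (N <= n)%N -> `|f n x - f N x| <= k.+1%:R^-1].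
  apply/seteqP; split=> x /=.
    by move=> /cvgn_cauchy h k _; have [N hN] := h k; exists N => // n _; exact: hN.
  move=> h; apply/cvgn_cauchy => k; have [N _ hN] := h k I.
  by exists N => n Nn; exact: hN.
apply: bigcap_measurableType => k _; apply: bigcup_measurable => N _.
apply: bigcap_measurableType => n _; have [Nn|Nn] := leqP N n; last first.
  by rewrite (_ : [set _ | _] = setT) //; apply/seteqP; split.
have -> : [set x | true -> `|f n x - f N x| <= k.+1%:R^-1] =
    setT `&` (fun x => `|f n x - f N x|) @^-1` `]-oo, k.+1%:R^-1].
  by apply/seteqP; split=> x /=; rewrite in_itv /=; [move=> h; split=> //; exact: h|case].
have mg : measurable_fun setT (fun x => `|f n x - f N x|).
  by apply: measurableT_comp => //; exact: measurable_funB.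
by apply: mg => //; exact: measurable_itv.
Qed.

(** On the measurable set of convergence this is a pointwise limit, and elsewhere
    [limn] has a fixed default value. *)
Lemma measurable_limn : measurable_fun setT (fun x => limn (fun n => f n x)).
Proof.
pose D := [set x | cvgn (fun n => f n x)].
have mD : measurable D by exact: measurable_cvgn.
have mlim : measurable_fun D (fun x => limn (fun n => f n x)).
  apply: (measurable_fun_cvg (h := f)); last by move=> x Dx; exact: Dx.
  by move=> n; apply: measurable_funS (mf n).
move=> _ Y mY; rewrite setTI.
have -> : (fun x => limn (fun n => f n x)) @^-1` Y =
    (D `&` (fun x => limn (fun n => f n x)) @^-1` Y) `|`
    (~` D `&` [set _ | Y (point : R)]).
  apply/seteqP; split=> [x /= Yx|x /= [[]//|[nD]]].
    have [Dx|nD] := pselect (D x); [by left|right; split => //].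
    by move: Yx; rewrite /preimage /= dvgP.
  by rewrite dvgP.
apply: measurableU; first exact: mlim.
apply: measurableI; first exact: measurableC.
have [h|h] := pselect (Y (point : R)).
  by rewrite (_ : [set _ | _] = setT) //; apply/seteqP; split.
by rewrite (_ : [set _ | _] = set0) //; apply/seteqP; split.
Qed.

Variables (P : probability T R) (M : R).
Hypotheses (fM : forall n x, `|f n x| <= M)
  (f_cvg : {ae P, forall x, cvgn (fun n => f n x)}).

Lemma Ex_limn : exists2 l : R,
  (\int[P]_x (limn (fun n => f n x))%:E)%E = l%:E & Ex P (f n) @[n --> \oo] --> l.
Proof.
have bf n : bounded_mfun (f n) by split; [exact: mf|exists M].
have [] := @dominated_convergence _ T R P setT measurableT
  (fun n x => (f n x)%:E) (fun x => (limn (fun n => f n x))%:E) (fun=> M%:E).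
- by move=> n; apply/measurable_EFinP.
- by apply/measurable_EFinP; exact: measurable_limn.
- apply: filterS f_cvg => x fx _.
  by apply: cvg_comp fx _; exact: cvg_id.
- exact: (bounded_mfun_integrable P (bounded_mfun_cst M)).
- by apply: aeW => x n _; rewrite abse_EFin lee_fin.
move=> ilim _ cv; exists (fine (\int[P]_x (limn (fun n => f n x))%:E)%E).
  by rewrite fineK //; exact: integrable_fin_num ilim.
apply: fine_cvg; rewrite fineK; last exact: integrable_fin_num ilim.
exact: cv.
Qed.

End limits.

(** * The pressure and the mean energy *)
Section densities.
Variables (R : realType) (d : nat) (E E' : finPointedType).
Variable Phi : potential R d (E * E')%type.
Hypotheses (Phi_local : local_potential Phi) (Phi_inv : potential_invariant Phi).
Variable r : nat.
Hypothesis Phi_range : forall A : {fset site d}, (r < diam A)%N ->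
  forall xi, Phi A xi = 0.
Variable C : R.
Hypotheses (C_ge0 : 0 <= C) (energy_le : forall D x xi,
  \sum_(A <- fpowerset D | x \in A) `|Phi A xi| <= C).
Variable sbar : config d E.
Implicit Types (eta : config d E') (xi : config d (E * E')%type).

Local Notation Cv := (Cvol E C).

Lemma bdry_layer n : (r <= n)%N ->
  #|` bdry r (box d n)|%:R / (vol d n)%:R <= layer d n r :> R.
Proof.
move=> rn; rewrite ler_wpM2r ?invr_ge0 // -natrB ?leq_vol ?leq_subr // ler_nat.
exact: card_bdry_box.
Qed.

Lemma pressureE eta n : pressure_density Phi sbar eta n =
  ln (partition_function Phi (box d n) sbar eta) / (vol d n)%:R.
Proof. by rewrite /pressure_density mulrC. Qed.

Lemma pressure_avg m n eta : (r <= m)%N -> (m <= n)%N ->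
  `|pressure_density Phi sbar eta n -
    avg n (fun eta => ln (Zfree Phi sbar (box d m) eta) / (vol d m)%:R) eta| <=
  C * layer d n r + (C * layer d m r + 2 * Cv * layer d n m).
Proof.
move=> rm mn; have rn := leq_trans rm mn.
apply: le_trans (ler_distD (ln (Zfree Phi sbar (box d n) eta) / (vol d n)%:R) _ _) _.
apply: lerD.
  rewrite pressureE -mulrBl normrM [X in _ * X]ger0_norm ?invr_ge0 //.
  apply: le_trans (ler_wpM2r _ (partition_function_free Phi_range C_ge0 energy_le sbar _ _)) _.
    by rewrite invr_ge0.
  by rewrite -mulrA ler_wpM2l // bdry_layer.
apply: le_trans (lnZfree_avg Phi_local Phi_inv Phi_range C_ge0 energy_le sbar _ mn) _.
by rewrite lerD2r -mulrA ler_wpM2l // bdry_layer.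
Qed.

Lemma pressure_bounded eta n : `|pressure_density Phi sbar eta n| <= C + Cv.
Proof.
rewrite pressureE normrM [X in _ * X]ger0_norm ?invr_ge0 // ler_pdivrMr ?vol_pos //.
rewrite -[ln _](subrK (ln (Zfree Phi sbar (box d n) eta))) mulrDl.
apply: le_trans (ler_normD _ _) _; apply: lerD.
  apply: le_trans (partition_function_free Phi_range C_ge0 energy_le sbar _ _) _.
  rewrite ler_wpM2l // ler_nat; apply/fsubset_leq_card/fsubsetP => x.
  by rewrite !inE => /andP[].
exact: (lnZfree_le Phi_local Phi_range energy_le).
Qed.

Lemma pressure_local n :
  local_on (hull r (box d n)) (fun eta => pressure_density Phi sbar eta n).
Proof.
move=> eta eta' a; rewrite !pressureE.
by rewrite (partition_function_local Phi_local Phi_range sbar a).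
Qed.

Variable K : probability (config d (E * E')%type) R.
Hypothesis K_inv : invariant_measure K.

(** The ergodic theorem handles each box size [m]; the error of the comparison
    vanishes as first [n] and then [m] grows. *)
Lemma pressure_ae :
  {ae K, forall xi, cvgn (pressure_density Phi sbar (disorder xi))}.
Proof.
pose psi m xi := ln (Zfree Phi sbar (box d m) (disorder xi)) / (vol d m)%:R.
have lpsi m : local_on (box d m) (psi m).
  move=> xi xi' a; rewrite /psi; congr (ln _ / _).
  by apply: (Zfree_local Phi_local) => x xm; rewrite /disorder a.
have ae m : {ae K, forall xi, cvgn (fun n => avg n (psi m) xi)}.
  have [M [_ psiM]] := local_on_bounded (lpsi m).
  exact: (ergodic_ae K_inv (local_bounded_mfun (lpsi m)) psiM).
apply: filterS (ae_foralln ae) => xi cv.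
apply: (@cvgn_of_close R _ (fun m n => avg n (psi m) xi)) => // e e0.
have e3 : 0 < e / 3 by rewrite divr_gt0.
have Cv0 : 0 <= 2 * Cv by rewrite mulr_ge0 ?Cvol_ge0.
have [m hm] := layer_small d r C_ge0 e3; have [rm lm] := hm m (leqnn m).
have [N1 hN1] := layer_small d m Cv0 e3.
exists m, (maxn N1 m) => n; rewrite geq_max => /andP[n1 mn].
have [_ l1] := hN1 n n1; have [_ l2] := hm n mn.
have := pressure_avg (disorder xi) rm mn.
have -> : avg n (fun eta => ln (Zfree Phi sbar (box d m) eta) / (vol d m)%:R)
    (disorder xi) = avg n (psi m) xi by [].
move=> h; apply: le_trans h _; move: lm l1 l2.
move: (C * _) (C * _) (2 * Cv * _) => x y z; lra.
Qed.

Lemma Ex_pressure : exists2 l : R,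
  (\int[K]_xi (limn (pressure_density Phi sbar (disorder xi)))%:E)%E = l%:E &
  Ex K (fun xi => pressure_density Phi sbar (disorder xi) n) @[n --> \oo] --> l.
Proof.
apply: (@Ex_limn R _ _ (fun n xi => pressure_density Phi sbar (disorder xi) n) _ K (C + Cv)).
- move=> n; have loc := @local_on_disorder d E E' R _ _ (@pressure_local n).
  exact: local_measurable_fun loc.
- by move=> n xi; exact: pressure_bounded.
- exact: pressure_ae.
Qed.

Let weight (A : {fset site d}) : R := #|` A|%:R^-1.

Definition site_energy xi : R :=
  \sum_(A <- fpowerset (box d r) | (0 : site d) \in A) weight A * Phi A xi.

Lemma site_energy_local : local_on (box d r) site_energy.
Proof.
move=> xi xi' a; rewrite /site_energy big_seq_cond [RHS]big_seq_cond.
apply: eq_bigr => A /andP[]; rewrite fpowersetE => AD _; congr (_ * _).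
by apply: Phi_local => x xA; apply/a/(fsubsetP AD).
Qed.

Lemma site_energy_shift D x xi : (translate x (box d r) `<=` D)%fset ->
  site_energy (shift_config x xi) = \sum_(A <- fpowerset D | x \in A) weight A * Phi A xi.
Proof.
move=> xD; rewrite /site_energy.
transitivity (\sum_(A <- fpowerset (translate x (box d r)) | x \in A) weight A * Phi A xi).
  rewrite fpowerset_translate [RHS]big_mkcond big_imfset /=; last first.
    by move=> A B _ _; exact: translate_inj.
  rewrite -big_mkcond /=; apply: eq_big => [A|A _].
    by rewrite in_translate subrr.
  by rewrite (Phi_shift Phi_inv) /weight card_translate.
rewrite big_mkcond [RHS]big_mkcond; apply: big_fset_incl; first by rewrite fpowersetS.
move=> A _ Ax; case: ifP => // xA; rewrite Phi_range ?mulr0 // ltnNge.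
by apply: contra Ax => Ar; rewrite fpowersetE; exact: diam_cube.
Qed.

(** The energy of each interaction is shared equally among its sites; this is exact
    for interactions inside the box, and the others meet the boundary. *)
Lemma inner_energy_site_energy n xi :
  `|inner_energy Phi (box d n) xi - \sum_(x <- box d n) site_energy (shift_config x xi)| <=
  C * #|` bdry r (box d n)|%:R.
Proof.
set L := box d n; set D := hull r L.
have LD : (L `<=` D)%fset by exact: sub_hull.
pose w (A : {fset site d}) : R := weight A * #|` (A `&` L)%fset|%:R.
have -> : \sum_(x <- L) site_energy (shift_config x xi) =
    \sum_(A <- fpowerset D) w A * Phi A xi.
  rewrite (eq_big_seq (fun x => \sum_(A <- fpowerset D | x \in A) weight A * Phi A xi)).
    rewrite (exchange_big_dep predT) //=; apply: eq_bigr => A _.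
    rewrite big_const_seq iter_addr addr0 -[LHS]mulr_natr mulrAC /w.
    congr (_ * _%:R * _).
    rewrite -sum1_count -sum1_size big_fset_condE; apply: eq_fbigl => x.
    by rewrite !inE andbC.
  move=> x xL; apply: site_energy_shift; apply/fsubsetP => y yx.
  by rewrite in_tiles; apply/hasP; exists x.
rewrite (inner_energy_in _ _ LD) /psum big_mkcond -sumrB.
apply: le_trans (ler_norm_sum _ _ _) _.
pose p A := (A `&` L != fset0)%fset && ~~ (A `<=` L)%fset.
apply: (@le_trans _ _ (\sum_(A <- fpowerset D | p A) `|Phi A xi|)); last first.
  apply: (abs_psum_bound Phi_range energy_le) => A /andP[/fset0Pn[x]].
  by rewrite inE => /andP[xA xL] AL Ar; exists x => //; exact: (meets_bdry xA xL Ar).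
rewrite [leRHS]big_mkcond; apply: ler_sum => A _; rewrite /p.
have [/eqP A0|An] := boolP (A == fset0).
  rewrite A0 /nonempty_fset eqxx /= /w fset0I eqxx cardfs0 mulr0 mul0r subr0.
  by rewrite normr0.
have [AL|AL] := boolP (A `<=` L)%fset.
  rewrite /nonempty_fset An andbF /= /w (fsetIidPl AL) /weight mulVf ?mul1r ?subrr ?normr0 //.
  by rewrite pnatr_eq0 cardfs_eq0.
rewrite /nonempty_fset An /= andbT sub0r normrN normrM.
have [_|/negPn/eqP AL0] := boolP (A `&` L != fset0)%fset; last first.
  by rewrite /w AL0 cardfs0 mulr0 normr0 mul0r.
rewrite ler_piMl // ger0_norm ?mulr_ge0 ?invr_ge0 // /w /weight mulrC.
rewrite ler_pdivrMr ?mul1r ?ler_nat ?ltr0n ?cardfs_gt0 //.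
exact/fsubset_leq_card/fsubsetIl.
Qed.

Lemma Ex_inner_energy : Ex K (inner_energy Phi (box d n)) / (vol d n)%:R @[n --> \oo] --> Ex K site_energy.
Proof.
have bse : bounded_mfun site_energy := local_bounded_mfun site_energy_local.
have bU n : bounded_mfun (inner_energy Phi (box d n)).
  exact: (local_bounded_mfun (inner_energy_local Phi_local (L := box d n))).
apply/cvgrPdist_le => e e0.
have [N hN] := layer_small d r C_ge0 e0.
exists N => // n /= /hN[rn ln]; apply: le_trans ln.
rewrite distrC -(Ex_avg K_inv n bse) /avg ExZ; last first.
  by apply: (@bounded_mfun_sum _ _ R _ _ (fun x => site_energy \o shift_config x)) => x;
     exact: bounded_shift.
rewrite mulrC -mulrBr normrM ger0_norm ?invr_ge0 //.
apply: (@le_trans _ _ ((vol d n)%:R^-1 * (C * #|` bdry r (box d n)|%:R))).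
  rewrite ler_wpM2l ?invr_ge0 //; apply: Ex_close => //; last exact: inner_energy_site_energy.
  by apply: (@bounded_mfun_sum _ _ R _ _ (fun x => site_energy \o shift_config x)) => x;
     exact: bounded_shift.
by rewrite mulrCA ler_wpM2l // mulrC bdry_layer.
Qed.

Lemma Ex_site_energy :
  (\sum_(A \in [set A : {fset site d} | (0%R : site d) \in A])
     (weight A)%:E * \int[K]_xi (Phi A xi)%:E)%E = (Ex K site_energy)%:E.
Proof.
have bPhi A : bounded_mfun (Phi A).
  by apply: (local_bounded_mfun (L := A)) => xi xi' a; exact: Phi_local.
pose s : seq {fset site d} := [seq A <- fpowerset (box d r) | (0 : site d) \in A].
rewrite (@fsbigE _ _ _ {fset site d} _ s).
- have -> : Ex K site_energy = \sum_(A <- fpowerset (box d r) | (0 : site d) \in A)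
      weight A * Ex K (Phi A).
    rewrite -big_filter -(eq_bigr _ (fun A _ => ExZ K (weight A) (bPhi A))).
    rewrite -Ex_sum; last by move=> A; exact: bounded_mfunZ.
    by congr (Ex K _); apply/funext => xi; rewrite /site_energy -big_filter.
  rewrite -sumEFin -[RHS]big_filter big_seq_cond -/s [RHS]big_seq.
  apply: eq_big => A; last by move=> _; rewrite EFinM EFin_Ex.
  rewrite mem_filter; case: (boolP ((0 : site d) \in A)) => //= A0.
  by rewrite mem_set ?andbT.
- exact/filter_uniq/fset_uniq.
- by move=> A /=; rewrite mem_filter => /andP[].
move=> A /= A0; rewrite mem_filter A0 fpowersetE /= => Ar.
rewrite (_ : (fun xi => _) = fun=> 0%E) ?integral0 ?mule0 //.
apply/funext => xi; rewrite Phi_range // ltnNge; apply: contra Ar => Ar.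
by have := diam_cube A0 Ar; rewrite translate0.
Qed.

End densities.

(** * Cylinder probabilities of joint measures *)
Section gibbs_bounds.
Variables (R : realType) (d : nat) (E E' : finPointedType).
Variable Phi : potential R d (E * E')%type.
Hypotheses (Phi_local : local_potential Phi).
Variable r : nat.
Hypothesis Phi_range : forall A : {fset site d}, (r < diam A)%N ->
  forall xi, Phi A xi = 0.
Variable C : R.
Hypotheses (C_ge0 : 0 <= C) (energy_le : forall D x xi,
  \sum_(A <- fpowerset D | x \in A) `|Phi A xi| <= C).
Variable sbar : config d E.
Implicit Types (sigma : config d E) (eta : config d E') (L V D : {fset site d}).

Definition spins (xi : config d (E * E')%type) : config d E := fun x => (xi x).1.

Lemma join_spins (xi : config d (E * E')%type) : join_config (spins xi) (disorder xi) = xi.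
Proof. by apply/funext => x; rewrite /join_config /spins /disorder -surjective_pairing. Qed.

Lemma cyl_join L xi sigma eta : cyl L xi (join_config sigma eta) <->
  cyl L (spins xi) sigma /\ cyl L (disorder xi) eta.
Proof.
rewrite -{1}(join_spins xi); split=> [h|[h1 h2]]; last exact: agree_join.
by split=> x /h []; rewrite /join_config /spins /disorder.
Qed.

Lemma spin_sum_split L D (f g : config d E -> R) A s : [disjoint L & D]%fset ->
  [disjoint L & A]%fset -> local_on L f -> local_on A g ->
  spin_sum (D `|` L)%fset (fun z => f z * g z) s = spin_sum L f s * spin_sum D g s.
Proof.
move=> LD LA lf lg; rewrite spin_sumU; last by rewrite fdisjoint_sym.
rewrite -spin_sumZ; apply: eq_spin_sum => z.
under eq_spin_sum do rewrite mulrC.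
by rewrite (spin_sumMl _ _ LA lg) mulrC (spin_sum_cst _ s lf).
Qed.

Section volume.
Variables (L V : {fset site d}).
Hypothesis LV : (L `<=` V)%fset.

(* The energy of the interactions that avoid [L]; it is the same for all spins in
   [L] and cancels between the numerator and the partition function. *)
Let outer eta sigma : R := psum Phi (hull r V)
  (fun A => (A `&` V != fset0)%fset && [disjoint A & L]%fset) (join_config sigma eta).

Let outer_local eta : local_on (hull r V `\` L)%fset (outer eta).
Proof.
move=> s s' a; rewrite /outer /psum big_seq_cond [RHS]big_seq_cond.
apply: eq_bigr => A /and3P[]; rewrite fpowersetE => AD _ /fdisjointP AL.
apply: Phi_local => x xA; rewrite /join_config (a x) //.
by rewrite inE AL // (fsubsetP AD).
Qed.

Let energy_split eta sigma :
  `|energy Phi V sigma eta - (inner_energy Phi L (join_config sigma eta) + outer eta sigma)| <=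
  C * #|` bdry r L|%:R.
Proof.
have LD : (L `<=` hull r V)%fset := fsubset_trans LV (sub_hull r V).
rewrite (energyE Phi_range _ _ (fsubset_refl _)) (inner_energy_in _ _ LD) opprD addrA.
rewrite psum_diff; last first.
  move=> A /andP[/nonempty_fsetP[x xA] AL]; apply/fset0Pn; exists x.
  by rewrite inE xA (fsubsetP LV) // (fsubsetP AL).
rewrite psum_diff; last first.
  move=> A /andP[-> AL] /=; apply/negP => /andP[/nonempty_fsetP[x xA] AL'].
  by move: AL => /fdisjointP /(_ x xA); rewrite (fsubsetP AL').
apply: (psum_bound Phi_range energy_le) => A /andP[/andP[AV h1] h2] Ar.
move: h2; rewrite AV /= => h2.
have [x xA xL] : exists2 x, x \in A & x \in L.
  by move: h2 => /fset0Pn[x]; rewrite inE => /andP[xA xL]; exists x.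
exists x => //; apply: (meets_bdry xA xL Ar).
by apply: contra h1 => ->; rewrite andbT; apply/nonempty_fsetP; exists x.
Qed.

Variable xi : config d (E * E')%type.
Local Notation b := (C * #|` bdry r L|%:R).
Local Notation boltzmann := (expR (- inner_energy Phi L xi) / Zfree Phi sbar L (disorder xi)).

Let inside eta := [set sigma | cyl L xi (join_config sigma eta)].

Let VE : ((V `\` L) `|` L)%fset = V.
Proof.
by apply/fsetP => x; rewrite !inE; case: (boolP (x \in L)) => [/(fsubsetP LV) ->|_]; rewrite ?orbT ?orbF.
Qed.

Let split_sum eta (f : config d E -> R) : local_on L f ->
  spin_sum V (fun s => f s * expR (- outer eta s)) sbar =
  spin_sum L f sbar * spin_sum (V `\` L)%fset (fun s => expR (- outer eta s)) sbar.
Proof.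
move=> lf; rewrite -[X in spin_sum X]VE (@spin_sum_split L _ _ _ (hull r V `\` L)%fset) //.
- by apply/fdisjointP => x xL; rewrite inE xL.
- by apply/fdisjointP => x xL; rewrite inE xL.
- by move=> z z' a; rewrite (outer_local eta a).
Qed.

Let numerator eta : cyl L (disorder xi) eta ->
  spin_sum L (fun s => \1_(inside eta) s * expR (- inner_energy Phi L (join_config s eta))) sbar =
  expR (- inner_energy Phi L xi).
Proof.
move=> eL; pose f s := expR (- inner_energy Phi L (join_config s eta)).
have lf : local_on L f by move=> s s' /(@inner_energy_join_local _ _ _ _ _ Phi_local L eta); rewrite /f => ->.
have -> : inner_energy Phi L xi = inner_energy Phi L (join_config (spins xi) eta).
  rewrite -{1}(join_spins xi); apply: (inner_energy_local Phi_local).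
  by apply: agree_join => //; exact: agree_sym.
rewrite -/(f _) (indic_cyl_sum (spins xi) sbar lf); apply: eq_spin_sum => s.
rewrite mulrC; congr (_ * _); rewrite !indicE; congr (_%:R).
congr (nat_of_bool _); apply/idP/idP => /set_mem h; apply/mem_set.
  by move/cyl_join : h => [/agree_sym].
by apply/cyl_join; split=> //; exact: agree_sym.
Qed.

Let lUL eta : local_on L (fun s => expR (- inner_energy Phi L (join_config s eta))).
Proof. by move=> s s' /(@inner_energy_join_local _ _ _ _ _ Phi_local L eta) ->. Qed.

Let linside eta : local_on L (fun s : config d E => \1_(inside eta) s : R).
Proof.
move=> s s' a; rewrite !indicE; congr (nat_of_bool _)%:R.
by apply/idP/idP => /set_mem /cyl_join[h1 h2]; apply/mem_set/cyl_join; split=> //;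
  [apply: agree_trans h1; exact: agree_sym|exact: agree_trans a h1].
Qed.

(** Given the spins outside [L], numerator and partition function differ from their
    free counterparts only through interactions that cross the boundary; each of
    the two costs one factor [expR b]. *)
Lemma gibbs_bounds eta : cyl L (disorder xi) eta ->
  expR (- (2 * b)) * boltzmann <= gibbs Phi V sbar eta (inside eta) <=
  expR (2 * b) * boltzmann.
Proof.
move=> eL.
have Zeta : Zfree Phi sbar L eta = Zfree Phi sbar L (disorder xi).
  exact: (Zfree_local Phi_local).
have Z0 : 0 < Zfree Phi sbar L (disorder xi) by exact: Zfree_gt0.
pose G := spin_sum (V `\` L)%fset (fun s => expR (- outer eta s)) sbar.
have G0 : 0 < G by exact: (spin_sum_expR_gt0 _ (fun s => - outer eta s)).
pose N := spin_sum V (fun s => \1_(inside eta) s * expR (- energy Phi V s eta)) sbar.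
have gE : gibbs Phi V sbar eta (inside eta) = N / partition_function Phi V sbar eta.
  by rewrite /gibbs mulrC.
have P0 := partition_function_gt0 Phi sbar V eta.
have hi s : expR (- energy Phi V s eta) <=
    expR b * (expR (- inner_energy Phi L (join_config s eta)) * expR (- outer eta s)).
  rewrite -!expRD ler_expR; have := energy_split eta s.
  by rewrite ler_norml => /andP[? ?]; lra.
have lo s : expR (- b) * (expR (- inner_energy Phi L (join_config s eta)) * expR (- outer eta s)) <=
    expR (- energy Phi V s eta).
  rewrite -!expRD ler_expR; have := energy_split eta s.
  by rewrite ler_norml => /andP[? ?]; lra.
have ind0 s : 0 <= \1_(inside eta) s :> R by rewrite indicE.
have Nhi : N <= expR b * (expR (- inner_energy Phi L xi) * G).
  rewrite -(numerator eL) -(split_sum eta); last first.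
    by move=> s s' a; rewrite (linside eta a) (lUL eta a).
  rewrite -spin_sumZ; apply: le_spin_sum => s; rewrite -mulrA mulrCA.
  by rewrite ler_wpM2l.
have Nlo : expR (- b) * (expR (- inner_energy Phi L xi) * G) <= N.
  rewrite -(numerator eL) -(split_sum eta); last first.
    by move=> s s' a; rewrite (linside eta a) (lUL eta a).
  rewrite -spin_sumZ; apply: le_spin_sum => s; rewrite -mulrA mulrCA.
  by rewrite ler_wpM2l.
have Phi_hi : partition_function Phi V sbar eta <=
    expR b * (Zfree Phi sbar L (disorder xi) * G).
  rewrite -Zeta /Zfree -(split_sum eta (lUL eta)) -spin_sumZ.
  exact: (@le_spin_sum d E R V (fun s => expR (- energy Phi V s eta)) _ sbar hi).
have Phi_lo : expR (- b) * (Zfree Phi sbar L (disorder xi) * G) <=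
    partition_function Phi V sbar eta.
  rewrite -Zeta /Zfree -(split_sum eta (lUL eta)) -spin_sumZ.
  exact: (@le_spin_sum d E R V _ (fun s => expR (- energy Phi V s eta)) sbar lo).
rewrite gE; move: (partition_function _ _ _ _) P0 Phi_hi Phi_lo => P P0 Phi_hi Phi_lo.
rewrite ler_pdivlMr // ler_pdivrMr //; apply/andP; split.
  apply: le_trans Nlo; apply: le_trans (ler_wpM2l _ Phi_hi) _.
    by rewrite !mulr_ge0 ?expR_ge0 // invr_ge0 ltW.
  have -> : - (2 * b) = - b + - b by ring.
  rewrite expRD !expRN le_eqVlt; apply/orP; left; apply/eqP; field.
  by rewrite !gt_eqF ?expR_gt0.
apply: le_trans Nhi _; apply: le_trans (ler_wpM2l _ Phi_lo); last first.
  by rewrite !mulr_ge0 ?expR_ge0 // invr_ge0 ltW.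
have -> : 2 * b = b + b by ring.
rewrite expRD !expRN le_eqVlt; apply/orP; left; apply/eqP; field.
by rewrite !gt_eqF ?expR_gt0.
Qed.

Lemma gibbs_local :
  local_on (hull r V) (fun eta => gibbs Phi V sbar eta (inside eta)).
Proof.
move=> eta eta' a; rewrite /gibbs (partition_function_local Phi_local Phi_range sbar a).
congr (_ * _); apply: eq_bigr => s _.
rewrite (energy_local Phi_local Phi_range (fsubset_refl _) a); congr (_ * _).
have LD : (L `<=` hull r V)%fset := fsubset_trans LV (sub_hull r V).
rewrite !indicE; congr (nat_of_bool _)%:R; have aL := agree_sub LD a.
by apply/idP/idP => /set_mem /cyl_join[h1 h2]; apply/mem_set/cyl_join; split=> //;
  [apply: agree_trans h2; exact: agree_sym|exact: agree_trans aL h2].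
Qed.

Lemma gibbs_outside eta : ~ cyl L (disorder xi) eta ->
  gibbs Phi V sbar eta (inside eta) = 0.
Proof.
move=> nL; rewrite /gibbs big1 ?mulr0 // => s _.
by rewrite indicE memNset ?mul0r // => /cyl_join[].
Qed.

Variable PP : probability (config d E') R.

Lemma joint_volume_bounds : exists2 k : R,
  joint_volume Phi PP V sbar (cyl L xi) = k%:E &
  expR (- (2 * b)) * boltzmann * pr PP L (disorder xi) <= k <=
  expR (2 * b) * boltzmann * pr PP L (disorder xi).
Proof.
have bg := local_bounded_mfun gibbs_local.
exists (Ex PP (fun eta => gibbs Phi V sbar eta (inside eta))).
  by rewrite /joint_volume EFin_Ex.
have mc := measurable_cyl L (disorder xi).
have bi : bounded_mfun (\1_(cyl L (disorder xi)) : config d E' -> R).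
  exact: bounded_mfun_indic.
rewrite /pr -(Ex_indic PP mc) -!ExZ //.
apply/andP; split; apply: le_Ex => //; try exact: bounded_mfunZ.
all: move=> eta; rewrite indicE; have [h|h] := pselect (cyl L (disorder xi) eta).
- by rewrite (mem_set h) mulr1; have /andP[] := gibbs_bounds h.
- by rewrite memNset // mulr0 gibbs_outside.
- by rewrite (mem_set h) mulr1; have /andP[] := gibbs_bounds h.
- by rewrite memNset // mulr0 gibbs_outside.
Qed.

End volume.

Definition cyl_weight (PP : probability (config d E') R) L xi : R :=
  expR (- inner_energy Phi L xi) / Zfree Phi sbar L (disorder xi) * pr PP L (disorder xi).

(** The bounds are uniform in the volume, and indicators of cylinders are
    continuous, so the bounds pass to weak limits. *)
Lemma joint_measure_bounds PP Ks L xi : joint_measure Phi PP sbar Ks ->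
  expR (- (2 * (C * #|` bdry r L|%:R))) * cyl_weight PP L xi <= pr Ks L xi <=
  expR (2 * (C * #|` bdry r L|%:R)) * cyl_weight PP L xi.
Proof.
move=> [V [KL [Vmono Vcover KLE KLcvg]]].
set b := C * _; set w := cyl_weight PP L xi.
have mc := measurable_cyl L xi.
have [N0 LV] : exists N0, forall N, (N0 <= N)%N -> (L `<=` V N)%fset.
  have mono M N : (M <= N)%N -> (V M `<=` V N)%fset.
    elim: N => [|N IH]; first by rewrite leqn0 => /eqP ->.
    rewrite leq_eqVlt => /predU1P[->//|/IH h]; exact: fsubset_trans (Vmono N).
  have [f hf] := choice Vcover.
  exists (\max_(x <- L) f x) => N hN; apply/fsubsetP => x xL.
  apply: (fsubsetP (mono (f x) N _)) (hf x); apply: leq_trans hN.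
  by rewrite (big_fsetD1 x) //= leq_maxl.
have bnd N : (N0 <= N)%N -> expR (- (2 * b)) * w <= pr (KL N) L xi <= expR (2 * b) * w.
  move=> /LV LVN; have [k kE kb] := joint_volume_bounds LVN xi PP.
  have -> : pr (KL N) L xi = k by rewrite /pr KLE // kE.
  by rewrite /w /cyl_weight (mulrA (expR (- _))) (mulrA (expR (2 * b))).
have cont : continuous (\1_(cyl L xi) : config d (E * E')%type -> R).
  apply: (@local_continuous _ _ _ L) => z z' a; rewrite !indicE.
  congr (nat_of_bool _)%:R; apply/idP/idP => /set_mem /= h; apply/mem_set.
    by apply: agree_trans h; exact: agree_sym.
  exact: agree_trans a h.
have cv := KLcvg _ cont _.
have {}cv : pr (KL N) L xi @[N --> \oo] --> pr Ks L xi.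
  have bI : bounded_mfun (\1_(cyl L xi) : config d (E * E')%type -> R).
    exact: bounded_mfun_indic.
  have [M hM] := bI.2; have := cv (ex_intro _ M hM).
  under eq_fun do rewrite -EFin_Ex // Ex_indic //.
  by rewrite -EFin_Ex // Ex_indic //; move/fine_cvg.
have cvP : cvgn (fun N => pr (KL N) L xi) by apply/cvg_ex; exists (pr Ks L xi).
rewrite -(cvg_lim _ cv) //; apply/andP; split.
  by apply: limr_ge => //; exists N0 => // N /= /bnd /andP[].
by apply: limr_le => //; exists N0 => // N /= /bnd /andP[].
Qed.

End gibbs_bounds.

(** * The disorder marginal *)
Section disorder_marginal.
Variables (R : realType) (d : nat) (E E' : finPointedType).

HB.instance Definition _ := isMeasurableFun.Build _ _
  (config d (E * E')%type) (config d E') (@disorder d E E')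
  (@measurable_disorder d E E').

Definition disorder_mfun : {mfun config d (E * E')%type >-> config d E'} :=
  [the {mfun _ >-> _} of @disorder d E E'].

Variable K : probability (config d (E * E')%type) R.
Implicit Types (L : {fset site d}) (xi : config d (E * E')%type) (eta : config d E').

Definition marginal : probability (config d E') R :=
  [the probability _ _ of distribution K disorder_mfun].

Lemma marginalE (A : set (config d E')) : marginal A = K (@disorder d E E' @^-1` A).
Proof. by []. Qed.

Lemma marginal_inv : invariant_measure K -> invariant_measure marginal.
Proof.
move=> K_inv x A mA; rewrite !marginalE.
have -> : @disorder d E E' @^-1` (shift_config x @^-1` A) =
    shift_config x @^-1` (@disorder d E E' @^-1` A) by [].
apply: K_inv; rewrite -[X in measurable X]setTI.
exact: (@measurable_disorder d E E').
Qed.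

Lemma Ex_marginal (f : config d E' -> R) : bounded_mfun f ->
  Ex marginal f = Ex K (f \o @disorder d E E').
Proof. by move=> bf; symmetry; apply: Ex_pushforward => //; exact: measurable_disorder. Qed.

Lemma pr_marginal_ge L xi : pr K L xi <= pr marginal L (disorder xi).
Proof.
have mc := measurable_cyl L (disorder xi).
have mpre : measurable (@disorder d E E' @^-1` cyl L (disorder xi)).
  by rewrite -[X in measurable X]setTI; exact: measurable_disorder.
apply: fine_le; rewrite ?fin_num_measure //; first exact: measurable_cyl.
apply: le_measure; rewrite ?inE //; first exact: measurable_cyl.
by move=> z /= h x xL; rewrite /disorder h.
Qed.

(** The cylinder of [eta] splits into the finitely many cylinders of the joint
    configurations over it, and one of them must have positive probability. *)
Lemma pr_marginal_gt0 L eta : 0 < pr marginal L eta ->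
  exists2 xi, agree L (disorder xi) eta & 0 < pr K L xi.
Proof.
pose B := @disorder d E E' @^-1` cyl L eta.
have mB : measurable B.
  by rewrite -[X in measurable X]setTI; apply: measurable_disorder => //; exact: measurable_cyl.
have -> : pr marginal L eta = Ex K (\1_B) by rewrite Ex_indic.
rewrite (@Ex_local _ _ _ K L _ point); last first.
  move=> z z' a; rewrite !indicE; congr (nat_of_bool _)%:R.
  by apply/idP/idP => /set_mem h; apply/mem_set => x xL; rewrite -(h x xL) /disorder a.
rewrite /spin_sum => p0; apply: contrapT => h; move: p0; rewrite big1 ?ltxx // => s _.
set z := glue_config s point.
rewrite indicE; have [zB|zB] := pselect (B z); last by rewrite memNset ?mul0r.
rewrite mem_set // mul1r; apply/eqP; rewrite eq_le pr_ge0 andbT leNgt.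
by apply/negP => z0; apply: h; exists z.
Qed.

End disorder_marginal.

(** * Relative entropy of joint measures *)
Section densitiesE.
Variables (R : realType) (d : nat) (S : finPointedType).
Variables (K P : probability (config d S) R).

Lemma entropy_densityE n :
  entropy_density K n = - (shannon K (box d n) / (vol d n)%:R).
Proof.
rewrite /entropy_density /shannon mulNr opprK mulrC; congr (_ / _).
have loc := ln_pr_local K (fsubset_refl (box d n)).
rewrite (Ex_local K point loc); apply: eq_bigr => w _.
by rewrite (cylinder_glue w point) mulrC.
Qed.

Lemma rel_entropy_densityE n : rel_entropy_density K P n =
  if `[< abs_cont K P (box d n) >] then (relent K P (box d n) / (vol d n)%:R)%:E else +oo%E.
Proof.
rewrite /rel_entropy_density rel_entropy_volumeE; case: ifP => _.
  by rewrite -EFinM mulrC.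
by rewrite gt0_muley // lte_fin invr_gt0 vol_pos.
Qed.

End densitiesE.

Section joint_entropy.
Variables (R : realType) (d : nat) (E E' : finPointedType).
Variable Phi : potential R d (E * E')%type.
Hypotheses (Phi_local : local_potential Phi).
Variable r : nat.
Hypothesis Phi_range : forall A : {fset site d}, (r < diam A)%N ->
  forall xi, Phi A xi = 0.
Variable C : R.
Hypotheses (C_ge0 : 0 <= C) (energy_le : forall D x xi,
  \sum_(A <- fpowerset D | x \in A) `|Phi A xi| <= C).
Variables (sbar : config d E) (PP : probability (config d E') R).
Variable Ks : probability (config d (E * E')%type) R.
Hypothesis Ks_joint : joint_measure Phi PP sbar Ks.
Variable K : probability (config d (E * E')%type) R.
Variable L : {fset site d}.
Local Notation b := (C * #|` bdry r L|%:R).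
Local Notation Kd := (marginal K).

Let Ks_bounds xi := joint_measure_bounds Phi_local Phi_range energy_le L xi Ks_joint.

Let weight0 xi : 0 < expR (- inner_energy Phi L xi) / Zfree Phi sbar L (disorder xi).
Proof. by rewrite divr_gt0 ?expR_gt0 // Zfree_gt0. Qed.

Lemma pr_joint_gt0 xi : (0 < pr Ks L xi) = (0 < pr PP L (disorder xi)).
Proof.
have /andP[lo hi] := Ks_bounds xi; apply/idP/idP => h.
  have := lt_le_trans h hi; rewrite /cyl_weight.
  by rewrite pmulr_rgt0 ?expR_gt0 // pmulr_rgt0.
by apply: lt_le_trans lo; rewrite /cyl_weight !mulr_gt0 ?expR_gt0 // invr_gt0 Zfree_gt0.
Qed.

(** Gibbs weights are positive, so that only the disorder can break absolute
    continuity. *)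
Lemma abs_cont_joint : abs_cont K Ks L <-> abs_cont Kd PP L.
Proof.
split=> ac z.
  move=> /pr_marginal_gt0[xi a /ac]; rewrite pr_joint_gt0.
  by rewrite (pr_local _ a).
by rewrite pr_joint_gt0 => k0; apply: ac; apply: lt_le_trans k0 (pr_marginal_ge _ _ _).
Qed.

(** On cylinders the joint measure is, up to a boundary factor, the product of the
    disorder distribution and of a Gibbs weight, so that its logarithm is a sum. *)
Lemma relent_joint : abs_cont Kd PP L ->
  `|relent K Ks L - (relent Kd PP L - shannon K L + shannon Kd L + Ex K (inner_energy Phi L) +
     Ex K (fun xi => ln (Zfree Phi sbar L (disorder xi))))| <= 2 * b.
Proof.
move=> acd; have ac : abs_cont K Ks L by exact/abs_cont_joint.
have lU : local_on L (inner_energy Phi L) := inner_energy_local Phi_local (L := L).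
have lZ : local_on L (fun xi : config d (E * E')%type => ln (Zfree Phi sbar L (disorder xi))).
  move=> xi xi' a; congr ln; apply: (Zfree_local Phi_local) => x xL.
  by rewrite /disorder a.
have lP : local_on L (fun xi : config d (E * E')%type => ln (pr PP L (disorder xi))).
  by move=> xi xi' a; congr ln; apply: pr_local => x xL; rewrite /disorder a.
have bU := local_bounded_mfun lU; have bZ := local_bounded_mfun lZ.
have bP := local_bounded_mfun lP.
have bK := bounded_ln_pr K L; have bKs := bounded_ln_pr Ks L.
have bd1 := bounded_ln_pr Kd L; have bd2 := bounded_ln_pr PP L.
pose f xi := ln (pr PP L (disorder xi)) - (inner_energy Phi L xi + ln (Zfree Phi sbar L (disorder xi))).
have lf : local_on L f by move=> xi xi' a; rewrite /f (lP _ _ a) (lU _ _ a) (lZ _ _ a).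
have bf := local_bounded_mfun lf.
have lKs := ln_pr_local Ks (fsubset_refl L).
have Exf : Ex K f = Ex K (fun xi => ln (pr PP L (disorder xi))) -
    (Ex K (inner_energy Phi L) + Ex K (fun xi => ln (Zfree Phi sbar L (disorder xi)))).
  by rewrite /f ExB //; [rewrite ExD|exact: bounded_mfunD].
have near xi : 0 < pr K L xi -> `|ln (pr Ks L xi) - f xi| <= 2 * b.
  move=> k0; have ks0 := ac xi k0; have p0 : 0 < pr PP L (disorder xi).
    by rewrite -pr_joint_gt0.
  have Z0 := Zfree_gt0 Phi sbar L (disorder xi).
  have w0 : 0 < cyl_weight Phi sbar PP L xi by rewrite /cyl_weight mulr_gt0.
  have lw : ln (cyl_weight Phi sbar PP L xi) = f xi.
    by rewrite /cyl_weight lnM ?posrE // ln_div ?posrE ?expR_gt0 // expRK /f; ring.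
  have /andP[lo hi] := Ks_bounds xi.
  have {}lo : - (2 * b) + f xi <= ln (pr Ks L xi).
    rewrite -lw -[X in X + _]expRK -lnM ?posrE ?expR_gt0 //.
    by rewrite ler_ln ?posrE // mulr_gt0 ?expR_gt0.
  have {}hi : ln (pr Ks L xi) <= 2 * b + f xi.
    rewrite -lw -[X in X + _]expRK -lnM ?posrE ?expR_gt0 //.
    by rewrite ler_ln ?posrE // mulr_gt0 ?expR_gt0.
  by rewrite ler_norml; apply/andP; split; lra.
have bcst := bounded_mfun_cst (T := config d (E * E')%type) (2 * b).
have upper : Ex K (fun xi => ln (pr Ks L xi)) <= Ex K f + 2 * b.
  rewrite -[X in _ + X](Ex_cst K) -ExD //; apply: (@le_Ex_pos _ _ _ K L) => //.
    by move=> xi xi' a; rewrite (lf _ _ a).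
  by move=> xi /near; rewrite ler_norml => /andP[_ h]; lra.
have lower : Ex K f <= Ex K (fun xi => ln (pr Ks L xi)) + 2 * b.
  rewrite -[X in _ + X](Ex_cst K) -ExD //; apply: (@le_Ex_pos _ _ _ K L) => //.
    by move=> xi xi' a; rewrite (lKs _ _ a).
  by move=> xi /near; rewrite ler_norml => /andP[h _]; lra.
have e1 : relent K Ks L = - shannon K L - Ex K (fun xi => ln (pr Ks L xi)).
  by rewrite /relent ExB // /shannon opprK.
have e2 : relent Kd PP L + shannon Kd L = - Ex K (fun xi => ln (pr PP L (disorder xi))).
  rewrite /relent ExB // /shannon -(Ex_marginal K bd2) addrAC subrr sub0r //.
rewrite e1; move: e2 Exf upper lower; move: (relent Kd _ _) (shannon Kd _) (shannon K _).
move: (Ex K (fun xi => ln (pr PP L (disorder xi)))) (Ex K _) (Ex K _) (Ex K _) (Ex K _).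
move=> *; rewrite ler_norml; apply/andP; split; lra.
Qed.

End joint_entropy.

Section relative_entropy_formula.
Variables (R : realType) (d : nat) (E E' : finPointedType).
Variables (Phi : potential R d (E * E')%type).
Hypotheses (Phi_local : local_potential Phi) (Phi_range : finite_range Phi)
  (Phi_inv : potential_invariant Phi).
Variables (PP : probability (config d E') R) (sbar : config d E)
  (Ks K : probability (config d (E * E')%type) R).
Hypotheses (PP_dec : asymptotically_decoupled PP)
  (Ks_joint : joint_measure Phi PP sbar Ks) (K_inv : invariant_measure K).

Local Notation Kd := (marginal K).

(** The error in [relent_joint], of the order of the boundary, disappears after
    division by the volume. *)
Lemma relent_difference_cvg (hK hKd eU lp : R) :
  (forall n, abs_cont Kd PP (box d n)) ->
  shannon K (box d n) / (vol d n)%:R @[n --> \oo] --> hK ->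
  shannon Kd (box d n) / (vol d n)%:R @[n --> \oo] --> hKd ->
  Ex K (inner_energy Phi (box d n)) / (vol d n)%:R @[n --> \oo] --> eU ->
  Ex K (fun xi => pressure_density Phi sbar (disorder xi) n) @[n --> \oo] --> lp ->
  relent K Ks (box d n) / (vol d n)%:R - relent Kd PP (box d n) / (vol d n)%:R
    @[n --> \oo] --> - hK + hKd + eU + lp.
Proof.
move=> acd cK cKd cU cp; have [r Phi0] := Phi_range.
have [C C0 CE] := abs_energy_bounded Phi_local Phi_inv Phi0.
pose rest n := - (shannon K (box d n) / (vol d n)%:R) + shannon Kd (box d n) / (vol d n)%:R +
  Ex K (inner_energy Phi (box d n)) / (vol d n)%:R +
  Ex K (fun xi => pressure_density Phi sbar (disorder xi) n).
have crest : rest n @[n --> \oo] --> - hK + hKd + eU + lp.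
  by apply: cvgD => //; apply: cvgD => //; apply: cvgD => //; exact: cvgN.
pose err n := relent K Ks (box d n) / (vol d n)%:R -
  relent Kd PP (box d n) / (vol d n)%:R - rest n.
have -> : (fun n => relent K Ks (box d n) / (vol d n)%:R -
    relent Kd PP (box d n) / (vol d n)%:R) = fun n => err n + rest n.
  by apply/funext => n; rewrite /err subrK.
apply: (cvg_to_eq _ (add0r (- hK + hKd + eU + lp))); apply: cvgD => //.
apply/cvgrPdist_le => e e0.
have C30 : 0 <= 3 * C by rewrite mulr_ge0.
have [N hN] := layer_small d r C30 e0.
exists N => // n /= /hN[rn ln]; rewrite sub0r normrN; apply: le_trans ln.
have vn := vol_pos R d n.
have h1 := relent_joint Phi_local Phi0 CE Ks_joint (acd n).
have bl := bdry_layer R d rn.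
have h2 : `|Ex K (fun xi => pressure_density Phi sbar (disorder xi) n) -
    Ex K (fun xi => ln (Zfree Phi sbar (box d n) (disorder xi))) / (vol d n)%:R| <=
    C * #|` bdry r (box d n)|%:R / (vol d n)%:R.
  have bp : bounded_mfun (fun xi : config d (E * E')%type =>
      pressure_density Phi sbar (disorder xi) n).
    apply: (local_bounded_mfun (L := hull r (box d n))).
    exact: (@local_on_disorder d E E' R _ _ (pressure_local Phi_local Phi0 sbar (n := n))).
  have bZ : bounded_mfun (fun xi : config d (E * E')%type =>
      ln (Zfree Phi sbar (box d n) (disorder xi))).
    apply: (local_bounded_mfun (L := box d n)) => xi xi' a; congr ln.
    by apply: (Zfree_local Phi_local) => x xL; rewrite /disorder a.
  rewrite [X in _ - X]mulrC -ExZ //.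
  apply: Ex_close => //; first exact: bounded_mfunZ.
  move=> xi; rewrite pressureE [X in _ - X]mulrC -mulrBl normrM [X in _ * X]ger0_norm ?invr_ge0 //.
  rewrite ler_wpM2r ?invr_ge0 //.
  exact: (partition_function_free Phi0 C0 CE).
have {}h1 : `|(relent K Ks (box d n) - (relent Kd PP (box d n) - shannon K (box d n) +
     shannon Kd (box d n) + Ex K (inner_energy Phi (box d n)) +
     Ex K (fun xi => ln (Zfree Phi sbar (box d n) (disorder xi))))) / (vol d n)%:R| <=
    2 * (C * #|` bdry r (box d n)|%:R / (vol d n)%:R).
  rewrite normrM [X in _ * X]ger0_norm ?invr_ge0 // mulrA.
  by rewrite ler_wpM2r ?invr_ge0.
have {}bl : C * #|` bdry r (box d n)|%:R / (vol d n)%:R <= C * layer d n r.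
  by rewrite -mulrA ler_wpM2l.
have dist (a k eK eD u z v : R) : (a - (k - eK + eD + u + z)) * v =
  a * v - (k * v - eK * v + eD * v + u * v + z * v) by ring.
rewrite dist in h1; rewrite -[leRHS]mulrA /err /rest; move: h1 h2 bl.
move: (C * layer _ _ _) (C * _ / _) => c1 c2.
do 6 move: (_ / _); move: (Ex K (fun _ => pressure_density _ _ _ _)).
move=> x1 x2 x3 x4 x5 x6 x7; rewrite !ler_norml => /andP[? ?] /andP[? ?] ?.
by apply/andP; split; lra.
Qed.

End relative_entropy_formula.

Local Open Scope ereal_scope.

Theorem theorem11 (R : realType) (d : nat) (hd : (0 < d)%N)
    (E E' : finPointedType)
    (Phi : potential R d (E * E')) (Phi_local : local_potential Phi)
    (Phi_range : finite_range Phi) (Phi_inv : potential_invariant Phi)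
    (PP : probability (config d E') R) (PP_dec : asymptotically_decoupled PP)
    (sbar : config d E)
    (Ks : probability (config d (E * E')) R)
    (Ks_joint : joint_measure Phi PP sbar Ks) (Ks_inv : invariant_measure Ks)
    (K : probability (config d (E * E')) R) (K_inv : invariant_measure K) :
  let Kd := pushforward K (@disorder d E E') in
  [/\ cvgn (rel_entropy_density K Ks),
      cvgn (rel_entropy_density Kd PP),
      cvgn (entropy_density K) /\ cvgn (entropy_density Kd),
      {ae K, forall xi, cvgn (pressure_density Phi sbar (disorder xi))}
    & rel_entropy K Ks =
        rel_entropy Kd PP - (entropy K)%:E + (entropy Kd)%:E
        + \sum_(A \in [set A : {fset site d} | (0%R : site d) \in A])
            ((#|` A|%:R)^-1)%:E * \int[K]_xi (Phi A xi)%:E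
        + \int[K]_xi (limn (pressure_density Phi sbar (disorder xi)))%:E].
Proof.
move=> Kd.
have KdE : Kd = marginal K by [].
have Kd_inv := marginal_inv K_inv.
have [r Phi0] := Phi_range.
have [C C0 CE] := abs_energy_bounded Phi_local Phi_inv Phi0.
have [hK cK] := shannon_density_cvg K_inv.
have [hKd cKd] := shannon_density_cvg Kd_inv.
have ae := pressure_ae Phi_local Phi_inv Phi0 C0 CE sbar K_inv.
have [lp lpE cp] := Ex_pressure Phi_local Phi_inv Phi0 C0 CE sbar K_inv.
have cU := Ex_inner_energy Phi_local Phi_inv Phi0 C0 CE K_inv.
have eUE := Ex_site_energy Phi_local Phi0 K.
move: (Ex K (site_energy Phi r)) cU eUE => eU cU eUE.
have dK : entropy_density K n @[n --> \oo] --> (- hK)%R.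
  by under eq_fun do rewrite entropy_densityE; exact: cvgN.
have dKd : entropy_density (marginal K) n @[n --> \oo] --> (- hKd)%R.
  by under eq_fun do rewrite entropy_densityE; exact: cvgN.
have entK : entropy K = hK by rewrite /entropy (cvg_lim _ dK) // opprK.
have entKd : entropy (marginal K) = hKd by rewrite /entropy (cvg_lim _ dKd) // opprK.
have box_mono m n : (m <= n)%N -> abs_cont (marginal K) PP (box d n) ->
    abs_cont (marginal K) PP (box d m).
  by move=> mn; apply: abs_cont_sub; exact: box_sub.
pose l : R := (- hK + hKd + eU + lp)%R.
have acE n : `[< abs_cont K Ks (box d n) >] = `[< abs_cont (marginal K) PP (box d n) >].
  by apply: asbool_equiv_eq; exact: (abs_cont_joint Phi_local Phi0 CE Ks_joint K).
suff [h [crel cjoint]] : exists h : \bar R,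
    [/\ h != -oo, rel_entropy_density (marginal K) PP n @[n --> \oo] --> h &
        rel_entropy_density K Ks n @[n --> \oo] --> h + l%:E].
  move=> cjoint'; rewrite KdE; split.
  - by apply/cvg_ex; exists (h + l%:E).
  - by apply/cvg_ex; exists h.
  - by split; apply/cvg_ex; [exists (- hK)%R|exists (- hKd)%R].
  - exact: ae.
  rewrite /rel_entropy (cvg_lim _ cjoint') // (cvg_lim _ cjoint) // entK entKd eUE lpE.
  by rewrite -EFinN -!addeA -!EFinD /l !addrA.
(* If absolute continuity fails in one box, it fails in all larger ones, for the
   joint measures as for the marginals. *)
have [ac|] := pselect (forall n, abs_cont (marginal K) PP (box d n)); last first.
  move=> /existsNP[n0 nac]; exists +oo; split=> //.
    apply: cvg_near_cst; exists n0 => // n /= n0n.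
    by rewrite rel_entropy_densityE; case: asboolP => // /(box_mono _ _ n0n).
  apply: cvg_near_cst; exists n0 => // n /= n0n.
  by rewrite rel_entropy_densityE acE; case: asboolP => // /(box_mono _ _ n0n).
have dif := relent_difference_cvg Phi_local Phi_range Phi_inv Ks_joint ac cK cKd cU cp.
have relE n : rel_entropy_density (marginal K) PP n =
    (relent (marginal K) PP (box d n) / (vol d n)%:R)%R%:E.
  by rewrite rel_entropy_densityE; case: asboolP => // /(_ (ac n)).
have jointE n : rel_entropy_density K Ks n = rel_entropy_density (marginal K) PP n +
    (relent K Ks (box d n) / (vol d n)%:R -
      relent (marginal K) PP (box d n) / (vol d n)%:R)%R%:E.
  rewrite relE -EFinD rel_entropy_densityE acE; case: asboolP => [_|/(_ (ac n))//].
  by rewrite addrC subrK.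
have dif' : (relent K Ks (box d n) / (vol d n)%:R -
    relent (marginal K) PP (box d n) / (vol d n)%:R)%R%:E @[n --> \oo] --> l%:E.
  by apply: cvg_EFin => //; exact: nearW.
have join h : h != -oo -> rel_entropy_density (marginal K) PP n @[n --> \oo] --> h ->
    rel_entropy_density K Ks n @[n --> \oo] --> h + l%:E.
  move=> hoo ch; under eq_fun do rewrite jointE.
  by apply: cvgeD => //; exact: fin_num_adde_defl.
have [[h ch]|ch] := rel_density_cvg Kd_inv PP_dec ac.
  have ch' : rel_entropy_density (marginal K) PP n @[n --> \oo] --> h%:E.
    by under eq_fun do rewrite relE; apply: cvg_EFin => //; exact: nearW.
  by exists h%:E; split=> //; exact: join.
have ch' : rel_entropy_density (marginal K) PP n @[n --> \oo] --> +oo.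
  by under eq_fun do rewrite relE.
by exists +oo; split=> //; exact: join.
Qed.
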